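(* Fix $d$. There is a randomized algorithm which, given a set $S\subset\mathbb{R}^d$ of $n$ points and a positive integer $k$, finds a covering of $S$ by $O_d(n/k)$ homothets of $B^d$ each containing at most $k$ points of $S$, in expected $O_d(n^2/k)$ time.
   Context: $B^d$ is the unit Euclidean ball in $\mathbb{R}^d$; its homothets are the Euclidean balls $\lambda B^d+x$ ($\lambda>0$, $x\in\mathbb{R}^d$). A covering of $S$ is a family whose union contains $S$. The constants hidden in $O_d$ depend only on $d$.
   Formalization: For k much larger than n the bounds O_d(n/k) and O_d(n²/k) cannot hold literally (one point and huge k still need one ball and some time), so they are stated as O_d(n/k + 1) balls and O_d(n²/k + n + 1) expected time, which agree with the original whenever 1 ≤ k ≤ n. *)

(* Defs.v *)
(* concrete reals R, lists.
   A minimal randomized real-RAM model, so that "randomized algorithm running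
   in expected time T" can be stated. *)
From Stdlib Require Import Reals Lra List Arith.
Import ListNotations.
Open Scope R_scope.

(* A point of R^d is a list of d reals. *)
Definition dist2 (d : nat) (x c : list R) : R :=
  fold_right Rplus 0
    (map (fun j => (nth j x 0 - nth j c 0) ^ 2) (seq 0 d)).

Definition in_ball (d : nat) (c : list R) (lambda : R) (x : list R) : Prop :=
  sqrt (dist2 d x c) <= lambda.

Definition in_ballb (d : nat) (c : list R) (lambda : R) (x : list R) : bool :=
  if Rle_dec (sqrt (dist2 d x c)) lambda then true else false.

Definition count_in_ball (d : nat) (S : list (list R)) (c : list R) (lambda : R) : nat :=
  length (filter (in_ballb d c lambda) S).

(* Memory: real registers rm : nat -> R and integer registers im : nat -> nat.
   Real registers are addressed indirectly through integer registers. *)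
Inductive instr : Type :=
| RZero (a : nat)
| ROne (a : nat)
| RAdd (a b c : nat)
| RSub (a b c : nat)
| RMul (a b c : nat)
| RDiv (a b c : nat)
| RSqrt (a b : nat)
| RLeJ (a b j : nat)
| ROfNat (a b : nat)
| ISet (a m : nat)
| IAdd (a b c : nat)
| ISub (a b c : nat)              (* im a := im b - im c (truncated) *)
| ILoad (a b : nat)
| IStore (a b : nat)
| ILeJ (a b j : nat)
| Jmp (j : nat)
| Rand (a : nat)
| Halt.

Record state : Type := mkState {
  pc : nat;
  rm : nat -> R;
  im : nat -> nat }.

Definition updR (f : nat -> R) (i : nat) (v : R) : nat -> R :=
  fun x => if Nat.eqb x i then v else f x.
Definition updN (f : nat -> nat) (i : nat) (v : nat) : nat -> nat :=
  fun x => if Nat.eqb x i then v else f x.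

Definition program := list instr.

Definition cur (p : program) (s : state) : instr := nth (pc s) p Halt.

(* one step; [bit] is the fresh random bit available at this step *)
Definition step (p : program) (bit : bool) (s : state) : state :=
  let r := rm s in let m := im s in let nx := S (pc s) in
  let setR a v := mkState nx (updR r (m a) v) m in
  let setN a v := mkState nx r (updN m a v) in
  match cur p s with
  | RZero a => setR a 0
  | ROne a => setR a 1
  | RAdd a b c => setR a (r (m b) + r (m c))
  | RSub a b c => setR a (r (m b) - r (m c))
  | RMul a b c => setR a (r (m b) * r (m c))
  | RDiv a b c => setR a (r (m b) / r (m c))
  | RSqrt a b => setR a (sqrt (r (m b)))
  | RLeJ a b j => mkState (if Rle_dec (r (m a)) (r (m b)) then j else nx) r m
  | ROfNat a b => setR a (INR (m b))
  | ISet a v => setN a v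
  | IAdd a b c => setN a (m b + m c)%nat
  | ISub a b c => setN a (m b - m c)%nat
  | ILoad a b => setN a (m (m b))
  | IStore a b => setN (m a) (m b)
  | ILeJ a b j => mkState (if Nat.leb (m a) (m b) then j else nx) r m
  | Jmp j => mkState j r m
  | Rand a => setN a (if bit then 1%nat else 0%nat)
  | Halt => s
  end.

Definition halted (p : program) (s : state) : bool :=
  match cur p s with Halt => true | _ => false end.

Fixpoint run (p : program) (bits : list bool) (s : state) : state :=
  match bits with
  | [] => s
  | b :: bs => run p bs (step p b s)
  end.

Fixpoint all_bits (t : nat) : list (list bool) :=
  match t with
  | O => [[]]
  | S t' => map (cons false) (all_bits t') ++ map (cons true) (all_bits t')
  end.

(* Pr[running time > t] = Pr[not halted after t steps] *)
Definition prob_not_halted (p : program) (s0 : state) (t : nat) : R :=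
  INR (length (filter (fun b => negb (halted p (run p b s0))) (all_bits t)))
  / 2 ^ t.

(* E[T] = sum_{t>=0} Pr[T > t]; "E[T] <= B" iff all partial sums are <= B *)
Definition expected_time_le (p : program) (s0 : state) (B : R) : Prop :=
  forall N : nat,
    fold_right Rplus 0 (map (prob_not_halted p s0) (seq 0 N)) <= B.

(* Input: im 0 = n, im 1 = k, im 2 = d; coordinate j of point i is
   rm (i*d + j); all other registers are 0. *)
Definition init_state (d : nat) (S : list (list R)) (k : nat) : state :=
  mkState 0
    (fun x => if Nat.ltb x (length S * d) then
                nth (x mod d) (nth (x / d) S []) 0 else 0)
    (fun x => match x with 0 => length S | 1 => k | 2 => d | _ => 0 end)%nat.

Definition out_count (s : state) : nat := im s 0.
Definition out_center (d : nat) (s : state) (i : nat) : list R :=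
  map (fun j => rm s (i * (d + 1) + j)) (seq 0 d).
Definition out_radius (d : nat) (s : state) (i : nat) : R :=
  rm s (i * (d + 1) + d).

Definition good_cover_output (d : nat) (C : R) (S : list (list R)) (k : nat)
    (s : state) : Prop :=
  let m := out_count s in
  INR m <= C * (INR (length S) / INR k + 1) /\
  (forall i, (i < m)%nat -> 0 < out_radius d s i) /\
  (forall x, In x S -> exists i, (i < m)%nat /\
        in_ball d (out_center d s i) (out_radius d s i) x) /\
  (forall i, (i < m)%nat ->
        (count_in_ball d S (out_center d s i) (out_radius d s i) <= k)%nat).

Definition valid_input (d : nat) (S : list (list R)) (k : nat) : Prop :=
  NoDup S /\ Forall (fun x => length x = d) S /\ (1 <= k)%nat.

(* Main.v *)
Require Import Defs.
From Stdlib Require Import Reals List.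
From Stdlib Require Import Lra Lia Arith ZArith Bool.
Import ListNotations.
Open Scope R_scope.

(* Give every point x the radius r_x at which its ball holds m points of a table
   T.  Centers picked greedily by decreasing radius among the points not yet
   covered by open balls are far apart compared with their radii, so that by the
   60-degree argument of Besicovitch boundedly many of the balls meet and there
   are only O(|T| / m + 1) of them.  The exact table T = S with m = k + 1 yields
   balls with at most k points, but costs n^2 k.

   Two samplings save time.  With b = floor(k^(1/4)), the table consists of about
   16 n b / k random draws and m = b.  By a Chernoff bound a given ball contains
   more than k points ("heavy") with probability at most e^(-3b); a heavy ball is
   replaced by a tiny one, and when more than n / k of them are met the run is
   repeated with the exact table, which happens with probability at most
   k e^(-3b) and is therefore cheap on average.  Moreover, the greedy choice is
   made first among n / b^2 random points only.  By exchangeability, the expected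
   number of points that its balls miss is at most 2 b^2 times the number of
   balls, and a second greedy choice among these points completes the cover. *)

(** * Expected running time of machine states *)

(** The exponent 1/4 is forced from both sides. One radius takes up to b rounds over the table,
    about n b^2 / k steps; for all n points this exceeds the budget by the factor b^2, hence the
    first attempt with n / b^2 points. The points missed are O(b^2 n / k) on average and cost n b^2
    / k each, in total b^4 n^2 / k^2, which is affordable when b^4 <= k. Conversely, a draw costs
    log n coin flips, and n / b^2 draws fit into n^2 / k because k < (b + 1)^4 <= 16 b^4; this also
    bounds k^3 e^(-3b), as the rerun requires.

    Sampling influences the running time alone: each ball is measured against all of S before it is
    written, so every halting run is correct. The greedy argument wants open balls and the output
    closed ones; a slightly smaller closed ball contains the same points of S.

    To reach the register machine, the algorithm is written in a small structured language whose
    compiler is proved correct together with expected cost; one unit of abstract cost is worth a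
    number of machine steps that depends only on d. *)

Definition etime (p : program) (N : nat) (s : state) : R :=
  fold_right Rplus 0 (map (prob_not_halted p s) (seq 0 N)).

Lemma filter_map_length {A B : Type} (f : B -> bool) (g : A -> B) (l : list A) :
  length (filter f (map g l)) = length (filter (fun x => f (g x)) l).
Proof. induction l as [|x l IH]; simpl; [reflexivity|]. destruct (f (g x)); simpl; lia. Qed.

(** Conditioning on the first bit: [all_bits (S t)] lists the strings that begin with 0 and then, in
    equal number, those that begin with 1. *)
Lemma prob_not_halted_S p s t :
  prob_not_halted p s (S t) =
  (prob_not_halted p (step p false s) t + prob_not_halted p (step p true s) t) / 2.
Proof.
  unfold prob_not_halted. simpl all_bits.
  rewrite filter_app, length_app, !filter_map_length, plus_INR. simpl.
  field. apply pow_nonzero. lra.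
Qed.

Lemma prob_not_halted_0 p s : prob_not_halted p s 0 <= 1.
Proof.
  unfold prob_not_halted. simpl. destruct (halted p s); simpl; lra.
Qed.

Lemma etime_S p N s :
  etime p (S N) s <=
  1 + (etime p N (step p false s) + etime p N (step p true s)) / 2.
Proof.
  unfold etime. simpl. rewrite <- seq_shift, map_map.
  assert (H : fold_right Rplus 0 (map (fun x => prob_not_halted p s (S x)) (seq 0 N)) =
    (fold_right Rplus 0 (map (prob_not_halted p (step p false s)) (seq 0 N)) +
     fold_right Rplus 0 (map (prob_not_halted p (step p true s)) (seq 0 N))) / 2).
  { induction (seq 0 N) as [|x l IH]; simpl; [lra|]. rewrite IH, prob_not_halted_S. lra. }
  rewrite H. pose proof (prob_not_halted_0 p s). lra.
Qed.

Lemma run_halted p bits s : halted p s = true -> run p bits s = s.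
Proof.
  intros H. induction bits as [|b bits IH]; simpl; [reflexivity|].
  replace (step p b s) with s; [exact IH|].
  unfold halted in H. unfold step. destruct (cur p s); try discriminate. reflexivity.
Qed.

Lemma etime_halted p N s : halted p s = true -> etime p N s = 0.
Proof.
  intros H. unfold etime. induction (seq 0 N) as [|t l IH]; simpl; [reflexivity|].
  rewrite IH. unfold prob_not_halted.
  replace (filter _ _) with (@nil (list bool)); [simpl; lra|].
  symmetry. induction (all_bits t) as [|b m IHm]; simpl; [reflexivity|].
  rewrite run_halted by exact H. rewrite H. exact IHm.
Qed.

(** Time and correctness are kept together so that one induction yields both. Correctness is
    demanded of every bit string that leads to a halted state, not just of almost all. *)
Definition within (p : program) (G : state -> Prop) (s : state) (B : R) : Prop :=
  (forall N, etime p N s <= B) /\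
  (forall bits, halted p (run p bits s) = true -> G (run p bits s)).

Lemma within_weaken p G s B B' : within p G s B -> B <= B' -> within p G s B'.
Proof. intros [H1 H2] HB. split; [|exact H2]. intros N. specialize (H1 N). lra. Qed.

Lemma within_halted p G s B :
  halted p s = true -> G s -> 0 <= B -> within p G s B.
Proof.
  intros H HG HB. split.
  - intros N. rewrite etime_halted by exact H. exact HB.
  - intros bits _. rewrite run_halted; assumption.
Qed.

Lemma within_flip p G s B0 B1 :
  halted p s = false ->
  within p G (step p false s) B0 -> within p G (step p true s) B1 ->
  within p G s ((B0 + B1) / 2 + 1).
Proof.
  intros H [A0 S0] [A1 S1]. split.
  - intros [|N].
    (* The sums are empty here: the bounds at 0 say that [B0] and [B1] are nonnegative, which is
       enough. *)
    + specialize (A0 0%nat). specialize (A1 0%nat). unfold etime in *. simpl in *. lra.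
    + pose proof (etime_S p N s). specialize (A0 N). specialize (A1 N). lra.
  - intros [|b bits]; simpl; intros Hh; [congruence|].
    destruct b; auto.
Qed.

Lemma within_step p G s s' B :
  halted p s = false -> (forall b, step p b s = s') ->
  within p G s' B -> within p G s (B + 1).
Proof.
  intros H Hs HW. replace (B + 1) with ((B + B) / 2 + 1) by lra.
  apply within_flip; [exact H| |]; rewrite Hs; exact HW.
Qed.

(** * Straight-line machine code *)

Definition memory : Type := ((nat -> R) * (nat -> nat))%type.

Definition at_pc (a : nat) (m : memory) : state := mkState a (fst m) (snd m).

Definition straight (i : instr) : bool :=
  match i with
  | RLeJ _ _ _ | ILeJ _ _ _ | Jmp _ | Rand _ | Halt => false
  | _ => true
  end.

(** Agrees with [step] on the instructions that [straight] accepts. The others are no-ops, since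
    [exec] describes straight-line code only. *)
Definition exec1 (i : instr) (mm : memory) : memory :=
  let (r, m) := mm in
  match i with
  | RZero a => (updR r (m a) 0, m)
  | ROne a => (updR r (m a) 1, m)
  | RAdd a b c => (updR r (m a) (r (m b) + r (m c)), m)
  | RSub a b c => (updR r (m a) (r (m b) - r (m c)), m)
  | RMul a b c => (updR r (m a) (r (m b) * r (m c)), m)
  | RDiv a b c => (updR r (m a) (r (m b) / r (m c)), m)
  | RSqrt a b => (updR r (m a) (sqrt (r (m b))), m)
  | ROfNat a b => (updR r (m a) (INR (m b)), m)
  | ISet a v => (r, updN m a v)
  | IAdd a b c => (r, updN m a (m b + m c)%nat)
  | ISub a b c => (r, updN m a (m b - m c)%nat)
  | ILoad a b => (r, updN m a (m (m b)))
  | IStore a b => (r, updN m (m a) (m b))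
  | _ => (r, m)
  end.

Definition exec (l : list instr) (mm : memory) : memory :=
  fold_left (fun x i => exec1 i x) l mm.

Lemma exec_app l1 l2 mm : exec (l1 ++ l2) mm = exec l2 (exec l1 mm).
Proof. apply fold_left_app. Qed.

Lemma exec_cons i l mm : exec (i :: l) mm = exec l (exec1 i mm).
Proof. reflexivity. Qed.

Lemma exec_nil mm : exec [] mm = mm.
Proof. reflexivity. Qed.

Definition code_at (p : program) (a : nat) (l : list instr) : Prop :=
  forall j, (j < length l)%nat -> nth (a + j) p Halt = nth j l Halt.

Lemma code_at_app p a l1 l2 :
  code_at p a (l1 ++ l2) -> code_at p a l1 /\ code_at p (a + length l1) l2.
Proof.
  intros H. split; intros j Hj.
  - rewrite H by (rewrite length_app; lia). apply app_nth1. exact Hj.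
  - rewrite <- Nat.add_assoc, H by (rewrite length_app; lia).
    rewrite app_nth2 by lia. f_equal. lia.
Qed.

Lemma code_at_hd p a i l : code_at p a (i :: l) -> nth a p Halt = i.
Proof. intros H. specialize (H 0%nat). simpl in H. rewrite Nat.add_0_r in H. apply H. lia. Qed.

Lemma code_at_tl p a i l : code_at p a (i :: l) -> code_at p (S a) l.
Proof.
  intros H j Hj. specialize (H (S j)). simpl in H.
  rewrite Nat.add_succ_r in H. apply H. simpl. lia.
Qed.

Lemma within_straight p G l : forall a mm B,
  code_at p a l -> forallb straight l = true ->
  within p G (at_pc (a + length l) (exec l mm)) B ->
  within p G (at_pc a mm) (B + INR (length l)).
Proof.
  induction l as [|i l IH]; intros a mm B Hc Hs HW.
  - simpl in *. rewrite Nat.add_0_r in HW. eapply within_weaken; [exact HW|lra].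
  - simpl forallb in Hs. apply andb_true_iff in Hs. destruct Hs as [Hi Hl].
    replace (INR (length (i :: l))) with (INR (length l) + 1)
      by (change (length (i :: l)) with (S (length l)); rewrite S_INR; lra).
    rewrite <- Rplus_assoc.
    pose proof (code_at_hd _ _ _ _ Hc) as Hhd.
    apply within_step with (s' := at_pc (S a) (exec1 i mm)).
    + unfold halted, cur, at_pc. simpl. rewrite Hhd.
      destruct i; simpl in Hi; congruence.
    + intros b. unfold step, cur, at_pc. simpl. rewrite Hhd.
      destruct mm as [r m]. destruct i; simpl in Hi; try discriminate; reflexivity.
    + apply IH.
      * eapply code_at_tl; exact Hc.
      * exact Hl.
      * simpl length in HW. rewrite Nat.add_succ_r in HW. exact HW.
Qed.

Lemma within_jmp p G a t mm B :
  nth a p Halt = Jmp t -> within p G (at_pc t mm) B -> within p G (at_pc a mm) (B + 1).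
Proof.
  intros H HW. eapply within_step; [| |exact HW].
  - unfold halted, cur, at_pc. simpl. rewrite H. reflexivity.
  - intros b. unfold step, cur, at_pc. simpl. rewrite H. reflexivity.
Qed.

(** * A structured language and its compiler *)

(* Integer registers are interleaved: cell [i] of integer array [a < 28] is
   register [30 * i + a], so array [28] is free for temporaries and register 29
   holds the base address of the real arrays.  Scalars are cells of index 0,
   and the inputs [n], [k] are scalars 0 and 1 already.  Likewise cell [i] of
   real array [a < stride] is register [base + stride * i + a], array 0 being
   reserved for temporaries; registers below [base] hold first the input and
   finally the output. *)

Inductive iexp : Type :=
| IC (n : nat)
| IA (a : nat) (e : iexp)
| IPlus (e1 e2 : iexp).

Inductive rop : Type := OpAdd | OpSub | OpMul | OpDiv.

Inductive rexp : Type :=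
| RC0
| RC1
| RA (a : nat) (e : iexp)
| RN (e : iexp)
| ROp (o : rop) (e1 e2 : rexp)
| RRoot (e : rexp).

Inductive bexp : Type :=
| BI (e1 e2 : iexp)
| BR (e1 e2 : rexp).

Inductive cmd : Type :=
| Skip
| SetI (a : nat) (e1 e2 : iexp)
| SetR (a : nat) (e1 : iexp) (e2 : rexp)
| SetLow (e1 : iexp) (e2 : rexp)
| GetLow (a : nat) (e1 e2 : iexp)
| Flip (a : nat)
| Seq (c1 c2 : cmd)
| If (b : bexp) (c1 c2 : cmd)
| While (b : bexp) (c : cmd).

Record store : Type := mkStore {
  ia : nat -> nat -> nat;
  ra : nat -> nat -> R;
  low : nat -> R }.

Arguments ia s (a i)%_nat_scope : extra scopes.
Arguments ra s (a i)%_nat_scope : extra scopes.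
Arguments low s i%_nat_scope : extra scopes.

Definition upd2 {A : Type} (f : nat -> nat -> A) (a i : nat) (v : A) : nat -> nat -> A :=
  fun a' i' => if Nat.eqb a' a then (if Nat.eqb i' i then v else f a' i') else f a' i'.

Definition setI (s : store) (a i v : nat) : store :=
  mkStore (upd2 (ia s) a i v) (ra s) (low s).
Definition setR (s : store) (a i : nat) (v : R) : store :=
  mkStore (ia s) (upd2 (ra s) a i v) (low s).
Definition setLow (s : store) (i : nat) (v : R) : store :=
  mkStore (ia s) (ra s) (updR (low s) i v).

Fixpoint ieval (e : iexp) (s : store) : nat :=
  match e with
  | IC n => n
  | IA a e => ia s a (ieval e s)
  | IPlus e1 e2 => (ieval e1 s + ieval e2 s)%nat
  end.

Definition opsem (o : rop) (x y : R) : R :=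
  match o with OpAdd => x + y | OpSub => x - y | OpMul => x * y | OpDiv => x / y end.

Fixpoint reval (e : rexp) (s : store) : R :=
  match e with
  | RC0 => 0
  | RC1 => 1
  | RA a e => ra s a (ieval e s)
  | RN e => INR (ieval e s)
  | ROp o e1 e2 => opsem o (reval e1 s) (reval e2 s)
  | RRoot e => sqrt (reval e s)
  end.

Definition Rleb (x y : R) : bool := if Rle_dec x y then true else false.

Definition beval (b : bexp) (s : store) : bool :=
  match b with
  | BI e1 e2 => Nat.leb (ieval e1 s) (ieval e2 s)
  | BR e1 e2 => Rleb (reval e1 s) (reval e2 s)
  end.

(** The machine has no integer multiplication. Multiplying by a constant is repeated addition, whose
    length does not depend on the input. *)
Definition add_times (t u n : nat) : list instr := repeat (IAdd t t u) n.
Arguments add_times : simpl never.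

Definition tmp (j : nat) : nat := 30 * j + 28.
Definition base : nat := 29.

Lemma updN_same f i v : updN f i v i = v.
Proof. unfold updN. rewrite Nat.eqb_refl. reflexivity. Qed.

Lemma updN_other f i v x : x <> i -> updN f i v x = f x.
Proof. intros H. unfold updN. apply Nat.eqb_neq in H. rewrite H. reflexivity. Qed.

Lemma updR_same f i v : updR f i v i = v.
Proof. unfold updR. rewrite Nat.eqb_refl. reflexivity. Qed.

Lemma updR_other f i v x : x <> i -> updR f i v x = f x.
Proof. intros H. unfold updR. apply Nat.eqb_neq in H. rewrite H. reflexivity. Qed.

Lemma exec_add_times_from t u : t <> u -> forall n r m,
  exists m', exec (add_times t u n) (r, m) = (r, m') /\
    m' t = (m t + n * m u)%nat /\ (forall x, x <> t -> m' x = m x).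
Proof.
  intros Htu n r. induction n as [|n IH]; intros m.
  - exists m. split; [reflexivity|]. split; [lia|reflexivity].
  - destruct (IH (updN m t (m t + m u)%nat)) as (m' & E & V & O).
    exists m'. split; [|split].
    + unfold add_times. cbn [repeat]. rewrite exec_cons. cbn [exec1]. exact E.
    + rewrite V, updN_same, updN_other by congruence. lia.
    + intros x Hx. rewrite O, updN_other by exact Hx. reflexivity.
Qed.

Lemma exec_add_times t u c : t <> u -> forall n r m,
  exists m', exec (add_times t u n) (r, updN m t c) = (r, m') /\
    m' t = (c + n * m u)%nat /\ (forall x, x <> t -> m' x = m x).
Proof.
  intros Htu n r m. destruct (exec_add_times_from t u Htu n r (updN m t c)) as (m' & E & V & O).
  exists m'. split; [exact E|]. split.
  - rewrite V, updN_same, updN_other by congruence. reflexivity.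
  - intros x Hx. rewrite O, updN_other by exact Hx. reflexivity.
Qed.

Lemma length_add_times t u n : length (add_times t u n) = n.
Proof. apply repeat_length. Qed.

Lemma straight_add_times t u n : forallb straight (add_times t u n) = true.
Proof. unfold add_times. induction n as [|n IH]; [reflexivity|exact IH]. Qed.

Global Opaque add_times.

Fixpoint iwf (e : iexp) : bool :=
  match e with
  | IC _ => true
  | IA a e => Nat.ltb a 28 && iwf e
  | IPlus e1 e2 => iwf e1 && iwf e2
  end.

(** Stack discipline: the value goes to [tmp j] and no temporary below [j] is touched, so that a
    left operand survives the evaluation of the right one at depth [S j]. *)
Fixpoint icode (j : nat) (e : iexp) : list instr :=
  match e with
  | IC n => [ISet (tmp j) n]
  | IA a e =>
      icode j e ++ ISet (tmp (S j)) a
      :: add_times (tmp (S j)) (tmp j) 30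
      ++ [ILoad (tmp j) (tmp (S j))]
  | IPlus e1 e2 => icode j e1 ++ icode (S j) e2 ++ [IAdd (tmp j) (tmp j) (tmp (S j))]
  end.

Definition tmps_from (j : nat) (m m' : nat -> nat) : Prop :=
  forall x, (forall i, (j <= i)%nat -> x <> tmp i) -> m' x = m x.

Definition isim (s : store) (m : nat -> nat) : Prop :=
  forall a i, (a < 28)%nat -> m (30 * i + a)%nat = ia s a i.

Lemma tmps_from_trans j m1 m2 m3 :
  tmps_from j m1 m2 -> tmps_from j m2 m3 -> tmps_from j m1 m3.
Proof. intros H1 H2 x Hx. rewrite H2, H1 by exact Hx. reflexivity. Qed.

Lemma tmps_from_S j m1 m2 : tmps_from (S j) m1 m2 -> tmps_from j m1 m2.
Proof. intros H x Hx. apply H. intros i Hi. apply Hx. lia. Qed.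

Lemma tmps_from_le i j m1 m2 : (i <= j)%nat -> tmps_from j m1 m2 -> tmps_from i m1 m2.
Proof. intros Hij H x Hx. apply H. intros y Hy. apply Hx. lia. Qed.

Lemma tmps_from_upd j i m v : (j <= i)%nat -> tmps_from j m (updN m (tmp i) v).
Proof. intros H x Hx. apply updN_other. apply Hx. exact H. Qed.

Lemma isim_tmps s m m' : isim s m -> tmps_from 0 m m' -> isim s m'.
Proof.
  intros H Ht a i Ha. rewrite Ht; [apply H; exact Ha|].
  intros j _. unfold tmp. lia.
Qed.

Lemma tmp_inj i j : tmp i = tmp j -> i = j.
Proof. unfold tmp. lia. Qed.

Lemma icode_spec s e : iwf e = true -> forall j r m, isim s m ->
  exists m', exec (icode j e) (r, m) = (r, m') /\
    m' (tmp j) = ieval e s /\ tmps_from j m m'.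
Proof.
  induction e as [n|a e IH|e1 IH1 e2 IH2]; simpl; intros Hwf j r m Hm.
  - exists (updN m (tmp j) n). split; [reflexivity|]. split.
    + apply updN_same.
    + apply tmps_from_upd. lia.
  - apply andb_true_iff in Hwf. destruct Hwf as [Ha He]. apply Nat.ltb_lt in Ha.
    destruct (IH He j r m Hm) as (m1 & E1 & V1 & T1).
    destruct (exec_add_times (tmp (S j)) (tmp j) a) with (n := 30%nat) (r := r) (m := m1)
      as (m2 & E2 & V2 & O2).
    { intros H. apply tmp_inj in H. lia. }
    exists (updN m2 (tmp j) (m2 (m2 (tmp (S j))))). split; [|split].
    + rewrite exec_app, E1.
      rewrite exec_cons. cbn [exec1]. rewrite exec_app, E2. reflexivity.
    + rewrite updN_same, V2, V1.
      assert (H30 : (a + 30 * ieval e s)%nat = (30 * ieval e s + a)%nat) by lia.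
      rewrite H30, O2 by (unfold tmp; lia).
      rewrite T1 by (intros i _; unfold tmp; lia).
      apply Hm. exact Ha.
    + eapply tmps_from_trans; [exact T1|].
      intros x Hx. rewrite updN_other by (apply Hx; lia). apply O2. apply Hx. lia.
  - apply andb_true_iff in Hwf. destruct Hwf as [H1 H2].
    destruct (IH1 H1 j r m Hm) as (m1 & E1 & V1 & T1).
    assert (Hm1 : isim s m1).
    { eapply isim_tmps; [exact Hm|]. eapply tmps_from_le; [|exact T1]. lia. }
    destruct (IH2 H2 (S j) r m1 Hm1) as (m2 & E2 & V2 & T2).
    exists (updN m2 (tmp j) (m2 (tmp j) + m2 (tmp (S j)))%nat). split; [|split].
    + rewrite !exec_app, E1, E2. reflexivity.
    + rewrite updN_same, V2, T2, V1; [reflexivity|].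
      intros i Hi H. apply tmp_inj in H. lia.
    + eapply tmps_from_trans; [exact T1|]. eapply tmps_from_trans; [apply tmps_from_S, T2|].
      apply tmps_from_upd. lia.
Qed.

(** * Code generation and simulation *)

Section Compiler.

(** [w] is the stride of the real arrays and [beta] the address at which they start, that is, the
    content of register [base]. *)
Variables (w beta : nat).

Fixpoint rwf (e : rexp) : bool :=
  match e with
  | RC0 | RC1 => true
  | RA a e => Nat.leb 1 a && Nat.ltb a w && iwf e
  | RN e => iwf e
  | ROp _ e1 e2 => rwf e1 && rwf e2
  | RRoot e => rwf e
  end.

Definition bwf (b : bexp) : bool :=
  match b with
  | BI e1 e2 => iwf e1 && iwf e2
  | BR e1 e2 => rwf e1 && rwf e2
  end.

Fixpoint cwf (c : cmd) : bool :=
  match c with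
  | Skip => true
  | SetI a e1 e2 => Nat.ltb a 28 && iwf e1 && iwf e2
  | SetR a e1 e2 => Nat.leb 1 a && Nat.ltb a w && iwf e1 && rwf e2
  | SetLow e1 e2 => iwf e1 && rwf e2
  | GetLow a e1 e2 => Nat.leb 1 a && Nat.ltb a w && iwf e1 && iwf e2
  | Flip a => Nat.ltb a 28
  | Seq c1 c2 => cwf c1 && cwf c2
  | If b c1 c2 => bwf b && cwf c1 && cwf c2
  | While b c => bwf b && cwf c
  end.

Definition rtmp (j : nat) : nat := (beta + w * j)%nat.

Definition load_rtmp (t j : nat) : list instr :=
  [ISet (tmp t) (w * j); IAdd (tmp t) (tmp t) base].

Definition load_cell (t a : nat) : list instr :=
  ISet (tmp (S t)) a :: add_times (tmp (S t)) (tmp t) w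
  ++ [IAdd (tmp (S t)) (tmp (S t)) base].

(** There is no instruction that copies a real, so the target is cleared and the source added;
    target and source must therefore differ. *)
Definition move (x y : nat) : list instr := [RZero x; RAdd x x y].

Definition rop_instr (o : rop) : nat -> nat -> nat -> instr :=
  match o with OpAdd => RAdd | OpSub => RSub | OpMul => RMul | OpDiv => RDiv end.

(** Intermediate reals live in the reserved array 0, indexed by the depth [j]. The integer
    temporaries hold their addresses and are reloaded before each use. *)
Fixpoint rcode (j : nat) (e : rexp) : list instr :=
  match e with
  | RC0 => load_rtmp 0 j ++ [RZero (tmp 0)]
  | RC1 => load_rtmp 0 j ++ [ROne (tmp 0)]
  | RA a e => icode 1 e ++ load_cell 1 a ++ load_rtmp 0 j ++ move (tmp 0) (tmp 2)
  | RN e => icode 1 e ++ load_rtmp 0 j ++ [ROfNat (tmp 0) (tmp 1)]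
  | ROp o e1 e2 =>
      rcode j e1 ++ rcode (S j) e2 ++ load_rtmp 0 j ++ load_rtmp 1 (S j)
      ++ [rop_instr o (tmp 0) (tmp 0) (tmp 1)]
  | RRoot e => rcode j e ++ load_rtmp 0 j ++ [RSqrt (tmp 0) (tmp 0)]
  end.

Definition bcode (b : bexp) (target : nat) : list instr * instr :=
  match b with
  | BI e1 e2 => (icode 0 e1 ++ icode 1 e2, ILeJ (tmp 0) (tmp 1) target)
  | BR e1 e2 =>
      (rcode 0 e1 ++ rcode 1 e2 ++ load_rtmp 0 0 ++ load_rtmp 1 1, RLeJ (tmp 0) (tmp 1) target)
  end.

(** The jump target occurs only in the final instruction, so an arbitrary one may be used to obtain
    the code before it. *)
Definition bpre (b : bexp) : list instr := fst (bcode b 0).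

(** Jumps are absolute, hence the start address [a]. In a conditional the code of [c2] comes first,
    because the machine jumps when the test succeeds. *)
Fixpoint ccode (a : nat) (c : cmd) : list instr :=
  match c with
  | Skip => []
  | SetI x e1 e2 =>
      icode 0 e2 ++ icode 1 e1 ++ ISet (tmp 2) x :: add_times (tmp 2) (tmp 1) 30
      ++ [IStore (tmp 2) (tmp 0)]
  | SetR x e1 e2 =>
      rcode 0 e2 ++ icode 1 e1 ++ load_cell 1 x ++ load_rtmp 0 0 ++ move (tmp 2) (tmp 0)
  | SetLow e1 e2 =>
      rcode 0 e2 ++ icode 1 e1 ++ load_rtmp 0 0 ++ move (tmp 1) (tmp 0)
  | GetLow x e1 e2 =>
      icode 0 e2 ++ icode 1 e1 ++ load_cell 1 x ++ move (tmp 2) (tmp 0)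
  | Flip x => [Rand x]
  | Seq c1 c2 => let l1 := ccode a c1 in l1 ++ ccode (a + length l1) c2
  | If b c1 c2 =>
      let h := length (bpre b) in
      let l2 := ccode (a + h + 1) c2 in
      let a1 := (a + h + 1 + length l2 + 1)%nat in
      let l1 := ccode a1 c1 in
      bpre b ++ [snd (bcode b a1)] ++ l2 ++ [Jmp (a1 + length l1)] ++ l1
  | While b c =>
      let h := length (bpre b) in
      let l := ccode (a + h + 2) c in
      bpre b ++ [snd (bcode b (a + h + 2))] ++ [Jmp (a + h + 2 + length l + 1)]
      ++ l ++ [Jmp a]
  end.

Definition sim (s : store) (mm : memory) : Prop :=
  isim s (snd mm) /\ snd mm base = beta /\
  (forall a i, (1 <= a < w)%nat -> fst mm (beta + w * i + a)%nat = ra s a i) /\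
  (forall i, (i < beta)%nat -> fst mm i = low s i).

Definition rtmps_from (j : nat) (r r' : nat -> R) : Prop :=
  forall x, (forall i, (j <= i)%nat -> x <> rtmp i) -> r' x = r x.

Hypothesis w_pos : (1 <= w)%nat.

(** Uniqueness of division by [w] with remainder. It keeps the arrays apart from each other and from
    the temporaries in array 0. *)
Lemma cell_inj a a' i i' : (a < w)%nat -> (a' < w)%nat ->
  (beta + w * i + a = beta + w * i' + a')%nat -> i = i' /\ a = a'.
Proof.
  intros Ha Ha' H. apply (Nat.div_mod_unique w i i' a a'); lia.
Qed.

Lemma rtmp_inj i j : rtmp i = rtmp j -> i = j.
Proof. unfold rtmp. intros H. apply (cell_inj 0 0 i j); lia. Qed.

Lemma base_not_tmp i : base <> tmp i.
Proof. unfold base, tmp. lia. Qed.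

Lemma rtmps_from_trans j r1 r2 r3 :
  rtmps_from j r1 r2 -> rtmps_from j r2 r3 -> rtmps_from j r1 r3.
Proof. intros H1 H2 x Hx. rewrite H2, H1 by exact Hx. reflexivity. Qed.

Lemma rtmps_from_le i j r1 r2 : (i <= j)%nat -> rtmps_from j r1 r2 -> rtmps_from i r1 r2.
Proof. intros Hij H x Hx. apply H. intros y Hy. apply Hx. lia. Qed.

Lemma rtmps_from_upd i r v : rtmps_from i r (updR r (rtmp i) v).
Proof. intros x Hx. apply updR_other. apply Hx. lia. Qed.

Lemma sim_tmps s r m r' m' :
  sim s (r, m) -> tmps_from 0 m m' -> rtmps_from 0 r r' -> sim s (r', m').
Proof.
  intros (H1 & H2 & H3 & H4) Ht Hr. repeat split; simpl in *.
  - eapply isim_tmps; eassumption.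
  - rewrite Ht; [exact H2|]. intros i _. apply base_not_tmp.
  - intros a i Ha. rewrite Hr; [apply H3; exact Ha|].
    intros j _ H. unfold rtmp in H. replace (beta + w * j)%nat with (beta + w * j + 0)%nat in H by lia.
    apply cell_inj in H; lia.
  - intros i Hi. rewrite Hr; [apply H4; exact Hi|]. intros j _. unfold rtmp. lia.
Qed.

Lemma load_rtmp_spec t j r m : m base = beta ->
  exists m', exec (load_rtmp t j) (r, m) = (r, m') /\ m' (tmp t) = rtmp j /\
    (forall x, x <> tmp t -> m' x = m x).
Proof.
  intros Hb. eexists. split; [reflexivity|]. split.
  - rewrite updN_same, updN_same, updN_other by apply base_not_tmp. rewrite Hb. unfold rtmp. lia.
  - intros x Hx. rewrite !updN_other by exact Hx. reflexivity.
Qed.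

Lemma load_cell_spec t a r m : m base = beta ->
  exists m', exec (load_cell t a) (r, m) = (r, m') /\
    m' (tmp (S t)) = (beta + w * m (tmp t) + a)%nat /\
    (forall x, x <> tmp (S t) -> m' x = m x).
Proof.
  intros Hb. unfold load_cell.
  destruct (exec_add_times (tmp (S t)) (tmp t) a) with (n := w) (r := r) (m := m)
    as (m2 & E2 & V2 & O2).
  { intros H. apply tmp_inj in H. lia. }
  exists (updN m2 (tmp (S t)) (m2 (tmp (S t)) + m2 base)%nat). split; [|split].
  - rewrite exec_cons. cbn [exec1]. rewrite exec_app, E2. reflexivity.
  - rewrite updN_same, V2, (O2 base) by apply base_not_tmp. rewrite Hb. lia.
  - intros x Hx. rewrite updN_other by exact Hx. apply O2. exact Hx.
Qed.

Lemma move_spec x y r m : m x <> m y -> exec (move x y) (r, m) = (updR (updR r (m x) 0) (m x) (r (m y)), m).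
Proof.
  intros H. unfold move. rewrite !exec_cons, exec_nil. cbn [exec1].
  rewrite updR_same, (updR_other _ _ _ (m y)) by congruence. rewrite Rplus_0_l. reflexivity.
Qed.

Lemma tmps_from_other t m m' : (forall x, x <> tmp t -> m' x = m x) -> tmps_from 0 m m'.
Proof. intros H x Hx. apply H. apply Hx. lia. Qed.

Lemma icode_sim s e j r m : iwf e = true -> sim s (r, m) ->
  exists m', exec (icode j e) (r, m) = (r, m') /\
    m' (tmp j) = ieval e s /\ tmps_from j m m' /\ sim s (r, m').
Proof.
  intros He Hs. destruct (icode_spec s e He j r m (proj1 Hs)) as (m' & E & V & T).
  exists m'. repeat split; try assumption.
  - eapply isim_tmps; [apply Hs|]. eapply tmps_from_le; [|exact T]. lia.
  - simpl. rewrite T; [apply Hs|]. intros i _. apply base_not_tmp.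
  - apply Hs.
  - apply Hs.
Qed.

Lemma sim_base s r m : sim s (r, m) -> m base = beta.
Proof. intros H. apply H. Qed.

Lemma exec_load_rtmp_then s t j r m :
  sim s (r, m) ->
  exists m', exec (load_rtmp t j) (r, m) = (r, m') /\ m' (tmp t) = rtmp j /\
    (forall x, x <> tmp t -> m' x = m x) /\ sim s (r, m').
Proof.
  intros Hs. destruct (load_rtmp_spec t j r m (sim_base _ _ _ Hs)) as (m' & E & V & O).
  exists m'. split; [exact E|]. split; [exact V|]. split; [exact O|].
  eapply sim_tmps; [exact Hs| |intros x _; reflexivity]. eapply tmps_from_other. exact O.
Qed.

Lemma exec_load_cell_then s t a r m :
  sim s (r, m) ->
  exists m', exec (load_cell t a) (r, m) = (r, m') /\
    m' (tmp (S t)) = (beta + w * m (tmp t) + a)%nat /\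
    (forall x, x <> tmp (S t) -> m' x = m x) /\ sim s (r, m').
Proof.
  intros Hs. destruct (load_cell_spec t a r m (sim_base _ _ _ Hs)) as (m' & E & V & O).
  exists m'. split; [exact E|]. split; [exact V|]. split; [exact O|].
  eapply sim_tmps; [exact Hs| |intros x _; reflexivity]. eapply tmps_from_other. exact O.
Qed.

Lemma tmp_neq i j : i <> j -> tmp i <> tmp j.
Proof. intros H E. apply H, tmp_inj, E. Qed.

Lemma rcode_spec s e : rwf e = true -> forall j r m, sim s (r, m) ->
  exists r' m', exec (rcode j e) (r, m) = (r', m') /\
    r' (rtmp j) = reval e s /\ tmps_from 0 m m' /\ rtmps_from j r r'.
Proof.
  induction e as [| |a e|e|o e1 IH1 e2 IH2|e IH]; cbn [rwf]; intros Hwf j r m Hs; cbn [rcode reval].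
  - destruct (exec_load_rtmp_then s 0 j r m Hs) as (m1 & E1 & V1 & O1 & S1).
    exists (updR r (rtmp j) 0), m1. split; [|split; [|split]].
    + rewrite exec_app, E1, exec_cons. cbn [exec1]. rewrite V1. reflexivity.
    + apply updR_same.
    + eapply tmps_from_other. exact O1.
    + apply rtmps_from_upd.
  - destruct (exec_load_rtmp_then s 0 j r m Hs) as (m1 & E1 & V1 & O1 & S1).
    exists (updR r (rtmp j) 1), m1. split; [|split; [|split]].
    + rewrite exec_app, E1, exec_cons. cbn [exec1]. rewrite V1. reflexivity.
    + apply updR_same.
    + eapply tmps_from_other. exact O1.
    + apply rtmps_from_upd.
  - apply andb_true_iff in Hwf. destruct Hwf as [Ha He].
    apply andb_true_iff in Ha. destruct Ha as [Ha1 Ha2].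
    apply Nat.leb_le in Ha1. apply Nat.ltb_lt in Ha2.
    destruct (icode_sim s e 1 r m He Hs) as (m1 & E1 & V1 & T1 & S1).
    destruct (exec_load_cell_then s 1 a r m1 S1) as (m2 & E2 & V2 & O2 & S2).
    destruct (exec_load_rtmp_then s 0 j r m2 S2) as (m3 & E3 & V3 & O3 & S3).
    assert (V3' : m3 (tmp 2) = (beta + w * ieval e s + a)%nat).
    { rewrite O3 by (apply tmp_neq; lia). rewrite V2, V1. reflexivity. }
    assert (Hne : m3 (tmp 0) <> m3 (tmp 2)).
    { rewrite V3, V3'. unfold rtmp. intros H.
      replace (beta + w * j)%nat with (beta + w * j + 0)%nat in H by lia.
      apply cell_inj in H; lia. }
    eexists _, m3. split; [|split; [|split]].
    + rewrite !exec_app, E1, E2, E3. rewrite move_spec by exact Hne. reflexivity.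
    + rewrite V3, updR_same, V3'. destruct Hs as (_ & _ & Hr & _). apply Hr. lia.
    + eapply tmps_from_trans; [eapply tmps_from_le; [|exact T1]; lia|].
      eapply tmps_from_trans; eapply tmps_from_other; eassumption.
    + rewrite V3. intros x Hx. rewrite !updR_other by (apply Hx; lia). reflexivity.
  - destruct (icode_sim s e 1 r m Hwf Hs) as (m1 & E1 & V1 & T1 & S1).
    destruct (exec_load_rtmp_then s 0 j r m1 S1) as (m3 & E3 & V3 & O3 & S3).
    eexists _, m3. split; [|split; [|split]].
    + rewrite !exec_app, E1, E3, exec_cons. cbn [exec1]. reflexivity.
    + rewrite V3, updR_same, O3 by (apply tmp_neq; lia). rewrite V1. reflexivity.
    + eapply tmps_from_trans; [eapply tmps_from_le; [|exact T1]; lia|].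
      eapply tmps_from_other; eassumption.
    + rewrite V3. apply rtmps_from_upd.
  - apply andb_true_iff in Hwf. destruct Hwf as [H1 H2].
    destruct (IH1 H1 j r m Hs) as (r1 & m1 & E1 & V1 & T1 & R1).
    assert (S1 : sim s (r1, m1)).
    { eapply sim_tmps; [exact Hs|exact T1|]. eapply rtmps_from_le; [|exact R1]. lia. }
    destruct (IH2 H2 (S j) r1 m1 S1) as (r2 & m2 & E2 & V2 & T2 & R2).
    assert (S2 : sim s (r2, m2)).
    { eapply sim_tmps; [exact S1|exact T2|]. eapply rtmps_from_le; [|exact R2]. lia. }
    destruct (exec_load_rtmp_then s 0 j r2 m2 S2) as (m3 & E3 & V3 & O3 & S3).
    destruct (exec_load_rtmp_then s 1 (S j) r2 m3 S3) as (m4 & E4 & V4 & O4 & S4).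
    assert (V4' : m4 (tmp 0) = rtmp j).
    { rewrite O4 by (apply tmp_neq; lia). exact V3. }
    exists (updR r2 (rtmp j) (opsem o (r2 (rtmp j)) (r2 (rtmp (S j))))), m4.
    split; [|split; [|split]].
    + rewrite !exec_app, E1, E2, E3, E4, exec_cons.
      destruct o; cbn [rop_instr exec1 opsem]; rewrite V4, V4'; reflexivity.
    + rewrite updR_same, V2, R2, V1; [reflexivity|].
      intros i Hi H. apply rtmp_inj in H. lia.
    + eapply tmps_from_trans; [exact T1|]. eapply tmps_from_trans; [exact T2|].
      eapply tmps_from_trans; eapply tmps_from_other; eassumption.
    + eapply rtmps_from_trans; [exact R1|].
      eapply rtmps_from_trans; [eapply rtmps_from_le; [|exact R2]; lia|].
      apply rtmps_from_upd.
  - destruct (IH Hwf j r m Hs) as (r1 & m1 & E1 & V1 & T1 & R1).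
    assert (S1 : sim s (r1, m1)).
    { eapply sim_tmps; [exact Hs|exact T1|]. eapply rtmps_from_le; [|exact R1]. lia. }
    destruct (exec_load_rtmp_then s 0 j r1 m1 S1) as (m3 & E3 & V3 & O3 & S3).
    exists (updR r1 (rtmp j) (sqrt (r1 (rtmp j)))), m3.
    split; [|split; [|split]].
    + rewrite !exec_app, E1, E3, exec_cons. cbn [exec1]. rewrite V3. reflexivity.
    + rewrite updR_same, V1. reflexivity.
    + eapply tmps_from_trans; [exact T1|]. eapply tmps_from_other; eassumption.
    + eapply rtmps_from_trans; [exact R1|]. apply rtmps_from_upd.
Qed.

Lemma rcode_sim s e j r m : rwf e = true -> sim s (r, m) ->
  exists r' m', exec (rcode j e) (r, m) = (r', m') /\
    r' (rtmp j) = reval e s /\ rtmps_from j r r' /\ sim s (r', m').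
Proof.
  intros He Hs. destruct (rcode_spec s e He j r m Hs) as (r' & m' & E & V & T & Q).
  exists r', m'. repeat (split; [assumption|]).
  eapply sim_tmps; [exact Hs|exact T|]. eapply rtmps_from_le; [|exact Q]. lia.
Qed.

Lemma straight_icode e : forall j, forallb straight (icode j e) = true.
Proof.
  induction e as [n|a e IH|e1 IH1 e2 IH2]; intros j; simpl; [reflexivity| |].
  - rewrite forallb_app. simpl. rewrite forallb_app, straight_add_times, IH. reflexivity.
  - rewrite !forallb_app, IH1, IH2. reflexivity.
Qed.

Lemma straight_load_cell t a : forallb straight (load_cell t a) = true.
Proof. unfold load_cell. simpl. rewrite forallb_app, straight_add_times. reflexivity. Qed.

Lemma straight_rcode e : forall j, forallb straight (rcode j e) = true.
Proof.
  induction e as [| |a e|e|o e1 IH1 e2 IH2|e IH]; intros j; cbn [rcode].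
  - reflexivity.
  - reflexivity.
  - rewrite !forallb_app, straight_icode, straight_load_cell. reflexivity.
  - rewrite !forallb_app, straight_icode. reflexivity.
  - rewrite !forallb_app, IH1, IH2. destruct o; reflexivity.
  - rewrite !forallb_app, IH. reflexivity.
Qed.

Lemma straight_bpre b : forallb straight (bpre b) = true.
Proof.
  destruct b as [e1 e2|e1 e2]; unfold bpre; cbn [bcode fst].
  - rewrite forallb_app, !straight_icode. reflexivity.
  - rewrite !forallb_app, !straight_rcode. reflexivity.
Qed.

(** * An expected-cost logic *)

(* [ecost c K s B]: started in [s], [c] ends in states that satisfy [K], and [B]
   bounds the expected cost of [c] plus that of what follows, when [K s' B'] is
   read as "from [s'] on, the expected cost is at most [B']". *)
Inductive ecost : cmd -> (store -> R -> Prop) -> store -> R -> Prop :=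
| ecost_skip (K : store -> R -> Prop) s B : K s B -> ecost Skip K s B
| ecost_setI (K : store -> R -> Prop) a e1 e2 s B :
    K (setI s a (ieval e1 s) (ieval e2 s)) B -> ecost (SetI a e1 e2) K s (B + 1)
| ecost_setR (K : store -> R -> Prop) a e1 e2 s B :
    K (setR s a (ieval e1 s) (reval e2 s)) B -> ecost (SetR a e1 e2) K s (B + 1)
| ecost_setLow (K : store -> R -> Prop) e1 e2 s B :
    (ieval e1 s < beta)%nat ->
    K (setLow s (ieval e1 s) (reval e2 s)) B -> ecost (SetLow e1 e2) K s (B + 1)
| ecost_getLow (K : store -> R -> Prop) a e1 e2 s B :
    (ieval e2 s < beta)%nat ->
    K (setR s a (ieval e1 s) (low s (ieval e2 s))) B -> ecost (GetLow a e1 e2) K s (B + 1)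
| ecost_flip (K : store -> R -> Prop) a s B0 B1 :
    K (setI s a 0 0) B0 -> K (setI s a 0 1) B1 -> ecost (Flip a) K s ((B0 + B1) / 2 + 1)
| ecost_seq (K1 K : store -> R -> Prop) c1 c2 s B :
    ecost c1 K1 s B -> (forall s' B', K1 s' B' -> ecost c2 K s' B') ->
    ecost (Seq c1 c2) K s B
| ecost_if (K : store -> R -> Prop) b c1 c2 s B :
    ecost (if beval b s then c1 else c2) K s B -> ecost (If b c1 c2) K s (B + 1)
| ecost_while_false (K : store -> R -> Prop) b c s B :
    beval b s = false -> K s B -> ecost (While b c) K s (B + 1)
| ecost_while_true (K1 K : store -> R -> Prop) b c s B :
    beval b s = true -> ecost c K1 s B ->
    (forall s' B', K1 s' B' -> ecost (While b c) K s' B') ->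
    ecost (While b c) K s (B + 1)
| ecost_weaken (K : store -> R -> Prop) c s B B' :
    ecost c K s B -> B <= B' -> ecost c K s B'.

Lemma sim_setI s r m a i v : (a < 28)%nat -> sim s (r, m) ->
  sim (setI s a i v) (r, updN m (30 * i + a)%nat v).
Proof.
  intros Ha (H1 & H2 & H3 & H4). cbn [fst snd] in *. repeat split; cbn [fst snd]; try assumption.
  - intros a' i' Ha'. unfold setI, upd2, updN. cbn [ia].
    destruct (Nat.eqb_spec (30 * i' + a') (30 * i + a)) as [E|E].
    + assert (Hi : i' = i) by lia. assert (a' = a) by lia. subst. rewrite !Nat.eqb_refl. reflexivity.
    + destruct (Nat.eqb_spec a' a) as [->|Hn]; [|apply H1; exact Ha'].
      destruct (Nat.eqb_spec i' i) as [->|Hn]; [congruence|apply H1; exact Ha'].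
  - rewrite updN_other; [exact H2|]. unfold base. lia.
Qed.

Lemma sim_setR s r m a i v v0 : (1 <= a < w)%nat -> sim s (r, m) ->
  sim (setR s a i v) (updR (updR r (beta + w * i + a)%nat v0) (beta + w * i + a)%nat v, m).
Proof.
  intros Ha (H1 & H2 & H3 & H4). cbn [fst snd] in *. repeat split; cbn [fst snd]; try assumption.
  - intros a' i' Ha'. unfold setR, upd2, updR. cbn [ra].
    destruct (Nat.eqb_spec (beta + w * i' + a') (beta + w * i + a)) as [E|E].
    + apply cell_inj in E; try lia. destruct E; subst. rewrite !Nat.eqb_refl. reflexivity.
    + destruct (Nat.eqb_spec a' a) as [->|Hn]; [|apply H3; exact Ha'].
      destruct (Nat.eqb_spec i' i) as [->|Hn]; [congruence|apply H3; exact Ha'].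
  - intros x Hx. rewrite !updR_other by lia. apply H4. exact Hx.
Qed.

Lemma sim_setLow s r m i v v0 : (i < beta)%nat -> sim s (r, m) ->
  sim (setLow s i v) (updR (updR r i v0) i v, m).
Proof.
  intros Hi (H1 & H2 & H3 & H4). cbn [fst snd] in *. repeat split; cbn [fst snd]; try assumption.
  - intros a' i' Ha'. rewrite !updR_other by lia. apply H3. exact Ha'.
  - intros x Hx. unfold setLow. cbn [low]. unfold updR. destruct (Nat.eqb_spec x i); [reflexivity|]. apply H4. exact Hx.
Qed.

Section Soundness.

(** [kappa] is the number of machine steps that pay for one unit of abstract cost. It will exceed
    the length of the whole compiled code, so that any straight-line piece and its jumps fit into
    one unit. *)
Variables (p : program) (G : state -> Prop) (kappa : R).

Lemma within_bcode s b target a mm B : bwf b = true -> sim s mm ->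
  code_at p a (bpre b ++ [snd (bcode b target)]) ->
  (forall mm', sim s mm' ->
     within p G (at_pc (if beval b s then target else a + length (bpre b) + 1)%nat mm') B) ->
  within p G (at_pc a mm) (B + (INR (length (bpre b)) + 1)).
Proof.
  intros Hwf Hs Hc HK. apply code_at_app in Hc. destruct Hc as [Hc1 Hc2].
  rewrite (Rplus_comm (INR _)), <- Rplus_assoc.
  apply within_straight with (l := bpre b); [exact Hc1|apply straight_bpre|].
  apply code_at_hd in Hc2.
  destruct mm as [r m]. destruct b as [e1 e2|e1 e2]; unfold bpre in *; cbn [bcode fst snd bwf beval] in *;
    apply andb_true_iff in Hwf; destruct Hwf as [W1 W2].
  - destruct (icode_sim s e1 0 r m W1 Hs) as (m1 & E1 & V1 & T1 & S1).
    destruct (icode_sim s e2 1 r m1 W2 S1) as (m2 & E2 & V2 & T2 & S2).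
    rewrite exec_app, E1, E2.
    assert (V1' : m2 (tmp 0) = ieval e1 s).
    { rewrite T2; [exact V1|]. intros i Hi. apply tmp_neq. lia. }
    specialize (HK _ S2). eapply within_step; [| |exact HK].
    + unfold halted, cur, at_pc. cbn [pc]. rewrite Hc2. reflexivity.
    + intros bit. unfold step, cur, at_pc. cbn [pc]. rewrite Hc2. cbn [rm im fst snd].
      rewrite V1', V2. destruct (ieval e1 s <=? ieval e2 s)%nat; f_equal; lia.
  - destruct (rcode_sim s e1 0 r m W1 Hs) as (r1 & m1 & E1 & V1 & T1 & S1).
    destruct (rcode_sim s e2 1 r1 m1 W2 S1) as (r2 & m2 & E2 & V2 & T2 & S2).
    destruct (exec_load_rtmp_then s 0 0 r2 m2 S2) as (m3 & E3 & V3 & O3 & S3).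
    destruct (exec_load_rtmp_then s 1 1 r2 m3 S3) as (m4 & E4 & V4 & O4 & S4).
    rewrite !exec_app, E1, E2, E3, E4.
    assert (V3' : m4 (tmp 0) = rtmp 0).
    { rewrite O4 by (apply tmp_neq; lia). exact V3. }
    assert (V1' : r2 (rtmp 0) = reval e1 s).
    { rewrite T2; [exact V1|]. intros i Hi H. apply rtmp_inj in H. lia. }
    specialize (HK _ S4). eapply within_step; [| |exact HK].
    + unfold halted, cur, at_pc. cbn [pc]. rewrite Hc2. reflexivity.
    + intros bit. unfold step, cur, at_pc. cbn [pc]. rewrite Hc2. cbn [rm im fst snd].
      rewrite V3', V4, V1', V2. unfold Rleb. destruct (Rle_dec (reval e1 s) (reval e2 s)); f_equal; lia.
Qed.

Lemma straight_sound c a mm B l K : ccode a c = l -> forallb straight l = true ->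
  code_at p a l -> INR (length l) + 3 <= kappa -> forall e s',
  (forall s' B' mm', K s' B' -> sim s' mm' ->
     within p G (at_pc (a + length (ccode a c)) mm') (kappa * B' + e)) ->
  K s' B -> sim s' (exec l mm) -> within p G (at_pc a mm) (kappa * (B + 1) + e).
Proof.
  intros Hl Hst Hc Hk e s' HK Hs Hsim. subst l.
  eapply within_weaken; [apply within_straight; [exact Hc|exact Hst|]|].
  - eapply HK; eassumption.
  - lra.
Qed.

(** Induction on the cost derivation instead of the command: each further iteration of a loop is a
    subderivation, so termination comes for free. The slack [e] carries the jump that closes a
    branch or a loop body; the unit charged for the test pays for it. *)
Lemma ecost_sound c K s B : ecost c K s B -> cwf c = true ->
  forall a mm e, code_at p a (ccode a c) -> sim s mm -> 0 <= e ->
  INR (length (ccode a c)) + 3 <= kappa ->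
  (forall s' B' mm', K s' B' -> sim s' mm' ->
     within p G (at_pc (a + length (ccode a c)) mm') (kappa * B' + e)) ->
  within p G (at_pc a mm) (kappa * B + e).
Proof.
  intros H. induction H as
    [K s B H|K x e1 e2 s B H|K x e1 e2 s B H|K e1 e2 s B Hlt H|K x e1 e2 s B Hlt H
    |K x s B0 B1 H0 H1|K1 K c1 c2 s B H IH1 H2 IH2|K b c1 c2 s B H IH|K b c s B Hb H
    |K1 K b c s B Hb H IH1 H2 IH2|K c s B B' H IH Hle];
    intros Hwf a mm e Hc Hs He Hk HK; cbn [cwf] in Hwf;
    repeat match goal with
      | X : (_ && _)%bool = true |- _ => apply andb_true_iff in X; destruct X
      | X : (_ <=? _)%nat = true |- _ => apply Nat.leb_le in X
      | X : (_ <? _)%nat = true |- _ => apply Nat.ltb_lt in X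
      end.
  - simpl in HK. rewrite Nat.add_0_r in HK. eapply HK; eassumption.
  - destruct mm as [r m].
    destruct (icode_sim s e2 0 r m) as (m1 & E1 & V1 & T1 & S1); [assumption..|].
    destruct (icode_sim s e1 1 r m1) as (m2 & E2 & V2 & T2 & S2); [assumption..|].
    destruct (exec_add_times (tmp 2) (tmp 1) x) with (n := 30%nat) (r := r) (m := m2)
      as (m3 & E3 & V3 & O3).
    { apply tmp_neq. lia. }
    eapply straight_sound; [reflexivity| |exact Hc|exact Hk|exact HK|exact H|].
    + cbn [ccode]. rewrite !forallb_app, !straight_icode. cbn [forallb]. 
      rewrite forallb_app, straight_add_times. reflexivity.
    + cbn [ccode]. rewrite !exec_app, E1, E2, exec_cons. cbn [exec1].
      rewrite exec_app, E3, exec_cons, exec_nil. cbn [exec1].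
      rewrite V3, V2.
      rewrite (O3 (tmp 0)), (T2 (tmp 0)), V1;
        [|intros i Hi; apply tmp_neq; lia|apply tmp_neq; lia].
      replace (x + 30 * ieval e1 s)%nat with (30 * ieval e1 s + x)%nat by lia.
      apply sim_setI; [assumption|].
      eapply sim_tmps; [exact S2| |intros y _; reflexivity]. eapply tmps_from_other. exact O3.
  - destruct mm as [r m].
    destruct (rcode_sim s e2 0 r m) as (r1 & m1 & E1 & V1 & T1 & S1); [assumption..|].
    destruct (icode_sim s e1 1 r1 m1) as (m2 & E2 & V2 & T2 & S2); [assumption..|].
    destruct (exec_load_cell_then s 1 x r1 m2 S2) as (m3 & E3 & V3 & O3 & S3).
    destruct (exec_load_rtmp_then s 0 0 r1 m3 S3) as (m4 & E4 & V4 & O4 & S4).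
    assert (V3' : m4 (tmp 2) = (beta + w * ieval e1 s + x)%nat).
    { rewrite O4 by (apply tmp_neq; lia). rewrite V3, V2. reflexivity. }
    eapply straight_sound; [reflexivity| |exact Hc|exact Hk|exact HK|exact H|].
    + cbn [ccode]. rewrite !forallb_app, straight_icode, straight_rcode, straight_load_cell.
      reflexivity.
    + cbn [ccode]. rewrite !exec_app, E1, E2, E3, E4.
      rewrite move_spec.
      * rewrite V3', V4, V1. apply sim_setR; [lia|exact S4].
      * rewrite V3', V4. unfold rtmp. intros Hcl.
        replace (beta + w * 0)%nat with (beta + w * 0 + 0)%nat in Hcl by lia.
        apply cell_inj in Hcl; lia.
  - destruct mm as [r m].
    destruct (rcode_sim s e2 0 r m) as (r1 & m1 & E1 & V1 & T1 & S1); [assumption..|].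
    destruct (icode_sim s e1 1 r1 m1) as (m2 & E2 & V2 & T2 & S2); [assumption..|].
    destruct (exec_load_rtmp_then s 0 0 r1 m2 S2) as (m4 & E4 & V4 & O4 & S4).
    assert (V3' : m4 (tmp 1) = ieval e1 s).
    { rewrite O4 by (apply tmp_neq; lia). exact V2. }
    eapply straight_sound; [reflexivity| |exact Hc|exact Hk|exact HK|exact H|].
    + cbn [ccode]. rewrite !forallb_app, straight_icode, straight_rcode. reflexivity.
    + cbn [ccode]. rewrite !exec_app, E1, E2, E4.
      rewrite move_spec.
      * rewrite V3', V4, V1. apply sim_setLow; [assumption|exact S4].
      * rewrite V3', V4. unfold rtmp. lia.
  - destruct mm as [r m].
    destruct (icode_sim s e2 0 r m) as (m1 & E1 & V1 & T1 & S1); [assumption..|].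
    destruct (icode_sim s e1 1 r m1) as (m2 & E2 & V2 & T2 & S2); [assumption..|].
    destruct (exec_load_cell_then s 1 x r m2 S2) as (m3 & E3 & V3 & O3 & S3).
    assert (V1' : m3 (tmp 0) = ieval e2 s).
    { rewrite O3 by (apply tmp_neq; lia). rewrite T2; [exact V1|].
      intros i Hi. apply tmp_neq. lia. }
    eapply straight_sound; [reflexivity| |exact Hc|exact Hk|exact HK|exact H|].
    + cbn [ccode]. rewrite !forallb_app, !straight_icode, straight_load_cell. reflexivity.
    + cbn [ccode]. rewrite !exec_app, E1, E2, E3.
      rewrite move_spec.
      * rewrite V3, V2, V1'. rewrite (proj2 (proj2 (proj2 S3))) by assumption.
        apply sim_setR; [lia|exact S3].
      * rewrite V3, V1'. lia.
  - assert (Hcur : cur p (at_pc a mm) = Rand x).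
    { unfold cur, at_pc. simpl. apply code_at_hd with (l := []). exact Hc. }
    assert (Hfl : forall v, sim (setI s x 0 v) (fst mm, updN (snd mm) x v)).
    { intros v. destruct mm as [r m]. replace (updN (snd (r, m)) x v) with (updN m (30 * 0 + x) v).
      - apply sim_setI; assumption.
      - f_equal. }
    simpl length in HK.
    assert (H3 : within p G (at_pc a mm) (((kappa * B0 + e) + (kappa * B1 + e)) / 2 + 1)).
    { apply within_flip.
      - unfold halted. rewrite Hcur. reflexivity.
      - unfold step. rewrite Hcur. specialize (HK _ _ _ H0 (Hfl 0%nat)).
        unfold at_pc in *. simpl in *. replace (S a) with (a + 1)%nat by lia. exact HK.
      - unfold step. rewrite Hcur. specialize (HK _ _ _ H1 (Hfl 1%nat)).
        unfold at_pc in *. simpl in *. replace (S a) with (a + 1)%nat by lia. exact HK. }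
    eapply within_weaken; [exact H3|]. simpl in Hk. lra.
  - cbn [ccode] in Hc, Hk, HK. cbv zeta in Hc, Hk, HK. apply code_at_app in Hc. destruct Hc as [Hc1 Hc2].
    rewrite length_app, plus_INR in Hk.
    pose proof (pos_INR (length (ccode a c1))).
    pose proof (pos_INR (length (ccode (a + length (ccode a c1)) c2))).
    apply IH1; [assumption|exact Hc1|exact Hs|exact He|lra|].
    intros s' B' mm' HK1 Hs'. eapply IH2; [exact HK1|assumption|exact Hc2|exact Hs'|exact He|lra|].
    intros s2 B2 mm2 HK2 Hs2. rewrite <- Nat.add_assoc, <- length_app. eapply HK; eassumption.
  - cbn [ccode] in Hc, Hk, HK. cbv zeta in Hc, Hk, HK.
    set (h := length (bpre b)) in *.
    set (l2 := ccode (a + h + 1) c2) in *.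
    set (a1 := (a + h + 1 + length l2 + 1)%nat) in *.
    set (l1 := ccode a1 c1) in *.
    rewrite app_assoc in Hc. apply code_at_app in Hc. destruct Hc as [Hcb Hc].
    rewrite length_app in Hc. simpl length in Hc. fold h in Hc. rewrite Nat.add_assoc in Hc.
    apply code_at_app in Hc. destruct Hc as [Hc2 Hc].
    apply code_at_app in Hc. destruct Hc as [Hcj Hc1]. apply code_at_hd in Hcj.
    fold a1 in Hc1. simpl length in Hc1.
    rewrite !length_app, !plus_INR in Hk. simpl length in Hk. fold h in Hk. simpl INR in Hk.
    pose proof (pos_INR h). pose proof (pos_INR (length l1)). pose proof (pos_INR (length l2)).
    assert (Hend : (a + length (bpre b ++ [snd (bcode b a1)] ++ l2 ++ [Jmp (a1 + length l1)] ++ l1) = a1 + length l1)%nat).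
    { rewrite !length_app. simpl length. fold h. unfold a1. lia. }
    rewrite Hend in HK.
    assert (H9 : within p G (at_pc a mm) ((kappa * B + (e + 1)) + (INR h + 1))).
    { eapply within_bcode; [eassumption|exact Hs|exact Hcb|].
      intros mm' Hs'. fold h. destruct (beval b s) eqn:Eb.
      - apply IH; [assumption|exact Hc1|exact Hs'|lra|fold l1; lra|].
        intros s2 B2 mm2 HK2 Hs2. eapply within_weaken; [eapply HK; eassumption|lra].
      - apply IH; [assumption|exact Hc2|exact Hs'|lra|fold l2; lra|].
        intros s2 B2 mm2 HK2 Hs2. fold l2. rewrite <- Rplus_assoc.
        eapply within_jmp; [exact Hcj|]. eapply HK; eassumption. }
    eapply within_weaken; [exact H9|]. lra.
  - cbn [ccode] in Hc, Hk, HK. cbv zeta in Hc, Hk, HK.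
    set (h := length (bpre b)) in *.
    set (l := ccode (a + h + 2) c) in *.
    rewrite app_assoc in Hc. apply code_at_app in Hc. destruct Hc as [Hcb Hc].
    rewrite length_app in Hc. simpl length in Hc. fold h in Hc. rewrite Nat.add_assoc in Hc.
    apply code_at_hd in Hc.
    rewrite !length_app, !plus_INR in Hk. simpl length in Hk. fold h in Hk. simpl INR in Hk.
    pose proof (pos_INR h). pose proof (pos_INR (length l)).
    assert (Hend : (a + length (bpre b ++ [snd (bcode b (a + h + 2))] ++ [Jmp (a + h + 2 + length l + 1)] ++ l ++ [Jmp a]) = a + h + 2 + length l + 1)%nat).
    { rewrite !length_app. simpl length. fold h. lia. }
    rewrite Hend in HK.
    assert (H9 : within p G (at_pc a mm) ((kappa * B + e + 1) + (INR h + 1))).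
    { eapply within_bcode; [eassumption|exact Hs|exact Hcb|].
      intros mm' Hs'. rewrite Hb. fold h.
      eapply within_jmp; [exact Hc|]. eapply HK; eassumption. }
    eapply within_weaken; [exact H9|]. lra.
  - pose proof Hc as Hc0. pose proof Hk as Hk0. pose proof HK as HK0.
    cbn [ccode] in Hc, Hk, HK. cbv zeta in Hc, Hk, HK.
    set (h := length (bpre b)) in *.
    set (l := ccode (a + h + 2) c) in *.
    rewrite app_assoc in Hc. apply code_at_app in Hc. destruct Hc as [Hcb Hc].
    rewrite length_app in Hc. simpl length in Hc. fold h in Hc. rewrite Nat.add_assoc in Hc.
    apply code_at_tl in Hc. replace (S (a + h + 1)) with (a + h + 2)%nat in Hc by lia.
    change (code_at p (a + h + 2) (l ++ [Jmp a])) in Hc.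
    apply code_at_app in Hc. destruct Hc as [Hcl Hcj]. apply code_at_hd in Hcj.
    rewrite !length_app, !plus_INR in Hk. simpl length in Hk. fold h in Hk. simpl INR in Hk.
    pose proof (pos_INR h). pose proof (pos_INR (length l)).
    assert (H9 : within p G (at_pc a mm) ((kappa * B + (e + 1)) + (INR h + 1))).
    { eapply within_bcode; [eassumption|exact Hs|exact Hcb|].
      intros mm' Hs'. rewrite Hb. fold h.
      apply IH1; [assumption|exact Hcl|exact Hs'|lra|fold l; lra|].
      intros s2 B2 mm2 HK2 Hs2. fold l. rewrite <- Rplus_assoc.
      eapply within_jmp; [exact Hcj|].
      eapply IH2; [exact HK2| |exact Hc0|exact Hs2|exact He|exact Hk0|exact HK0].
      simpl. apply andb_true_iff. split; assumption. }
    eapply within_weaken; [exact H9|]. lra.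
  - eapply within_weaken; [apply IH; eassumption|].
    pose proof (pos_INR (length (ccode a c))). nra.
Qed.

End Soundness.

End Compiler.

(** * Finite sums, averages and expectations *)

Fixpoint rsum (n : nat) (f : nat -> R) : R :=
  match n with O => 0 | S n => rsum n f + f n end.

Lemma rsum_ext n f g : (forall i, (i < n)%nat -> f i = g i) -> rsum n f = rsum n g.
Proof. induction n as [|n IH]; simpl; intros H; [reflexivity|]. rewrite IH, H; auto. Qed.

Lemma rsum_le n f g : (forall i, (i < n)%nat -> f i <= g i) -> rsum n f <= rsum n g.
Proof.
  induction n as [|n IH]; simpl; intros H; [lra|].
  assert (rsum n f <= rsum n g) by (apply IH; auto). specialize (H n). assert (f n <= g n) by auto. lra.
Qed.

Lemma rsum_const n c : rsum n (fun _ => c) = INR n * c.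
Proof. induction n as [|n IH]; [simpl; lra|]. cbn [rsum]. rewrite IH, S_INR. lra. Qed.

Lemma rsum_plus n f g : rsum n (fun i => f i + g i) = rsum n f + rsum n g.
Proof. induction n as [|n IH]; simpl; [lra|]. rewrite IH. lra. Qed.

Lemma rsum_scal n c f : rsum n (fun i => c * f i) = c * rsum n f.
Proof. induction n as [|n IH]; simpl; [lra|]. rewrite IH. lra. Qed.

Lemma rsum_app n m f : rsum (n + m) f = rsum n f + rsum m (fun i => f (n + i)%nat).
Proof.
  induction m as [|m IH]; [rewrite Nat.add_0_r; simpl; lra|].
  rewrite Nat.add_succ_r. cbn [rsum]. rewrite IH. lra.
Qed.

Lemma rsum_swap n m f :
  rsum n (fun i => rsum m (fun j => f i j)) = rsum m (fun j => rsum n (fun i => f i j)).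
Proof.
  induction n as [|n IH]; simpl.
  - symmetry. rewrite rsum_const. lra.
  - rewrite IH, rsum_plus. reflexivity.
Qed.

Definition avg (n : nat) (f : nat -> R) : R := rsum n f / INR n.

(** The mean of [f] over the numbers obtained from [v] by appending [r] fair binary digits; its
    recursion is that of the loop that draws bits. *)
Fixpoint bit_avg (r v : nat) (f : nat -> R) : R :=
  match r with
  | O => f v
  | S r => (bit_avg r (2 * v) f + bit_avg r (2 * v + 1) f) / 2
  end.

Lemma bit_avg_rsum r : forall v f,
  bit_avg r v f = rsum (2 ^ r) (fun i => f (v * 2 ^ r + i)%nat) / 2 ^ r.
Proof.
  induction r as [|r IH]; intros v f; cbn [bit_avg].
  - simpl. rewrite Nat.mul_1_r, Nat.add_0_r. lra.
  - rewrite !IH. change (2 ^ S r)%nat with (2 * 2 ^ r)%nat.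
    replace (2 * 2 ^ r)%nat with (2 ^ r + 2 ^ r)%nat by lia.
    rewrite rsum_app.
    rewrite (rsum_ext _ (fun i => f (2 * v * 2 ^ r + i)%nat) (fun i => f (v * (2 ^ r + 2 ^ r) + i)%nat))
      by (intros i _; f_equal; lia).
    rewrite (rsum_ext _ (fun i => f ((2 * v + 1) * 2 ^ r + i)%nat)
      (fun i => f (v * (2 ^ r + 2 ^ r) + (2 ^ r + i))%nat)) by (intros i _; f_equal; lia).
    simpl pow. field. apply pow_nonzero. lra.
Qed.

Lemma bit_avg_avg r f : bit_avg r 0 f = avg (2 ^ r) f.
Proof.
  rewrite bit_avg_rsum. unfold avg. rewrite pow_INR. reflexivity.
Qed.

(** The expectation over [m] independent uniform draws from 0, ..., n - 1, by conditioning on the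
    first of them. *)
Fixpoint expect (n m : nat) (f : list nat -> R) : R :=
  match m with
  | O => f []
  | S m => avg n (fun v => expect n m (fun l => f (v :: l)))
  end.

Lemma avg_ext n f g : (forall v, (v < n)%nat -> f v = g v) -> avg n f = avg n g.
Proof. intros H. unfold avg. rewrite (rsum_ext _ _ _ H). reflexivity. Qed.

Definition draws (n m : nat) (l : list nat) : Prop :=
  length l = m /\ Forall (fun v => (v < n)%nat) l.

Lemma draws_cons n m v l : (v < n)%nat -> draws n m l -> draws n (S m) (v :: l).
Proof. intros Hv [H1 H2]. split; simpl; [lia|constructor; assumption]. Qed.

Lemma expect_ext n m : forall f g,
  (forall l, draws n m l -> f l = g l) -> expect n m f = expect n m g.
Proof.
  induction m as [|m IH]; simpl; intros f g H.
  - apply H. split; constructor.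
  - apply avg_ext. intros v Hv. apply IH. intros l Hl. apply H. apply draws_cons; assumption.
Qed.

(** * Cost triples *)

Section Logic.

Variable beta : nat.

Notation ecost := (ecost beta).

(** A triple for total correctness with cost at most [t], in continuation form. Since [K] and [B]
    are arbitrary, such a triple can be placed before any random command. *)
Definition det (c : cmd) (s : store) (t : R) (Q : store -> Prop) : Prop :=
  forall K B, (forall s', Q s' -> K s' B) -> ecost c K s (B + t).

Lemma det_weaken c s t t' (Q Q' : store -> Prop) :
  det c s t Q -> t <= t' -> (forall s', Q s' -> Q' s') -> det c s t' Q'.
Proof.
  intros H Ht HQ K B HK. eapply ecost_weaken; [apply H|].
  - intros s' Hs'. apply HK, HQ, Hs'.
  - lra.
Qed.

Lemma det_le c s t t' Q : det c s t Q -> t <= t' -> det c s t' Q.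
Proof. intros H Ht. eapply det_weaken; eauto. Qed.

Lemma det_skip s (Q : store -> Prop) : Q s -> det Skip s 0 Q.
Proof. intros H K B HK. rewrite Rplus_0_r. apply ecost_skip. auto. Qed.

Lemma det_setI a e1 e2 s (Q : store -> Prop) :
  Q (setI s a (ieval e1 s) (ieval e2 s)) -> det (SetI a e1 e2) s 1 Q.
Proof. intros H K B HK. apply ecost_setI. auto. Qed.

Lemma det_setR a e1 e2 s (Q : store -> Prop) :
  Q (setR s a (ieval e1 s) (reval e2 s)) -> det (SetR a e1 e2) s 1 Q.
Proof. intros H K B HK. apply ecost_setR. auto. Qed.

Lemma det_setLow e1 e2 s (Q : store -> Prop) :
  (ieval e1 s < beta)%nat ->
  Q (setLow s (ieval e1 s) (reval e2 s)) -> det (SetLow e1 e2) s 1 Q.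
Proof. intros H1 H K B HK. apply ecost_setLow; auto. Qed.

Lemma det_getLow a e1 e2 s (Q : store -> Prop) :
  (ieval e2 s < beta)%nat ->
  Q (setR s a (ieval e1 s) (low s (ieval e2 s))) -> det (GetLow a e1 e2) s 1 Q.
Proof. intros H1 H K B HK. apply ecost_getLow; auto. Qed.

Lemma det_seq c1 c2 s t1 t2 (Q1 Q : store -> Prop) :
  det c1 s t1 Q1 -> (forall s', Q1 s' -> det c2 s' t2 Q) -> det (Seq c1 c2) s (t1 + t2) Q.
Proof.
  intros H1 H2 K B HK.
  apply ecost_seq with (K1 := fun s' B' => Q1 s' /\ B' = B + t2).
  - replace (B + (t1 + t2)) with ((B + t2) + t1) by lra.
    apply H1. auto.
  - intros s' B' [HQ ->]. apply H2; auto.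
Qed.

Lemma det_if b c1 c2 s t Q :
  det (if beval b s then c1 else c2) s t Q -> det (If b c1 c2) s (t + 1) Q.
Proof.
  intros H K B HK. rewrite <- Rplus_assoc. apply ecost_if. apply H. exact HK.
Qed.

Lemma det_while_false b c s (Q : store -> Prop) :
  beval b s = false -> Q s -> det (While b c) s 1 Q.
Proof. intros H HQ K B HK. apply ecost_while_false; auto. Qed.

Lemma det_while_true b c s t1 t2 (Q1 Q : store -> Prop) :
  beval b s = true -> det c s t1 Q1 ->
  (forall s', Q1 s' -> det (While b c) s' t2 Q) ->
  det (While b c) s (t1 + t2 + 1) Q.
Proof.
  intros Hb H1 H2 K B HK. replace (B + (t1 + t2 + 1)) with ((B + t2 + t1) + 1) by lra.
  apply ecost_while_true with (K1 := fun s' B' => Q1 s' /\ B' = B + t2).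
  - exact Hb.
  - apply H1. auto.
  - intros s' B' [HQ ->]. apply H2; auto.
Qed.

Lemma det_while_iter b c (I : nat -> store -> Prop) (t : nat -> R) n :
  (forall j s, (j < n)%nat -> I j s -> beval b s = true /\ det c s (t j) (I (S j))) ->
  (forall s, I n s -> beval b s = false) ->
  forall s, I 0%nat s -> det (While b c) s (rsum n t + INR n + 1) (I n).
Proof.
  intros Hb He.
  assert (H : forall m j s, (j + m = n)%nat -> I j s ->
    det (While b c) s (rsum m (fun i => t (j + i)%nat) + INR m + 1) (I n)).
  { induction m as [|m IH]; intros j s Hj Hs.
    - assert (j = n) by lia. subst j.
      eapply det_le; [apply det_while_false; auto|simpl; lra].
    - destruct (Hb j s) as [H1 H2]; [lia|exact Hs|].
      eapply det_le; [eapply det_while_true; [exact H1|exact H2|]|].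
      + intros s' Hs'. apply (IH (S j)); [lia|exact Hs'].
      + replace (S m) with (1 + m)%nat by lia. rewrite rsum_app, plus_INR. simpl.
        rewrite Nat.add_0_r.
        rewrite (rsum_ext m (fun i => t (S (j + i))) (fun i => t (j + S i)%nat))
          by (intros i _; f_equal; lia). lra. }
  intros s Hs. apply (H n 0%nat s); [lia|exact Hs].
Qed.

End Logic.

Definition var (a : nat) : iexp := IA a (IC 0).
Definition rvar (a : nat) : rexp := RA a (IC 0).
Definition assign (a : nat) (e : iexp) : cmd := SetI a (IC 0) e.
Definition rassign (a : nat) (e : rexp) : cmd := SetR a (IC 0) e.
Definition inc (a : nat) : cmd := assign a (IPlus (var a) (IC 1)).
Definition less (e1 e2 : iexp) : bexp := BI (IPlus e1 (IC 1)) e2.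
Definition for_loop (i : nat) (hi : iexp) (c : cmd) : cmd :=
  Seq (assign i (IC 0)) (While (less (var i) hi) (Seq c (inc i))).

Section Rules.

Variable beta : nat.

Notation det := (det beta).

Lemma beval_less e1 e2 s : beval (less e1 e2) s = Nat.ltb (ieval e1 s) (ieval e2 s).
Proof. unfold less, Nat.ltb. simpl. rewrite Nat.add_1_r. reflexivity. Qed.

(** Two units per round pay for the test and the increment, two more for the initialisation and the
    failing test. *)
Lemma det_for_sum i hi c (I : nat -> store -> Prop) (t : nat -> R) n s (Q : store -> Prop) :
  (forall j s, (j <= n)%nat -> I j s -> ia s i 0 = j /\ ieval hi s = n) ->
  (forall j s, (j < n)%nat -> I j s ->
     det c s (t j) (fun s' => ia s' i 0 = j /\ I (S j) (setI s' i 0 (S j)))) ->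
  I 0%nat (setI s i 0 0) ->
  (forall s', I n s' -> Q s') ->
  det (for_loop i hi c) s (rsum n t + 2 * INR n + 2) Q.
Proof.
  intros H1 H2 H3 HQ.
  eapply det_weaken; [eapply det_seq|..].
  - apply det_setI. cbn [ieval]. exact (eq_refl (setI s i 0 0)).
  - intros s' <-. apply det_while_iter with (I := I) (n := n) (t := fun j => t j + 1).
    + intros j s' Hj Hs'. destruct (H1 j s') as [E1 E2]; [lia|exact Hs'|]. split.
      * rewrite beval_less. cbn [ieval var]. apply Nat.ltb_lt. rewrite E1, E2. exact Hj.
      * eapply det_seq; [apply H2; assumption|]. intros s2 [E3 Hs2].
        apply det_setI. cbn [ieval var]. rewrite E3, Nat.add_1_r. exact Hs2.
    + intros s' Hs'. destruct (H1 n s') as [E1 E2]; [lia|exact Hs'|].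
      rewrite beval_less. cbn [ieval var]. apply Nat.ltb_ge. rewrite E1, E2. lia.
    + exact H3.
  - rewrite rsum_plus, rsum_const. lra.
  - exact HQ.
Qed.

Lemma det_for i hi c (I : nat -> store -> Prop) t n s (Q : store -> Prop) :
  (forall j s, (j <= n)%nat -> I j s -> ia s i 0 = j /\ ieval hi s = n) ->
  (forall j s, (j < n)%nat -> I j s ->
     det c s t (fun s' => ia s' i 0 = j /\ I (S j) (setI s' i 0 (S j)))) ->
  I 0%nat (setI s i 0 0) ->
  (forall s', I n s' -> Q s') ->
  det (for_loop i hi c) s (INR n * (t + 2) + 2) Q.
Proof.
  intros H1 H2 H3 HQ. eapply det_le; [eapply det_for_sum with (t := fun _ => t); eassumption|].
  rewrite rsum_const. lra.
Qed.

End Rules.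

(** * Frame conditions *)

Definition keep (A B : list nat) (s s' : store) : Prop :=
  (forall a i, ~ In a A -> ia s' a i = ia s a i) /\
  (forall a i, ~ In a B -> ra s' a i = ra s a i) /\
  (forall i, low s' i = low s i).

Lemma keep_refl A B s : keep A B s s.
Proof. repeat split; auto. Qed.

Lemma keep_trans A B s1 s2 s3 : keep A B s1 s2 -> keep A B s2 s3 -> keep A B s1 s3.
Proof.
  intros (H1 & H2 & H3) (G1 & G2 & G3). repeat split; intros; rewrite ?G1, ?G2, ?G3; auto.
Qed.

Lemma keep_incl A B A' B' s s' : incl A A' -> incl B B' -> keep A B s s' -> keep A' B' s s'.
Proof. intros HA HB (H1 & H2 & H3). repeat split; intros; auto. Qed.

Lemma upd2_other {X : Type} (f : nat -> nat -> X) a i v a' i' : a' <> a -> upd2 f a i v a' i' = f a' i'.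
Proof. intros H. unfold upd2. apply Nat.eqb_neq in H. rewrite H. reflexivity. Qed.

Lemma upd2_same {X : Type} (f : nat -> nat -> X) a i v : upd2 f a i v a i = v.
Proof. unfold upd2. rewrite !Nat.eqb_refl. reflexivity. Qed.

Lemma keep_setI A B s s' a i v : In a A -> keep A B s s' -> keep A B s (setI s' a i v).
Proof.
  intros Ha (H1 & H2 & H3). repeat split; simpl; auto. intros a' i' Ha'.
  rewrite upd2_other; auto. congruence.
Qed.

Lemma keep_setR A B s s' a i v : In a B -> keep A B s s' -> keep A B s (setR s' a i v).
Proof.
  intros Ha (H1 & H2 & H3). repeat split; simpl; auto. intros a' i' Ha'.
  rewrite upd2_other; auto. congruence.
Qed.

Ltac index_tac := repeat constructor; simpl; lia.
Ltac reduce := cbn [ieval reval beval var rvar ia ra low setI setR setLow opsem upd2 Nat.eqb].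
Ltac keep_tac := repeat first
  [apply keep_setI; [simpl; tauto|] | apply keep_setR; [simpl; tauto|]]; try assumption; try apply keep_refl.
Ltac use_keep H := let E := fresh in pose proof (proj1 H) as E; rewrite ?E by (simpl; lia); clear E.

(** * Random draws *)

(* The number of values of a draw is scalar 6, a power of two; the result is
   left in scalar 8. *)
Definition draw : cmd :=
  Seq (assign 8 (IC 0)) (Seq (assign 9 (IC 1))
  (While (less (var 9) (var 6))
    (Seq (Flip 10)
    (Seq (assign 8 (IPlus (IPlus (var 8) (var 8)) (var 10)))
         (assign 9 (IPlus (var 9) (var 9))))))).

Definition drawn (s s' : store) (v : nat) : Prop :=
  ia s' 8 0 = v /\ keep [8;9;10]%nat [] s s'.

Section Draws.

Variable beta : nat.

Notation ecost := (ecost beta).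

Lemma ecost_det c s t Q (K : store -> R -> Prop) B :
  det beta c s t Q -> (forall s', Q s' -> K s' B) -> ecost c K s (B + t).
Proof. intros H HK. apply H. exact HK. Qed.

(** The range is a power of two, so L flips give an exactly uniform value without rejection. After l
    flips scalar 9 holds 2^l and scalar 8 a uniform number below it; each bit costs a test, a flip
    and two assignments. *)
Lemma ecost_draw L s (K : store -> R -> Prop) (F : nat -> R) :
  ia s 6 0 = (2 ^ L)%nat ->
  (forall v s', (v < 2 ^ L)%nat -> drawn s s' v -> K s' (F v)) ->
  ecost draw K s (avg (2 ^ L) F + (4 * INR L + 3)).
Proof.
  intros HL HK.
  assert (Hloop : forall r l v s', (l + r = L)%nat -> (v < 2 ^ l)%nat ->
    ia s' 9 0 = (2 ^ l)%nat -> ia s' 8 0 = v -> keep [8;9;10]%nat [] s s' ->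
    ecost (While (less (var 9) (var 6))
    (Seq (Flip 10)
    (Seq (assign 8 (IPlus (IPlus (var 8) (var 8)) (var 10)))
         (assign 9 (IPlus (var 9) (var 9)))))) K s' (bit_avg r v F + (4 * INR r + 1))).
  { induction r as [|r IH]; intros l v s' Hl Hv H9 H8 Hk;
      assert (H6 : ia s' 6 0 = (2 ^ L)%nat) by (rewrite <- HL; apply Hk; simpl; lia).
    - assert (l = L) by lia. subst l. simpl bit_avg. rewrite <- Rplus_assoc.
      apply ecost_while_false.
      + rewrite beval_less. cbn [ieval var]. apply Nat.ltb_ge. lia.
      + simpl INR. rewrite Rmult_0_r, Rplus_0_r. apply HK; [exact Hv|]. split; assumption.
    - cbn [bit_avg].
      replace ((bit_avg r (2 * v) F + bit_avg r (2 * v + 1) F) / 2 + (4 * INR (S r) + 1))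
        with (((bit_avg r (2 * v) F + (4 * INR r + 1) + 1 + 1) +
               (bit_avg r (2 * v + 1) F + (4 * INR r + 1) + 1 + 1)) / 2 + 1 + 1)
        by (rewrite S_INR; lra).
      apply ecost_while_true with (K1 := fun s2 B => exists v2, (v2 < 2 ^ S l)%nat /\
        ia s2 9 0 = (2 ^ S l)%nat /\ ia s2 8 0 = v2 /\ keep [8;9;10]%nat [] s s2 /\
        B = bit_avg r v2 F + (4 * INR r + 1)).
      + rewrite beval_less. cbn [ieval var]. apply Nat.ltb_lt. rewrite H9, H6.
        apply Nat.pow_lt_mono_r; lia.
      + apply ecost_seq with (K1 := fun s2 B => exists bit, (bit < 2)%nat /\ s2 = setI s' 10 0 bit /\
          B = bit_avg r (2 * v + bit) F + (4 * INR r + 1) + 1 + 1).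
        * apply ecost_flip; [exists 0%nat|exists 1%nat]; rewrite ?Nat.add_0_r; auto.
        * intros s2 B (bit & Hbit & -> & ->).
          rewrite Rplus_assoc. eapply ecost_det.
          { eapply det_seq.
            - apply det_setI. exact (eq_refl (setI _ _ _ _)).
            - intros s3 <-. apply det_setI. exact (eq_refl (setI _ _ _ _)). }
          intros s3 <-. exists (2 * v + bit)%nat.
          cbn [ieval var setI ia]. unfold upd2. cbn [Nat.eqb].
          rewrite H9, H8. split; [|split; [|split; [|split]]].
          -- simpl. lia.
          -- simpl. lia.
          -- lia.
          -- keep_tac.
          -- reflexivity.
      + intros s2 B (v2 & Hv2 & A9 & A8 & Ak & ->). apply (IH (S l)); auto. lia. }
  rewrite <- bit_avg_avg.
  replace (bit_avg L 0 F + (4 * INR L + 3)) with (bit_avg L 0 F + (4 * INR L + 1) + 1 + 1) by lra.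
  apply ecost_seq with (K1 := fun s1 B1 => s1 = setI s 8 0 0 /\ B1 = bit_avg L 0 F + (4 * INR L + 1) + 1).
  { apply ecost_setI. split; reflexivity. }
  intros s1 B1 [-> ->].
  apply ecost_seq with (K1 := fun s1 B1 => s1 = setI (setI s 8 0 0) 9 0 1 /\ B1 = bit_avg L 0 F + (4 * INR L + 1)).
  { apply ecost_setI. split; reflexivity. }
  intros s2 B2 [-> ->]. apply (Hloop L 0%nat 0%nat); try reflexivity; try lia.
  - simpl. lia.
  - keep_tac.
Qed.

(** The bound [F] on what follows may depend on the complete list of draws. With the prefix [l]
    known, the loop is charged the expectation of [F] over the draws still to come. *)
Lemma ecost_draws b c L m (rel : list nat -> store -> Prop) t
    (K : store -> R -> Prop) (F : list nat -> R) :
  (forall l s, rel l s -> beval b s = (length l <? m)%nat /\ ia s 6 0 = (2 ^ L)%nat) ->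
  (forall l s s' v, rel l s -> (length l < m)%nat -> (v < 2 ^ L)%nat -> drawn s s' v ->
     det beta c s' t (rel (l ++ [v]))) ->
  (forall l s, length l = m -> rel l s -> K s (F l)) ->
  forall r l s, (length l + r = m)%nat -> rel l s ->
  ecost (While b (Seq draw c)) K s
    (expect (2 ^ L) r (fun l' => F (l ++ l')) + (INR r * (4 * INR L + 4 + t) + 1)).
Proof.
  intros Hb Hc HK.
  induction r as [|r IH]; intros l s Hl Hs; destruct (Hb l s Hs) as [Hb1 H6].
  - rewrite <- Rplus_assoc. apply ecost_while_false.
    + rewrite Hb1. apply Nat.ltb_ge. lia.
    + cbn [expect]. rewrite app_nil_r. simpl INR. rewrite Rmult_0_l, Rplus_0_r.
      apply HK; [lia|exact Hs].
  - set (u := INR r * (4 * INR L + 4 + t) + 1).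
    cbn [expect].
    replace (avg (2 ^ L) (fun v => expect (2 ^ L) r (fun l' => F (l ++ v :: l'))) +
       (INR (S r) * (4 * INR L + 4 + t) + 1))
      with (avg (2 ^ L) (fun v => expect (2 ^ L) r (fun l' => F ((l ++ [v]) ++ l')) + u + t)
        + (4 * INR L + 3) + 1).
    + apply ecost_while_true with (K1 := fun s2 B => exists v, rel (l ++ [v]) s2 /\
        B = expect (2 ^ L) r (fun l' => F ((l ++ [v]) ++ l')) + u).
      * rewrite Hb1. apply Nat.ltb_lt. lia.
      * apply ecost_seq with (K1 := fun s2 B => exists v, (v < 2 ^ L)%nat /\ drawn s s2 v /\
          B = expect (2 ^ L) r (fun l' => F ((l ++ [v]) ++ l')) + u + t).
        -- apply ecost_draw; [exact H6|]. intros v s' Hv Hd. exists v. auto.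
        -- intros s2 B (v & Hv & Hd & ->). eapply ecost_det.
           ++ apply (Hc l s s2 v Hs); auto. lia.
           ++ intros s3 H3. exists v. auto.
      * intros s2 B (v & Hr & ->). apply IH; [|exact Hr]. rewrite length_app. simpl. lia.
    + assert (Hn : INR (2 ^ L) <> 0).
      { apply not_0_INR. apply Nat.pow_nonzero. lia. }
      rewrite (avg_ext _ _ (fun v => expect (2 ^ L) r (fun l' => F (l ++ v :: l')) + (u + t))).
      * unfold avg. rewrite rsum_plus, rsum_const, S_INR. unfold u. field. exact Hn.
      * intros v _. rewrite (expect_ext _ _ _ (fun l' => F (l ++ v :: l'))); [lra|].
        intros l' _. rewrite <- app_assoc. reflexivity.
Qed.

End Draws.

(** * Bounded overlap of separated balls *)

Definition edist (d : nat) (x y : list R) : R := sqrt (dist2 d x y).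

Lemma sum_seq n f : fold_right Rplus 0 (map f (seq 0 n)) = rsum n f.
Proof.
  induction n as [|n IH]; [reflexivity|].
  rewrite seq_S, map_app, fold_right_app. simpl. rewrite <- IH.
  assert (H : forall l a, fold_right Rplus a l = fold_right Rplus 0 l + a).
  { induction l as [|x l IHl]; intros a; simpl; [lra|]. rewrite IHl. lra. }
  rewrite (H _ (f n + 0)). lra.
Qed.

Lemma dist2_rsum d x y : dist2 d x y = rsum d (fun j => (nth j x 0 - nth j y 0) ^ 2).
Proof. apply sum_seq. Qed.

Lemma rsum_nonneg n f : (forall i, (i < n)%nat -> 0 <= f i) -> 0 <= rsum n f.
Proof.
  intros H. replace 0 with (rsum n (fun _ => 0)) by (rewrite rsum_const; lra).
  apply rsum_le. exact H.
Qed.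

Lemma rsum_le_term n f i : (forall i, (i < n)%nat -> 0 <= f i) -> (i < n)%nat -> f i <= rsum n f.
Proof.
  induction n as [|n IH]; intros H Hi; [lia|]. cbn [rsum].
  assert (0 <= rsum n f) by (apply rsum_nonneg; auto).
  destruct (Nat.eq_dec i n) as [->|Hn]; [lra|].
  assert (f i <= rsum n f) by (apply IH; [auto|lia]). specialize (H n). assert (0 <= f n) by auto. lra.
Qed.

Lemma dist2_nonneg d x y : 0 <= dist2 d x y.
Proof. rewrite dist2_rsum. apply rsum_nonneg. intros i _. apply pow2_ge_0. Qed.

Lemma dist2_sym d x y : dist2 d x y = dist2 d y x.
Proof. rewrite !dist2_rsum. apply rsum_ext. intros i _. ring. Qed.

Lemma edist_nonneg d x y : 0 <= edist d x y.
Proof. apply sqrt_pos. Qed.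

Lemma edist_sym d x y : edist d x y = edist d y x.
Proof. unfold edist. rewrite dist2_sym. reflexivity. Qed.

Lemma edist_sq d x y : edist d x y * edist d x y = dist2 d x y.
Proof. apply sqrt_sqrt, dist2_nonneg. Qed.

Lemma edist_refl d x : edist d x x = 0.
Proof.
  unfold edist. rewrite dist2_rsum, (rsum_ext _ _ (fun _ => 0)) by (intros i _; ring).
  rewrite rsum_const, Rmult_0_r. apply sqrt_0.
Qed.

Lemma edist_zero d x y : length x = d -> length y = d -> edist d x y = 0 -> x = y.
Proof.
  intros Hx Hy H. apply nth_ext with (d := 0) (d' := 0); [congruence|]. intros i Hi.
  assert (H0 : dist2 d x y = 0) by (rewrite <- edist_sq, H; ring).
  rewrite dist2_rsum in H0.
  assert (H1 := rsum_le_term d (fun j => (nth j x 0 - nth j y 0) ^ 2) i).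
  cbv beta in H1. rewrite H0 in H1.
  assert (H2 : (nth i x 0 - nth i y 0) ^ 2 <= 0) by (apply H1; [intros; apply pow2_ge_0|lia]).
  apply Rminus_diag_uniq, Rsqr_0_uniq. unfold Rsqr. pose proof (pow2_ge_0 (nth i x 0 - nth i y 0)). lra.
Qed.

(** Coordinatewise |u - v|^2 <= 2 |u|^2 + 2 |v|^2, because |u + v|^2 >= 0. This takes the place of
    the triangle inequality. *)
Lemma edist_le_double d x y z b : edist d x z <= b -> edist d y z <= b -> edist d x y <= b + b.
Proof.
  intros H1 H2. pose proof (edist_nonneg d x z). pose proof (edist_nonneg d x y).
  pose proof (edist_sq d x z). pose proof (edist_sq d y z). pose proof (edist_sq d x y).
  assert (H6 : dist2 d x y <= 2 * dist2 d x z + 2 * dist2 d y z).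
  { rewrite !dist2_rsum, <- !rsum_scal, <- rsum_plus. apply rsum_le. intros i _. cbv beta.
    pose proof (pow2_ge_0 ((nth i x 0 - nth i z 0) + (nth i y 0 - nth i z 0))). lra. }
  pose proof (edist_nonneg d y z).
  apply Rnot_lt_le. intros Hlt. nra.
Qed.

Lemma length_filter_split {A : Type} (f : A -> bool) (l : list A) :
  length l = (length (filter f l) + length (filter (fun x => negb (f x)) l))%nat.
Proof. induction l as [|x l IH]; simpl; [reflexivity|]. destruct (f x); simpl; lia. Qed.

Lemma length_le_classes {A : Type} (f : A -> nat) m b : forall l : list A,
  (forall x, In x l -> (f x < b)%nat) ->
  (forall v, (length (filter (fun x => Nat.eqb (f x) v) l) <= m)%nat) ->
  (length l <= b * m)%nat.
Proof.
  induction b as [|b IH]; intros l H1 H2.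
  - destruct l as [|x l]; [simpl; lia|]. specialize (H1 x (or_introl eq_refl)). lia.
  - rewrite (length_filter_split (fun x => Nat.eqb (f x) b)).
    specialize (IH (filter (fun x => negb (Nat.eqb (f x) b)) l)).
    assert (length (filter (fun x => negb (Nat.eqb (f x) b)) l) <= b * m)%nat.
    { apply IH.
      - intros x Hx. apply filter_In in Hx. destruct Hx as [Hx Hn]. specialize (H1 x Hx).
        apply negb_true_iff, Nat.eqb_neq in Hn. lia.
      - intros v. specialize (H2 v). etransitivity; [|exact H2].
        clear. induction l as [|x l IHl]; simpl; [lia|].
        destruct (Nat.eqb (f x) b); simpl; destruct (Nat.eqb (f x) v); simpl; lia. }
    specialize (H2 b). lia.
Qed.

(** Induction on the number of coordinates: the elements with a given last coordinate are separated
    by the remaining ones. *)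
Lemma pigeonhole {A : Type} (f : nat -> A -> nat) b d : forall l : list A,
  NoDup l -> (forall x j, In x l -> (f j x < b)%nat) ->
  (forall x y, In x l -> In y l -> x <> y -> exists j, (j < d)%nat /\ f j x <> f j y) ->
  (length l <= b ^ d)%nat.
Proof.
  induction d as [|d IH]; intros l Hnd Hb Hsep.
  - destruct l as [|x [|y l]]; [simpl; lia|simpl; lia|exfalso].
    destruct (Hsep x y) as (j & Hj & _); simpl; auto; [|lia].
    inversion Hnd as [|? ? Hn _]. intros ->. apply Hn. simpl. auto.
  - simpl. apply length_le_classes with (f := f d); [auto|].
    intros v. apply IH.
    + apply NoDup_filter. exact Hnd.
    + intros x j Hx. apply filter_In in Hx. apply Hb. apply Hx.
    + intros x y Hx Hy Hxy. apply filter_In in Hx. apply filter_In in Hy.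
      destruct Hx as [Hx Ex]. destruct Hy as [Hy Ey].
      apply Nat.eqb_eq in Ex. apply Nat.eqb_eq in Ey.
      destruct (Hsep x y Hx Hy Hxy) as (j & Hj & Hne).
      exists j. split; [|exact Hne].
      destruct (Nat.eq_dec j d) as [->|]; [congruence|lia].
Qed.

(** Index of a cell of width 1/s. For x >= -1 the value of [up] is positive, so [Z.to_nat]
    identifies no two cells. *)
Definition grid_cell (s : nat) (x : R) : nat := Z.to_nat (up ((x + 1) * INR s)).

Lemma grid_cell_bound s x : -1 <= x <= 1 -> (grid_cell s x < 2 * s + 2)%nat.
Proof.
  intros Hx. unfold grid_cell. destruct (archimed ((x + 1) * INR s)) as [H1 H2].
  pose proof (pos_INR s).
  assert (H3 : IZR (up ((x + 1) * INR s)) < IZR (2 * Z.of_nat s + 2)).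
  { rewrite plus_IZR, mult_IZR, <- INR_IZR_INZ. nra. }
  apply lt_IZR in H3. lia.
Qed.

Lemma grid_cell_eq s x y : -1 <= x <= 1 -> -1 <= y <= 1 ->
  grid_cell s x = grid_cell s y -> (x - y) * INR s < 1.
Proof.
  intros Hx Hy H. unfold grid_cell in H.
  destruct (archimed ((x + 1) * INR s)) as [H1 H2].
  destruct (archimed ((y + 1) * INR s)) as [H3 H4].
  pose proof (pos_INR s).
  assert (0 < up ((x + 1) * INR s))%Z by (apply lt_IZR; simpl; nra).
  assert (0 < up ((y + 1) * INR s))%Z by (apply lt_IZR; simpl; nra).
  assert (H7 : up ((x + 1) * INR s) = up ((y + 1) * INR s)) by lia.
  rewrite H7 in *. lra.
Qed.

(** Cells of side 1/(d + 1) in the cube [-1, 1]^d, fine enough since two points of one cell have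
    squared distance at most d / (d + 1)^2 < 1. The extra 1 is for a center at the common point,
    which has no direction. *)
Definition multiplicity (d : nat) : nat := (2 * (d + 1) + 2) ^ d + 1.

(* Two vectors [u, v] with [|u - v| >= max |u| |v|] form an angle of at least 60
   degrees, so only boundedly many can occur: their directions lie in different
   cells of a fine enough grid. *)
Lemma ball_multiplicity d (pt : nat -> list R) (r : nat -> R) (p : list R) (l : list nat) :
  NoDup l ->
  (forall x, In x l -> edist d (pt x) p <= r x) ->
  (forall x y, In x l -> In y l -> x <> y ->
     0 < edist d (pt x) (pt y) /\ r x <= edist d (pt x) (pt y)) ->
  (length l <= multiplicity d)%nat.
Proof.
  intros Hnd Hr Hsep.
  (* Directions make sense only for centers away from p; by separation at most one center is at
     distance 0 from it. *)
  set (far := fun x => negb (Rleb (edist d (pt x) p) 0)).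
  rewrite (length_filter_split far).
  assert (Hin : forall x, In x (filter (fun x => negb (far x)) l) -> In x l /\ edist d (pt x) p = 0).
  { intros x Hx. apply filter_In in Hx. destruct Hx as [Hx E]. split; [exact Hx|].
    unfold far, Rleb in E. pose proof (edist_nonneg d (pt x) p).
    destruct (Rle_dec (edist d (pt x) p) 0); simpl in E; [lra|discriminate]. }
  assert (Hz : (length (filter (fun x => negb (far x)) l) <= 1)%nat).
  { apply (NoDup_filter (fun x => negb (far x))) in Hnd.
    destruct (filter (fun x => negb (far x)) l) as [|x [|y m]]; [simpl; lia|simpl; lia|exfalso].
    destruct (Hin x) as [Ix Ex]; [simpl; auto|]. destruct (Hin y) as [Iy Ey]; [simpl; auto|].
    assert (Hxy : x <> y).
    { inversion Hnd as [|? ? Hn _]. intros ->. apply Hn. simpl. auto. }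
    destruct (Hsep x y Ix Iy Hxy) as [Hpos _].
    assert (edist d (pt x) (pt y) <= 0 + 0); [|lra].
    apply edist_le_double with (z := p); lra. }
  assert (Hf : (length (filter far l) <= (2 * (d + 1) + 2) ^ d)%nat).
  { set (a := fun x => edist d (pt x) p).
    set (e := fun j x => (nth j (pt x) 0 - nth j p 0) / a x).
    assert (Hin' : forall x, In x (filter far l) -> In x l /\ 0 < a x).
    { intros x Hx. apply filter_In in Hx. destruct Hx as [Hx E]. split; [exact Hx|].
      unfold far, Rleb in E. fold (a x) in E. destruct (Rle_dec (a x) 0); simpl in E; [discriminate|lra]. }
    assert (Hunit : forall x, 0 < a x -> rsum d (fun j => e j x * e j x) = 1).
    { intros x Hx.
      rewrite (rsum_ext _ _ (fun j => / (a x * a x) * (nth j (pt x) 0 - nth j p 0) ^ 2))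
        by (intros i _; unfold e; field; lra).
      rewrite rsum_scal, <- dist2_rsum, <- edist_sq. fold (a x). field. lra. }
    assert (He : forall x j, 0 < a x -> (j < d)%nat -> -1 <= e j x <= 1).
    { intros x j Hx Hj.
      assert (e j x * e j x <= 1).
      { rewrite <- (Hunit x Hx). apply (rsum_le_term d (fun j => e j x * e j x)); [intros; cbv beta; nra|exact Hj]. }
      split; nra. }
    assert (Hcase : d = 0%nat \/ (0 < d)%nat) by lia.
    apply pigeonhole with (f := fun j x => if Nat.ltb j d then grid_cell (d + 1) (e j x) else 0%nat).
    - apply NoDup_filter. exact Hnd.
    - intros x j Hx. destruct (Nat.ltb_spec j d); [|lia].
      apply grid_cell_bound. apply He; [apply Hin'; exact Hx|assumption].
    - intros x y Hx Hy Hxy.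
      destruct (Hin' x Hx) as [Ix Ax]. destruct (Hin' y Hy) as [Iy Ay].
      destruct (Hsep x y Ix Iy Hxy) as [_ S1].
      destruct (Hsep y x Iy Ix (fun E => Hxy (eq_sym E))) as [_ S2].
      rewrite edist_sym in S2.
      pose proof (Hr x Ix) as Rx. pose proof (Hr y Iy) as Ry. fold (a x) in Rx. fold (a y) in Ry.
      set (ip := rsum d (fun j => (nth j (pt x) 0 - nth j p 0) * (nth j (pt y) 0 - nth j p 0))).
      assert (Hd2 : dist2 d (pt x) (pt y) = a x * a x + a y * a y - 2 * ip).
      { unfold a. rewrite !edist_sq, !dist2_rsum. unfold ip.
        replace (2 * rsum d (fun j => (nth j (pt x) 0 - nth j p 0) * (nth j (pt y) 0 - nth j p 0)))
          with (- rsum d (fun j => -2 * ((nth j (pt x) 0 - nth j p 0) * (nth j (pt y) 0 - nth j p 0))))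
          by (rewrite rsum_scal; lra).
        unfold Rminus at 2. rewrite Ropp_involutive, <- !rsum_plus. apply rsum_ext. intros; ring. }
      pose proof (edist_sq d (pt x) (pt y)) as Hsq.
      (* With u, v the vectors from p to the centers, |u - v| >= r_x >= |u| leaves 2 u.v <= |v|^2 in
         the expansion of |u - v|^2, and symmetrically. *)
      assert (Hip1 : 2 * ip <= a y * a y) by nra.
      assert (Hip2 : 2 * ip <= a x * a x) by nra.
      (* The smaller of |u|^2 and |v|^2 is at most |u| |v|. Hence the cosine is at most 1/2 and the
         unit vectors are at distance at least 1. *)
      assert (Hip : 2 * ip <= a x * a y).
      { destruct (Rle_dec (a x) (a y)); nra. }
      assert (Hone : 1 <= rsum d (fun j => (e j x - e j y) * (e j x - e j y))).
      { rewrite (rsum_ext _ _ (fun j => (e j x * e j x + e j y * e j y) + (- 2 / (a x * a y)) *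
            ((nth j (pt x) 0 - nth j p 0) * (nth j (pt y) 0 - nth j p 0))))
          by (intros i _; unfold e; field; lra).
        rewrite !rsum_plus, rsum_scal, !Hunit by assumption. fold ip.
        assert (Hpos : 0 < a x * a y) by nra.
        assert (ip * / (a x * a y) <= / 2).
        { apply Rmult_le_reg_r with (a x * a y); [exact Hpos|].
          rewrite Rmult_assoc, Rinv_l by lra. lra. }
        unfold Rdiv. lra. }
      assert (Hex : exists j, (j < d)%nat /\ grid_cell (d + 1) (e j x) <> grid_cell (d + 1) (e j y)).
      { assert (Hdec : forall m, (m <= d)%nat ->
          (exists j, (j < m)%nat /\ grid_cell (d + 1) (e j x) <> grid_cell (d + 1) (e j y)) \/
          (forall j, (j < m)%nat -> grid_cell (d + 1) (e j x) = grid_cell (d + 1) (e j y))).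
        { induction m as [|m IHm]; intros Hm; [right; intros; lia|].
          destruct IHm as [(j & Hj & E)|Hall]; [lia|left; exists j; split; [lia|exact E]|].
          destruct (Nat.eq_dec (grid_cell (d + 1) (e m x)) (grid_cell (d + 1) (e m y))) as [E|E].
          - right. intros j Hj. destruct (Nat.eq_dec j m) as [->|]; [exact E|apply Hall; lia].
          - left. exists m. split; [lia|exact E]. }
        destruct (Hdec d (Nat.le_refl d)) as [H|H]; [exact H|exfalso].
        (* If all cells agreed, each coordinate would differ by less than 1/(d + 1), too little for
           the squared distance 1. *)
        assert (Hsmall : rsum d (fun j => (e j x - e j y) * (e j x - e j y))
                         <= rsum d (fun _ => 1 / (INR (d + 1) * INR (d + 1)))).
        { apply rsum_le. intros j Hj.
          pose proof (grid_cell_eq (d + 1) _ _ (He x j Ax Hj) (He y j Ay Hj) (H j Hj)).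
          pose proof (grid_cell_eq (d + 1) _ _ (He y j Ay Hj) (He x j Ax Hj) (eq_sym (H j Hj))).
          assert (0 < INR (d + 1)) by (apply lt_0_INR; lia).
          apply Rmult_le_reg_r with (INR (d + 1) * INR (d + 1)); [nra|].
          unfold Rdiv. rewrite Rmult_1_l, Rinv_l by nra.
          set (z := e j x - e j y) in *.
          replace (e j y - e j x) with (- z) in * by (unfold z; ring).
          nra. }
        rewrite rsum_const in Hsmall.
        assert (INR (d + 1) = INR d + 1) by (rewrite plus_INR; reflexivity).
        pose proof (pos_INR d).
        assert (INR d * (1 / (INR (d + 1) * INR (d + 1))) < 1); [|lra].
        apply Rmult_lt_reg_r with (INR (d + 1) * INR (d + 1)); [nra|].
        unfold Rdiv. rewrite Rmult_1_l, Rmult_assoc, Rinv_l by nra. nra. }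
      destruct Hex as (j & Hj & E). exists j. split; [exact Hj|].
      destruct (Nat.ltb_spec j d); [exact E|lia]. }
  unfold multiplicity. lia.
Qed.

(** * Counting in lists *)

Definition count {X : Type} (f : X -> bool) (l : list X) : nat := length (filter f l).

Definition Rltb (x y : R) : bool := negb (Rleb y x).

Lemma Rleb_true x y : Rleb x y = true <-> x <= y.
Proof. unfold Rleb. destruct (Rle_dec x y); split; intros; auto; discriminate. Qed.

Lemma Rleb_false x y : Rleb x y = false <-> y < x.
Proof. unfold Rleb. destruct (Rle_dec x y); split; intros; auto; try discriminate; lra. Qed.

Lemma Rltb_true x y : Rltb x y = true <-> x < y.
Proof. unfold Rltb. rewrite negb_true_iff. apply Rleb_false. Qed.

Lemma Rltb_false x y : Rltb x y = false <-> y <= x.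
Proof. unfold Rltb. rewrite negb_false_iff. apply Rleb_true. Qed.

Lemma count_cons {X : Type} (f : X -> bool) x l :
  count f (x :: l) = ((if f x then 1 else 0) + count f l)%nat.
Proof. unfold count. simpl. destruct (f x); reflexivity. Qed.

Lemma count_app {X : Type} (f : X -> bool) l1 l2 : count f (l1 ++ l2) = (count f l1 + count f l2)%nat.
Proof. unfold count. rewrite filter_app, length_app. reflexivity. Qed.

Lemma count_le {X : Type} (f g : X -> bool) l :
  (forall x, In x l -> f x = true -> g x = true) -> (count f l <= count g l)%nat.
Proof.
  induction l as [|x l IH]; intros H; [reflexivity|]. rewrite !count_cons.
  assert (count f l <= count g l)%nat by (apply IH; intros; apply H; simpl; auto).
  specialize (H x (or_introl eq_refl)). destruct (f x); [rewrite H by reflexivity; lia|lia].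
Qed.

Lemma count_ext {X : Type} (f g : X -> bool) l :
  (forall x, In x l -> f x = g x) -> count f l = count g l.
Proof.
  intros H. apply Nat.le_antisymm; apply count_le; intros x Hx E; specialize (H x Hx); congruence.
Qed.

Lemma count_le_length {X : Type} (f : X -> bool) l : (count f l <= length l)%nat.
Proof. unfold count. apply filter_length_le. Qed.

Lemma count_lt {X : Type} (f g : X -> bool) l x :
  (forall y, In y l -> f y = true -> g y = true) -> In x l -> f x = false -> g x = true ->
  (count f l < count g l)%nat.
Proof.
  induction l as [|y l IH]; intros H Hx Hf Hg; [destruct Hx|]. rewrite !count_cons.
  assert (Hl : (count f l <= count g l)%nat) by (apply count_le; intros; apply H; simpl; auto).
  destruct Hx as [->|Hx].
  - rewrite Hf, Hg. lia.
  - assert (count f l < count g l)%nat by (apply IH; auto; intros; apply H; simpl; auto).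
    specialize (H y (or_introl eq_refl)). destruct (f y); [rewrite H by reflexivity; lia|lia].
Qed.

Lemma count_pos {X : Type} (f : X -> bool) l x : In x l -> f x = true -> (0 < count f l)%nat.
Proof.
  intros Hx Hf. unfold count. assert (H : In x (filter f l)) by (apply filter_In; auto).
  destruct (filter f l); [destruct H|simpl; lia].
Qed.

Lemma count_filter {X : Type} (f g : X -> bool) l :
  count f (filter g l) = count (fun x => g x && f x) l.
Proof.
  induction l as [|x l IH]; [reflexivity|]. rewrite count_cons. cbn [filter].
  destruct (g x); simpl; [rewrite count_cons, IH; reflexivity|exact IH].
Qed.

Lemma count_rsum f n : INR (count f (seq 0 n)) = rsum n (fun i => if f i then 1 else 0).
Proof.
  induction n as [|n IH]; [reflexivity|].
  rewrite seq_S, count_app, plus_INR, IH. cbn [rsum]. f_equal. simpl.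
  unfold count. simpl. destruct (f n); simpl; reflexivity.
Qed.

Lemma count_seq_le f n : (count f (seq 0 n) <= n)%nat.
Proof. pose proof (count_le_length f (seq 0 n)). rewrite length_seq in H. exact H. Qed.

(** * The radius enclosing [m] points of a list *)

Section Radius.

Variables (D : nat -> nat -> R) (big : R) (T : list nat) (m x : nat).

(** Strict and weak inequality together determine r even when distances tie or table entries repeat.
    The cap [big] serves tables with fewer than m entries. *)
Definition is_radius (r : R) : Prop :=
  r <= big /\ (count (fun t => Rltb (D t x) r) T < m)%nat /\
  ((m <= count (fun t => Rleb (D t x) r) T)%nat \/ r = big).

Definition radius : R :=
  fold_right Rmin big
    (filter (fun th => Nat.leb m (count (fun t => Rleb (D t x) th) T)) (map (fun t => D t x) T)).

(** Identifies the radius that the program finds by successive minima with the closed formula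
    [radius]. *)
Lemma is_radius_unique r r' : is_radius r -> is_radius r' -> r = r'.
Proof.
  assert (H : forall r r', is_radius r -> is_radius r' -> ~ r < r').
  { intros a b (A1 & A2 & A3) (B1 & B2 & B3) Hlt. destruct A3 as [A3|A3]; [|lra].
    assert (count (fun t => Rleb (D t x) a) T <= count (fun t => Rltb (D t x) b) T)%nat; [|lia].
    apply count_le. intros t _ Ht. apply Rleb_true in Ht. apply Rltb_true. lra. }
  intros H1 H2. pose proof (H r r' H1 H2). pose proof (H r' r H2 H1). lra.
Qed.

Lemma fold_min_cases l : fold_right Rmin big l = big \/ In (fold_right Rmin big l) l.
Proof.
  induction l as [|a l IH]; simpl; [auto|].
  destruct (Rle_dec a (fold_right Rmin big l)).
  - rewrite Rmin_left by assumption. auto.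
  - rewrite Rmin_right by lra. destruct IH; auto.
Qed.

Lemma fold_min_le l a : In a l -> fold_right Rmin big l <= a.
Proof.
  induction l as [|b l IH]; simpl; [tauto|]. intros [->|H].
  - apply Rmin_l.
  - eapply Rle_trans; [apply Rmin_r|auto].
Qed.

Lemma fold_min_big l : fold_right Rmin big l <= big.
Proof. induction l as [|b l IH]; simpl; [lra|]. eapply Rle_trans; [apply Rmin_r|exact IH]. Qed.

(** If m entries lay strictly inside the ball of radius [radius], the largest of their distances
    would be a smaller admissible threshold. *)
Lemma largest_below (l : list nat) th : (0 < count (fun t => Rltb (D t x) th) l)%nat ->
  exists t, In t l /\ D t x < th /\
    forall t', In t' l -> D t' x < th -> D t' x <= D t x.
Proof.
  induction l as [|a l IH]; [intros H; inversion H|]. rewrite count_cons. cbv beta. intros H.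
  destruct (Rltb (D a x) th) eqn:Ea.
  - apply Rltb_true in Ea. destruct (count (fun t => Rltb (D t x) th) l) eqn:Ec.
    + exists a. split; [simpl; auto|]. split; [exact Ea|]. intros t' [->|Ht'] Hlt; [lra|].
      exfalso. assert (0 < count (fun t => Rltb (D t x) th) l)%nat; [|lia].
      apply count_pos with (x := t'); [exact Ht'|]. apply Rltb_true. exact Hlt.
    + destruct IH as (t & It & Lt & Mt); [lia|].
      destruct (Rle_dec (D a x) (D t x)).
      * exists t. split; [simpl; auto|]. split; [exact Lt|]. intros t' [->|Ht'] Hlt; auto.
      * exists a. split; [simpl; auto|]. split; [exact Ea|]. intros t' [->|Ht'] Hlt; [lra|].
        specialize (Mt t' Ht' Hlt). lra.
  - destruct IH as (t & It & Lt & Mt); [lia|].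
    exists t. split; [simpl; auto|]. split; [exact Lt|]. intros t' [->|Ht'] Hlt; auto.
    apply Rltb_false in Ea. lra.
Qed.

Lemma radius_spec : (1 <= m)%nat -> is_radius radius.
Proof.
  intros Hm. unfold is_radius.
  assert (Hb : radius <= big) by apply fold_min_big.
  split; [exact Hb|]. split.
  - apply Nat.nle_gt. intros Hc.
    destruct (largest_below T radius) as (t & It & Lt & Mt); [lia|].
    assert (radius <= D t x); [|lra].
    apply fold_min_le. apply filter_In. split; [apply in_map_iff; exists t; auto|].
    apply Nat.leb_le. etransitivity; [exact Hc|]. apply count_le. intros t' Ht' E.
    apply Rltb_true in E. apply Rleb_true. auto.
  - destruct (fold_min_cases
      (filter (fun th => Nat.leb m (count (fun t => Rleb (D t x) th) T)) (map (fun t => D t x) T)))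
      as [H|H]; [right; exact H|left].
    apply filter_In in H. apply Nat.leb_le. apply H.
Qed.

End Radius.

(** * Greedy selection by decreasing radius *)

Section Greedy.

Variables (n : nat) (r : nat -> R) (cov : nat -> nat -> bool).

Hypothesis cov_refl : forall x, cov x x = true.

(** Ties go to the smallest index. The greedy list is then a function of P, and the runs on two
    samples can be compared pick by pick. *)
Definition is_pick (P : nat -> bool) (x : nat) : Prop :=
  (x < n)%nat /\ P x = true /\
  forall y, (y < n)%nat -> P y = true -> r y < r x \/ (r y = r x /\ (x <= y)%nat).

Definition residue (P : nat -> bool) (x : nat) : nat -> bool := fun i => P i && negb (cov x i).

Inductive greedy : (nat -> bool) -> list nat -> Prop :=
| greedy_nil P : (forall i, (i < n)%nat -> P i = false) -> greedy P []
| greedy_cons P x l : is_pick P x -> greedy (residue P x) l -> greedy P (x :: l).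

Lemma is_pick_unique P x y : is_pick P x -> is_pick P y -> x = y.
Proof.
  intros (A1 & A2 & A3) (B1 & B2 & B3).
  destruct (A3 y B1 B2) as [H|[H H']]; destruct (B3 x A1 A2) as [G|[G G']]; try lra. lia.
Qed.

Lemma greedy_unique P l : greedy P l -> forall l', greedy P l' -> l = l'.
Proof.
  induction 1 as [P H|P x l Hx H IH]; intros l' H'; inversion H' as [P1 G|P1 y l1 Hy G]; subst.
  - reflexivity.
  - destruct Hy as (B1 & B2 & _). rewrite H in B2 by exact B1. discriminate.
  - destruct Hx as (B1 & B2 & _). rewrite G in B2 by exact B1. discriminate.
  - assert (x = y) by (eapply is_pick_unique; eassumption). subst y. f_equal. apply IH. exact G.
Qed.

Lemma pick_exists P m : (m <= n)%nat ->
  (forall i, (i < m)%nat -> P i = false) \/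
  exists x, (x < m)%nat /\ P x = true /\
    forall y, (y < m)%nat -> P y = true -> r y < r x \/ (r y = r x /\ (x <= y)%nat).
Proof.
  induction m as [|m IH]; intros Hm; [left; intros; lia|].
  destruct (P m) eqn:Em.
  - destruct IH as [H|(x & Hx & Px & Mx)]; [lia| |].
    + right. exists m. split; [lia|]. split; [exact Em|]. intros y Hy Py.
      destruct (Nat.eq_dec y m) as [->|]; [right; split; [reflexivity|lia]|].
      rewrite H in Py by lia. discriminate.
    + right. destruct (Rle_dec (r m) (r x)) as [Hr|Hr].
      * exists x. split; [lia|]. split; [exact Px|]. intros y Hy Py.
        destruct (Nat.eq_dec y m) as [->|]; [|apply Mx; [lia|exact Py]].
        destruct (Req_dec (r m) (r x)); [right; split; [assumption|lia]|left; lra].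
      * exists m. split; [lia|]. split; [exact Em|]. intros y Hy Py.
        destruct (Nat.eq_dec y m) as [->|]; [right; split; [reflexivity|lia]|].
        left. destruct (Mx y) as [|[]]; [lia|exact Py|lra|lra].
  - destruct IH as [H|(x & Hx & Px & Mx)]; [lia| |].
    + left. intros i Hi. destruct (Nat.eq_dec i m) as [->|]; [exact Em|apply H; lia].
    + right. exists x. split; [lia|]. split; [exact Px|]. intros y Hy Py.
      destruct (Nat.eq_dec y m) as [->|]; [congruence|apply Mx; [lia|exact Py]].
Qed.

Lemma residue_count P x : is_pick P x ->
  (count (residue P x) (seq 0 n) < count P (seq 0 n))%nat.
Proof.
  intros (A1 & A2 & _). apply count_lt with (x := x).
  - intros y _ E. apply andb_true_iff in E. apply E.
  - apply in_seq. lia.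
  - unfold residue. rewrite cov_refl. apply andb_false_r.
  - exact A2.
Qed.

Lemma greedy_exists P : exists l, greedy P l.
Proof.
  remember (count P (seq 0 n)) as c eqn:Hc. revert P Hc.
  induction c as [c IH] using lt_wf_ind. intros P ->.
  destruct (pick_exists P n (Nat.le_refl n)) as [H|(x & Hx)].
  - exists []. apply greedy_nil. exact H.
  - destruct (IH (count (residue P x) (seq 0 n))) with (P := residue P x) as (l & Hl); [|reflexivity|].
    + apply residue_count. exact Hx.
    + exists (x :: l). apply greedy_cons; assumption.
Qed.

Lemma greedy_in P l : greedy P l -> forall x, In x l -> (x < n)%nat /\ P x = true.
Proof.
  induction 1 as [P H|P x l (A1 & A2 & _) H IH]; intros y Hy; [destruct Hy|].
  destruct Hy as [<-|Hy]; [auto|].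
  destruct (IH y Hy) as [B1 B2]. apply andb_true_iff in B2. tauto.
Qed.

Lemma greedy_NoDup P l : greedy P l -> NoDup l.
Proof.
  induction 1 as [P H|P x l Hx H IH]; constructor; [|exact IH].
  intros Hin. destruct (greedy_in _ _ H x Hin) as [_ B]. unfold residue in B.
  rewrite cov_refl, andb_false_r in B. discriminate.
Qed.

Lemma greedy_covers P l : greedy P l -> forall i, (i < n)%nat -> P i = true ->
  existsb (fun x => cov x i) l = true.
Proof.
  induction 1 as [P H|P x l Hx H IH]; intros i Hi Pi; simpl.
  - rewrite H in Pi by exact Hi. discriminate.
  - destruct (cov x i) eqn:E; [reflexivity|]. apply IH; [exact Hi|].
    unfold residue. rewrite Pi, E. reflexivity.
Qed.

Lemma greedy_sep P l : greedy P l -> forall x y, In x l -> In y l -> x <> y ->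
  (cov x y = false /\ r y <= r x) \/ (cov y x = false /\ r x <= r y).
Proof.
  induction 1 as [P H|P z l Hz H IH]; intros x y Hx Hy Hxy; [destruct Hx|].
  assert (Hlater : forall y, In y l -> cov z y = false /\ r y <= r z).
  { intros u Hu. destruct (greedy_in _ _ H u Hu) as [B1 B2]. apply andb_true_iff in B2.
    destruct B2 as [B2 B3]. apply negb_true_iff in B3. split; [exact B3|].
    destruct Hz as (_ & _ & Hz). destruct (Hz u B1 B2) as [|[]]; lra. }
  destruct Hx as [<-|Hx]; destruct Hy as [<-|Hy]; try congruence; auto.
Qed.

(* A point that the greedy balls of [P] miss is itself chosen once it is added:
   the picks before it are the same. *)
Lemma greedy_leave_one_out P l : greedy P l -> forall P' l' y,
  greedy P' l' -> (y < n)%nat -> P y = false ->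
  (forall i, (i < n)%nat -> P' i = (P i || Nat.eqb i y)%bool) ->
  existsb (fun x => cov x y) l = false -> In y l'.
Proof.
  induction 1 as [P H|P x l Hx H IH]; intros P' l' y H' Hy Py HP' Hunc;
    assert (P'y : P' y = true) by (rewrite HP', Nat.eqb_refl, orb_true_r by exact Hy; reflexivity);
    inversion H' as [P1 G|P1 x' l1 Hx' G]; subst;
    try (rewrite G in P'y by exact Hy; discriminate);
    destruct (Nat.eq_dec x' y) as [->|Hne]; try (simpl; auto; fail);
    pose proof Hx' as (B1 & B2 & B3);
    rewrite HP' in B2 by exact B1; apply orb_true_iff in B2;
    destruct B2 as [B2|B2]; try (apply Nat.eqb_eq in B2; congruence).
  - rewrite H in B2 by exact B1. discriminate.
  - assert (Hpk : is_pick P x').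
    { split; [exact B1|]. split; [exact B2|]. intros z Hz Pz. apply B3; [exact Hz|].
      rewrite HP', Pz by exact Hz. reflexivity. }
    assert (x = x') by (eapply is_pick_unique; eassumption). subst x'.
    simpl in Hunc. apply orb_false_iff in Hunc. destruct Hunc as [U1 U2].
    right. eapply IH; [exact G|exact Hy| | |exact U2].
    + unfold residue. rewrite Py. reflexivity.
    + intros i Hi. unfold residue. rewrite HP' by exact Hi.
      destruct (Nat.eqb_spec i y) as [->|]; [rewrite U1; simpl; rewrite !orb_true_r; reflexivity|].
      rewrite !orb_false_r. reflexivity.
Qed.

(** A functional version of the choice: the expectation of [missed] needs the greedy list as a
    function of the sample. *)
Definition pick_fun (P : nat -> bool) : option nat :=
  fold_left (fun acc i => if P i then
      match acc with Some x => if Rleb (r i) (r x) then Some x else Some i | None => Some i end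
    else acc) (seq 0 n) None.

Lemma pick_fun_spec P :
  match pick_fun P with Some x => is_pick P x | None => forall i, (i < n)%nat -> P i = false end.
Proof.
  unfold pick_fun, is_pick.
  assert (H : forall m, (m <= n)%nat -> match fold_left (fun acc i => if P i then
      match acc with Some x => if Rleb (r i) (r x) then Some x else Some i | None => Some i end
    else acc) (seq 0 m) None with
    | Some x => (x < m)%nat /\ P x = true /\
       forall y, (y < m)%nat -> P y = true -> r y < r x \/ (r y = r x /\ (x <= y)%nat)
    | None => forall i, (i < m)%nat -> P i = false end).
  { induction m as [|m IH]; intros Hm; [simpl; intros; lia|].
    rewrite seq_S, fold_left_app. cbn [plus fold_left].
    specialize (IH (Nat.lt_le_incl _ _ Hm)).
    destruct (fold_left _ (seq 0 m) None) as [x|]; destruct (P m) eqn:Em.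
    - destruct IH as (A1 & A2 & A3). destruct (Rleb (r m) (r x)) eqn:E.
      + apply Rleb_true in E. split; [lia|]. split; [exact A2|]. intros y Hy Py.
        destruct (Nat.eq_dec y m) as [->|]; [|apply A3; [lia|exact Py]].
        destruct (Req_dec (r m) (r x)); [right; split; [assumption|lia]|left; lra].
      + apply Rleb_false in E. split; [lia|]. split; [exact Em|]. intros y Hy Py.
        destruct (Nat.eq_dec y m) as [->|]; [right; split; [reflexivity|lia]|].
        left. destruct (A3 y) as [|[]]; [lia|exact Py|lra|lra].
    - destruct IH as (A1 & A2 & A3). split; [lia|]. split; [exact A2|]. intros y Hy Py.
      destruct (Nat.eq_dec y m) as [->|]; [congruence|apply A3; [lia|exact Py]].
    - split; [lia|]. split; [exact Em|]. intros y Hy Py.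
      destruct (Nat.eq_dec y m) as [->|]; [right; split; [reflexivity|lia]|].
      rewrite IH in Py by lia. discriminate.
    - intros i Hi. destruct (Nat.eq_dec i m) as [->|]; [exact Em|apply IH; lia]. }
  exact (H n (Nat.le_refl n)).
Qed.

Fixpoint greedy_fuel (fuel : nat) (P : nat -> bool) : list nat :=
  match fuel with
  | O => []
  | S fuel =>
      match pick_fun P with
      | Some x => x :: greedy_fuel fuel (residue P x)
      | None => []
      end
  end.

Definition greedy_list (P : nat -> bool) : list nat := greedy_fuel n P.

Lemma greedy_list_spec P : greedy P (greedy_list P).
Proof.
  assert (H : forall f P, (count P (seq 0 n) <= f)%nat -> greedy P (greedy_fuel f P)).
  { induction f as [|f IH]; intros Q Hf; cbn [greedy_fuel].
    - apply greedy_nil. intros i Hi. destruct (Q i) eqn:E; [|reflexivity].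
      assert (0 < count Q (seq 0 n))%nat; [|lia].
      apply count_pos with (x := i); [apply in_seq; lia|exact E].
    - pose proof (pick_fun_spec Q) as Hp. destruct (pick_fun Q) as [x|].
      + apply greedy_cons; [exact Hp|]. apply IH. pose proof (residue_count Q x Hp). lia.
      + apply greedy_nil. exact Hp. }
  apply H. apply count_seq_le.
Qed.

Definition uncovered (l : list nat) (y : nat) : bool := negb (existsb (fun x => cov x y) l).

Definition sampled (l : list nat) : nat -> bool := fun i => existsb (Nat.eqb i) l.

Definition missed (l : list nat) : nat := count (uncovered (greedy_list (sampled l))) (seq 0 n).

End Greedy.

(** * Expected number of points missed *)

Lemma avg_le n f g : (forall v, (v < n)%nat -> f v <= g v) -> avg n f <= avg n g.
Proof.
  intros H. unfold avg, Rdiv. destruct n as [|n]; [simpl; lra|].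
  apply Rmult_le_compat_r; [|apply rsum_le; exact H].
  left. apply Rinv_0_lt_compat. apply lt_0_INR. lia.
Qed.

Lemma avg_const n c : (0 < n)%nat -> avg n (fun _ => c) = c.
Proof. intros H. unfold avg. rewrite rsum_const. field. apply not_0_INR. lia. Qed.

Lemma avg_plus n f g : avg n (fun v => f v + g v) = avg n f + avg n g.
Proof. unfold avg. rewrite rsum_plus. unfold Rdiv. ring. Qed.

Lemma avg_scal n c f : avg n (fun v => c * f v) = c * avg n f.
Proof. unfold avg. rewrite rsum_scal. unfold Rdiv. ring. Qed.

Lemma avg_swap n m f : avg n (fun i => avg m (fun j => f i j)) = avg m (fun j => avg n (fun i => f i j)).
Proof.
  unfold avg.
  rewrite (rsum_ext n _ (fun i => / INR m * rsum m (fun j => f i j))) by (intros; unfold Rdiv; ring).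
  rewrite (rsum_ext m _ (fun j => / INR n * rsum n (fun i => f i j))) by (intros; unfold Rdiv; ring).
  rewrite !rsum_scal, rsum_swap. unfold Rdiv. ring.
Qed.

Lemma expect_le n m : forall f g,
  (forall l, draws n m l -> f l <= g l) -> expect n m f <= expect n m g.
Proof.
  induction m as [|m IH]; simpl; intros f g H.
  - apply H. split; constructor.
  - apply avg_le. intros v Hv. apply IH. intros l Hl. apply H. apply draws_cons; assumption.
Qed.

Lemma expect_const n m c : (0 < n)%nat -> expect n m (fun _ => c) = c.
Proof.
  intros Hn. induction m as [|m IH]; simpl; [reflexivity|].
  rewrite IH. apply avg_const. exact Hn.
Qed.

Lemma expect_plus n m : forall f g,
  expect n m (fun l => f l + g l) = expect n m f + expect n m g.
Proof.
  induction m as [|m IH]; simpl; intros f g; [reflexivity|].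
  rewrite <- avg_plus. apply avg_ext. intros v _. apply IH.
Qed.

Lemma expect_scal n m c : forall f, expect n m (fun l => c * f l) = c * expect n m f.
Proof.
  induction m as [|m IH]; simpl; intros f; [reflexivity|].
  rewrite <- avg_scal. apply avg_ext. intros v _. apply IH.
Qed.

Lemma expect_rsum n m k f : (0 < n)%nat ->
  expect n m (fun l => rsum k (fun i => f i l)) = rsum k (fun i => expect n m (f i)).
Proof.
  intros Hn. induction k as [|k IH]; simpl.
  - apply expect_const. exact Hn.
  - rewrite expect_plus, IH. reflexivity.
Qed.

Definition drop_nth (i : nat) (l : list nat) : list nat := firstn i l ++ skipn (S i) l.

(** Given the other m draws, the i-th of m + 1 independent draws is a fresh uniform one, at whatever
    position i it stands. *)
Lemma expect_drop_nth n m : forall i (g : nat -> list nat -> R), (i <= m)%nat ->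
  expect n (S m) (fun l => g (nth i l 0%nat) (drop_nth i l)) =
  expect n m (fun l => avg n (fun v => g v l)).
Proof.
  induction m as [|m IH]; intros i g Hi.
  - assert (i = 0%nat) by lia. subst i. reflexivity.
  - destruct i as [|i].
    + cbn [expect nth]. unfold drop_nth. cbn [firstn skipn app].
      change (avg n (fun v => expect n (S m) (fun l => g v l)) =
        expect n (S m) (fun l => avg n (fun v => g v l))).
      generalize (S m). intros k. clear. revert g. induction k as [|k IH]; intros g; [reflexivity|].
      cbn [expect]. rewrite avg_swap. apply avg_ext. intros v _.
      rewrite <- (IH (fun w l => g w (v :: l))). reflexivity.
    + change (expect n (S (S m)) (fun l => g (nth (S i) l 0%nat) (drop_nth (S i) l)))
        with (avg n (fun v => expect n (S m) (fun l => g (nth i l 0%nat) (v :: drop_nth i l)))).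
      cbn [expect]. apply avg_ext. intros v _.
      rewrite <- (IH i (fun w l => g w (v :: l))) by lia. reflexivity.
Qed.

Lemma in_drop_nth i l y : In y (drop_nth i l) -> In y l.
Proof.
  unfold drop_nth. rewrite in_app_iff. intros [H|H].
  - rewrite <- (firstn_skipn i l). apply in_app_iff. auto.
  - rewrite <- (firstn_skipn (S i) l). apply in_app_iff. auto.
Qed.

Lemma drop_nth_in i : forall l y, In y l -> (i < length l)%nat -> In y (drop_nth i l) \/ y = nth i l 0%nat.
Proof.
  induction i as [|i IH]; intros [|a l] y Hy Hi; simpl in Hi; try lia.
  - destruct Hy as [->|Hy]; [right; reflexivity|left; exact Hy].
  - destruct Hy as [->|Hy]; [left; simpl; auto|].
    destruct (IH l y Hy) as [H|H]; [lia|left; right; exact H|right; exact H].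
Qed.

Lemma nth_in_drop_nth i : forall l j, (i < length l)%nat -> (j < length l)%nat -> i <> j ->
  In (nth j l 0%nat) (drop_nth i l).
Proof.
  induction i as [|i IH]; intros [|a l] j Hi Hj Hij; simpl in *; try lia.
  - destruct j as [|j]; [lia|]. unfold drop_nth. cbn [firstn skipn app nth]. apply nth_In. lia.
  - destruct j as [|j]; [left; reflexivity|]. right. apply IH; lia.
Qed.

Lemma NoDup_map_inj_on {X Y : Type} (f : X -> Y) (l : list X) :
  (forall x y, In x l -> In y l -> f x = f y -> x = y) -> NoDup l -> NoDup (map f l).
Proof.
  induction l as [|a l IH]; intros Hf Hnd; [constructor|]. inversion Hnd; subst.
  simpl. constructor; [|apply IH; auto; intros; apply Hf; simpl; auto].
  intros Hin. apply in_map_iff in Hin. destruct Hin as (b & E & Hb).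
  apply Hf in E; simpl; auto. subst. contradiction.
Qed.

Lemma sampled_true l i : sampled l i = true <-> In i l.
Proof.
  unfold sampled. rewrite existsb_exists. split.
  - intros (x & Hx & E). apply Nat.eqb_eq in E. subst. exact Hx.
  - intros H. exists i. rewrite Nat.eqb_refl. auto.
Qed.

(* Exchangeability: a fresh draw is missed by the sample exactly as often as a
   member of a sample one larger is missed by the others, and such members are
   all chosen from the larger sample. *)
Lemma expect_missed n r cov N m Q :
  (forall x, cov x x = true) -> (n <= N)%nat -> (0 < N)%nat ->
  (forall P, (length (greedy_list n r cov P) <= Q)%nat) ->
  expect N m (fun l => INR (missed n r cov l)) <= INR N * INR Q / INR (S m).
Proof.
  intros Hrefl HnN HN HQ.
  (* The range N may exceed n; a draw v >= n stands for no point and never counts as missed. *)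
  set (g := fun v l => if (Nat.ltb v n && uncovered cov (greedy_list n r cov (sampled l)) v)%bool
                       then 1 else 0).
  assert (H1 : forall l, INR (missed n r cov l) = INR N * avg N (fun v => g v l)).
  { intros l. unfold missed. rewrite count_rsum. unfold avg.
    replace N with (n + (N - n))%nat at 2 by lia. rewrite rsum_app.
    rewrite (rsum_ext (N - n) (fun i => g (n + i)%nat l) (fun _ => 0)).
    - rewrite rsum_const.
      rewrite (rsum_ext n _ (fun v => g v l)).
      + field. apply not_0_INR. lia.
      + intros i Hi. unfold g. apply Nat.ltb_lt in Hi. rewrite Hi. reflexivity.
    - intros i _. unfold g. replace (Nat.ltb (n + i) n) with false; [reflexivity|].
      symmetry. apply Nat.ltb_ge. lia. }
  rewrite (expect_ext _ _ _ (fun l => INR N * avg N (fun v => g v l))) by (intros; apply H1).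
  rewrite expect_scal.
  assert (HN0 : 0 < INR N) by (apply lt_0_INR; lia).
  assert (Hm0 : 0 < INR (S m)) by (apply lt_0_INR; lia).
  unfold Rdiv. rewrite Rmult_assoc. apply Rmult_le_compat_l; [lra|].
  apply Rmult_le_reg_r with (INR (S m)); [exact Hm0|].
  rewrite Rmult_assoc, Rinv_l, Rmult_1_r by lra. rewrite Rmult_comm.
  rewrite <- rsum_const.
  (* After multiplication by m + 1, every position of a sample of size m + 1 takes a turn as the
     fresh draw. *)
  rewrite (rsum_ext (S m) _ (fun i => expect N (S m) (fun l => g (nth i l 0%nat) (drop_nth i l))))
    by (intros i Hi; symmetry; apply expect_drop_nth; lia).
  rewrite <- (expect_rsum N (S m) (S m) (fun i l => g (nth i l 0%nat) (drop_nth i l))) by exact HN.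
  rewrite <- (expect_const N (S m) (INR Q)) by exact HN.
  apply expect_le. intros l [Hlen _].
  set (f := fun i => (Nat.ltb (nth i l 0%nat) n &&
     uncovered cov (greedy_list n r cov (sampled (drop_nth i l))) (nth i l 0%nat))%bool).
  change (rsum (S m) (fun i => if f i then 1 else 0) <= INR Q).
  rewrite <- count_rsum. apply le_INR.
  assert (Hf : forall i, In i (filter f (seq 0 (S m))) ->
    (i < S m)%nat /\ (nth i l 0 < n)%nat /\
    existsb (fun x => cov x (nth i l 0%nat)) (greedy_list n r cov (sampled (drop_nth i l))) = false).
  { intros i Hi. apply filter_In in Hi. destruct Hi as [Hi Ei]. apply in_seq in Hi.
    unfold f in Ei. apply andb_true_iff in Ei. destruct Ei as [E1 E2].
    apply Nat.ltb_lt in E1. unfold uncovered in E2. apply negb_true_iff in E2.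
    split; [lia|]. split; assumption. }
  (* A missed value does not occur among the other draws, as its own greedy list would cover it. So
     different missed positions carry different values, and values may be counted instead. *)
  assert (Hself : forall i, In i (filter f (seq 0 (S m))) ->
    sampled (drop_nth i l) (nth i l 0%nat) = false).
  { intros i Hi. destruct (Hf i Hi) as (A1 & A2 & A3).
    destruct (sampled (drop_nth i l) (nth i l 0%nat)) eqn:E; [|reflexivity].
    rewrite (greedy_covers n r cov _ _ (greedy_list_spec n r cov Hrefl _)) in A3 by assumption.
    discriminate. }
  unfold count. rewrite <- (length_map (fun i => nth i l 0%nat)).
  etransitivity; [|apply (HQ (sampled l))].
  apply NoDup_incl_length.
  - apply NoDup_map_inj_on; [|apply NoDup_filter, seq_NoDup].
    intros i j Hi Hj E. destruct (Nat.eq_dec i j) as [|Hij]; [assumption|exfalso].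
    destruct (Hf i Hi) as (A1 & _ & _). destruct (Hf j Hj) as (B1 & _ & _).
    pose proof (Hself i Hi) as Hs.
    rewrite (proj2 (sampled_true _ _)) in Hs; [discriminate|].
    rewrite E. apply nth_in_drop_nth; lia.
  (* By the leave-one-out lemma each missed value is a pick of the full sample, of which there are
     at most Q. *)
  - intros y Hy. apply in_map_iff in Hy. destruct Hy as (i & <- & Hi).
    destruct (Hf i Hi) as (A1 & A2 & A3).
    eapply (greedy_leave_one_out n r cov) with (P := sampled (drop_nth i l));
      [apply greedy_list_spec; exact Hrefl|apply greedy_list_spec; exact Hrefl|exact A2
      |apply Hself; exact Hi| |exact A3].
    intros j _. destruct (sampled l j) eqn:Ej; symmetry.
    + apply sampled_true in Ej. apply orb_true_iff.
      destruct (drop_nth_in i l j Ej) as [H|H]; [lia|left; apply sampled_true; exact H|].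
      right. apply Nat.eqb_eq. exact H.
    + apply orb_false_iff. split.
      * destruct (sampled (drop_nth i l) j) eqn:E; [|reflexivity].
        apply sampled_true, in_drop_nth, sampled_true in E. congruence.
      * apply Nat.eqb_neq. intros ->. rewrite (proj2 (sampled_true _ _)) in Ej; [discriminate|].
        apply nth_In. lia.
Qed.

(** * Heavy balls *)

Section Balls.

Variables (n k : nat) (D : nat -> nat -> R) (big : R).

Hypothesis D_sym : forall x y, D x y = D y x.
Hypothesis D_nonneg : forall x y, 0 <= D x y.
Hypothesis D_refl : forall x, D x x = 0.
Hypothesis D_pos : forall x y, (x < n)%nat -> (y < n)%nat -> x <> y -> 0 < D x y.
Hypothesis D_big : forall x y, (x < n)%nat -> (y < n)%nat -> D x y < big.
Hypothesis big_pos : 0 < big.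

Section Fixed.

Variables (T : list nat) (m : nat).

Notation rad := (radius D big T m).

Definition open_count (x : nat) : nat := count (fun i => Rltb (D i x) (rad x)) (seq 0 n).

(** A ball of radius 0, which arises when x itself was drawn m times, is neither light nor heavy. It
    is shrunk to its center like a heavy one, but the packing bound still applies to it. *)
Definition light_ball (x : nat) : bool := Rltb 0 (rad x) && Nat.leb (open_count x) k.
Definition heavy_ball (x : nat) : bool := Rltb 0 (rad x) && Nat.ltb k (open_count x).

(* A heavy ball is replaced by one that contains its center only. *)
Definition covers (x i : nat) : bool := if light_ball x then Rltb (D i x) (rad x) else Nat.eqb i x.

Lemma covers_refl x : covers x x = true.
Proof.
  unfold covers. destruct (light_ball x) eqn:E; [|apply Nat.eqb_refl].
  apply andb_true_iff in E. destruct E as [E _]. rewrite D_refl. exact E.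
Qed.

Hypothesis m_pos : (1 <= m)%nat.

Lemma rad_nonneg x : 0 <= rad x.
Proof.
  destruct (radius_spec D big T m x m_pos) as (_ & _ & [H|H]); [|lra].
  apply Rnot_lt_le. intros Hlt.
  assert (E : count (fun t => Rleb (D t x) (rad x)) T = 0%nat); [|lia].
  unfold count. replace (filter _ T) with (@nil nat); [reflexivity|].
  clear H m_pos. symmetry. set (v := rad x) in *. clearbody v. induction T as [|t T' IH]; [reflexivity|].
  cbn [filter]. destruct (Rleb (D t x) v) eqn:Et; [|exact IH].
  apply Rleb_true in Et. pose proof (D_nonneg t x). lra.
Qed.

Lemma uncovered_far x y : heavy_ball x = false -> x <> y -> covers x y = false -> rad x <= D x y.
Proof.
  intros Hh Hxy Hc. pose proof (rad_nonneg x). pose proof (D_nonneg x y).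
  unfold covers in Hc. destruct (light_ball x) eqn:El.
  - apply Rltb_false in Hc. rewrite D_sym. exact Hc.
  - unfold light_ball, heavy_ball in *. destruct (Rltb 0 (rad x)) eqn:Er.
    + simpl in *. apply Nat.ltb_ge in Hh. apply Nat.leb_gt in El. lia.
    + apply Rltb_false in Er. lra.
Qed.

Variable M : nat.

(** The overlap bound in terms of indices: all that this section needs to know about Euclidean
    space. *)
Hypothesis mult : forall (l : list nat) (r : nat -> R) p, NoDup l -> (forall x, In x l -> (x < n)%nat) ->
  (p < n)%nat -> (forall x, In x l -> D x p <= r x) ->
  (forall x y, In x l -> In y l -> x <> y -> r x <= D x y) -> (length l <= M)%nat.

(** Count the pairs of a ball and a table entry in it, first by balls and then by entries. *)
Lemma double_count (l : list nat) :
  (forall x, In x l -> (m <= count (fun t => Rleb (D t x) (rad x)) T)%nat) ->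
  (forall t, In t T -> (count (fun x => Rleb (D t x) (rad x)) l <= M)%nat) ->
  (m * length l <= M * length T)%nat.
Proof.
  intros H1 H2.
  assert (E : list_sum (map (fun x => count (fun t => Rleb (D t x) (rad x)) T) l) =
    list_sum (map (fun t => count (fun x => Rleb (D t x) (rad x)) l) T)).
  { set (f := fun t x => Rleb (D t x) (rad x)).
    change (list_sum (map (fun x => count (fun t => f t x) T) l) =
      list_sum (map (fun t => count (fun x => f t x) l) T)).
    clearbody f. clear. induction l as [|x l IH]; simpl.
    - induction T as [|t T' IHT]; simpl; [reflexivity|exact IHT].
    - rewrite IH. clear IH. induction T as [|t T' IHT]; simpl; [reflexivity|].
      rewrite !count_cons. lia. }
  assert (L1 : (m * length l <= list_sum (map (fun x => count (fun t => Rleb (D t x) (rad x)) T) l))%nat).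
  { clear E H2. induction l as [|x l IH]; simpl; [lia|].
    assert (H : (m * length l <= list_sum (map (fun x => count (fun t => Rleb (D t x) (rad x)) T) l))%nat)
      by (apply IH; intros; apply H1; simpl; auto).
    specialize (H1 x (or_introl eq_refl)). lia. }
  assert (L2 : forall T', (forall t, In t T' -> In t T) ->
    (list_sum (map (fun t => count (fun x => Rleb (D t x) (rad x)) l) T') <= M * length T')%nat).
  { induction T' as [|t T' IH]; intros Hi; simpl; [lia|].
    specialize (H2 t (Hi t (or_introl eq_refl))).
    assert (H : (list_sum (map (fun t => count (fun x => Rleb (D t x) (rad x)) l) T') <= M * length T')%nat)
      by (apply IH; intros; apply Hi; simpl; auto). lia. }
  specialize (L2 T (fun t H => H)). lia.
Qed.

Lemma count_split {X : Type} (f g : X -> bool) l :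
  count f l = (count (fun x => f x && g x) l + count (fun x => f x && negb (g x)) l)%nat.
Proof.
  induction l as [|x l IH]; [reflexivity|]. rewrite !count_cons.
  destruct (f x); destruct (g x); simpl; lia.
Qed.

(** Picks that are not heavy are separated by their radii, so double counting applies to those whose
    closed ball holds m entries. The summand m is for a pick of radius [big], which need not hold
    them; two such picks would have distance at least [big]. *)
Lemma greedy_good_count P l : greedy n rad covers P l -> (forall t, In t T -> (t < n)%nat) ->
  (m * count (fun x => negb (heavy_ball x)) l <= m + M * length T)%nat.
Proof.
  intros Hg HT.
  pose proof (greedy_NoDup _ _ _ covers_refl _ _ Hg) as Hnd.
  pose proof (greedy_in _ _ _ _ _ Hg) as Hin.
  assert (Hsep : forall x y, In x l -> In y l -> heavy_ball x = false -> heavy_ball y = false -> x <> y ->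
    rad x <= D x y).
  { intros x y Hx Hy Gx Gy Hxy.
    destruct (greedy_sep _ _ _ _ _ Hg x y Hx Hy Hxy) as [[H1 H2]|[H1 H2]].
    - apply uncovered_far; assumption.
    - rewrite D_sym. eapply Rle_trans; [exact H2|]. apply uncovered_far; auto. }
  rewrite (count_split _ (fun x => Rleb big (rad x))).
  assert (H1 : (count (fun x => negb (heavy_ball x) && Rleb big (rad x)) l <= 1)%nat).
  { unfold count.
    assert (Hf : forall x, In x (filter (fun x => negb (heavy_ball x) && Rleb big (rad x)) l) ->
      In x l /\ heavy_ball x = false /\ big <= rad x).
    { intros x Hx. apply filter_In in Hx. destruct Hx as [Hx E].
      apply andb_true_iff in E. destruct E as [E1 E2].
      apply negb_true_iff in E1. apply Rleb_true in E2. auto. }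
    pose proof (NoDup_filter (fun x => negb (heavy_ball x) && Rleb big (rad x)) Hnd) as Hnd'.
    destruct (filter _ l) as [|x [|y l']]; simpl; try lia. exfalso.
    destruct (Hf x) as (A1 & A2 & A3); [simpl; auto|].
    destruct (Hf y) as (B1 & B2 & B3); [simpl; auto|].
    assert (Hxy : x <> y).
    { inversion Hnd' as [|? ? Hn _]. intros ->. apply Hn. simpl. auto. }
    pose proof (Hsep x y A1 B1 A2 B2 Hxy).
    pose proof (D_big x y (proj1 (Hin x A1)) (proj1 (Hin y B1))). lra. }
  assert (H2 : (m * count (fun x => negb (heavy_ball x) && negb (Rleb big (rad x))) l <= M * length T)%nat).
  { set (l' := filter (fun x => negb (heavy_ball x) && negb (Rleb big (rad x))) l).
    assert (Hf : forall x, In x l' -> In x l /\ heavy_ball x = false /\ rad x < big).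
    { intros x Hx. apply filter_In in Hx. destruct Hx as [Hx E].
      apply andb_true_iff in E. destruct E as [E1 E2].
      apply negb_true_iff in E1. apply Rltb_true in E2. auto. }
    apply double_count.
    - intros x Hx. destruct (Hf x Hx) as (A1 & A2 & A3).
      destruct (radius_spec D big T m x m_pos) as (_ & _ & [H|H]); [exact H|lra].
    - intros t Ht. unfold count.
      assert (Hf' : forall x, In x (filter (fun x => Rleb (D t x) (rad x)) l') ->
        In x l /\ heavy_ball x = false /\ D t x <= rad x).
      { intros x Hx. apply filter_In in Hx. destruct Hx as [Hx E]. apply Rleb_true in E.
        destruct (Hf x Hx) as (A1 & A2 & A3). auto. }
      apply mult with (r := rad) (p := t).
      + apply NoDup_filter, NoDup_filter. exact Hnd.
      + intros x Hx. apply Hin. apply Hf'. exact Hx.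
      + apply HT. exact Ht.
      + intros x Hx. rewrite D_sym. apply Hf'. exact Hx.
      + intros x y Hx Hy Hxy. destruct (Hf' x Hx) as (A1 & A2 & A3).
        destruct (Hf' y Hy) as (B1 & B2 & B3). apply Hsep; auto. }
  nia.
Qed.

End Fixed.

Definition valid (l : list nat) : list nat := filter (fun v => Nat.ltb v n) l.

(* The points of rank at most [k + 1] around [x], ties included: a heavy ball
   contains all of them, and fewer than [m] points of [T]. *)
Definition near (x i : nat) : bool :=
  Nat.leb (count (fun j => Rltb (D j x) (D i x)) (seq 0 n)) k.

(** Otherwise take a closest point that is not near. More than k points are strictly closer than it,
    and by its choice all of them are near. *)
Lemma near_count x : (k + 1 <= n)%nat -> (k + 1 <= count (near x) (seq 0 n))%nat.
Proof.
  intros Hkn. apply Nat.nlt_ge. intros Hlt.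
  set (out := filter (fun i => negb (near x i)) (seq 0 n)).
  assert (Hout : (0 < length out)%nat).
  { pose proof (length_filter_split (near x) (seq 0 n)) as E. rewrite length_seq in E.
    unfold out. unfold count in Hlt. lia. }
  assert (Hmin : exists i, In i out /\ forall j, In j out -> D i x <= D j x).
  { clearbody out. clear Hlt. induction out as [|a l IH]; [simpl in Hout; lia|].
    destruct l as [|b l].
    - exists a. split; [simpl; auto|]. intros j [->|[]]. lra.
    - destruct IH as (i & Hi & Mi); [simpl; lia|].
      destruct (Rle_dec (D a x) (D i x)).
      + exists a. split; [simpl; auto|]. intros j [->|Hj]; [lra|]. specialize (Mi j Hj). lra.
      + exists i. split; [simpl in *; tauto|]. intros j [->|Hj]; [lra|]. auto. }
  destruct Hmin as (i & Hi & Mi). apply filter_In in Hi. destruct Hi as [Hi Ei].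
  apply negb_true_iff in Ei. unfold near in Ei at 1. apply Nat.leb_gt in Ei.
  assert (count (fun j => Rltb (D j x) (D i x)) (seq 0 n) <= count (near x) (seq 0 n))%nat; [|lia].
  apply count_le. intros j Hj E. apply Rltb_true in E.
  destruct (near x j) eqn:En; [reflexivity|]. exfalso.
  assert (D i x <= D j x); [|lra]. apply Mi. apply filter_In. rewrite En. auto.
Qed.

(** A near entry outside the open ball would have all the points of that ball strictly closer to x,
    hence at most k of them. *)
Lemma heavy_near T m x : (1 <= m)%nat -> (forall t, In t T -> (t < n)%nat) -> heavy_ball T m x = true ->
  (k + 1 <= n)%nat /\ (count (near x) T < m)%nat.
Proof.
  intros Hm HT Hh. unfold heavy_ball in Hh. apply andb_true_iff in Hh. destruct Hh as [_ Hh].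
  apply Nat.ltb_lt in Hh. unfold open_count in Hh. split.
  - pose proof (count_seq_le (fun i => Rltb (D i x) (radius D big T m x)) n). lia.
  - destruct (radius_spec D big T m x Hm) as (_ & H & _).
    eapply Nat.le_lt_trans; [|exact H]. apply count_le. intros t Ht E.
    apply Rltb_true. apply Rnot_le_lt. intros Hle. unfold near in E. apply Nat.leb_le in E.
    assert (open_count T m x <= count (fun j => Rltb (D j x) (D t x)) (seq 0 n))%nat;
      [|unfold open_count in *; lia].
    apply count_le. intros j _ Ej. apply Rltb_true in Ej. apply Rltb_true. lra.
Qed.

(** The generating function of a binomial variable at 1/2: a draw that hits with probability p
    contributes the factor 1 - p/2. *)
Lemma expect_pow N q (f : nat -> bool) : (0 < N)%nat ->
  expect N q (fun l => (/ 2) ^ count f l) = (1 - INR (count f (seq 0 N)) / (2 * INR N)) ^ q.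
Proof.
  intros HN. induction q as [|q IH]; [reflexivity|].
  cbn [expect].
  rewrite (avg_ext N _ (fun v => (1 - INR (count f (seq 0 N)) / (2 * INR N)) ^ q *
     (1 + (- / 2) * (if f v then 1 else 0)))).
  - rewrite avg_scal, avg_plus, avg_scal, avg_const by exact HN.
    unfold avg. rewrite <- count_rsum. simpl. field. apply not_0_INR. lia.
  - intros v _. rewrite <- IH.
    rewrite (Rmult_comm (expect _ _ _)), <- expect_scal. apply expect_ext. intros l _.
    rewrite count_cons, pow_add. destruct (f v); simpl; lra.
Qed.

(** Chernoff bound with base 2. A heavy ball has fewer than m near entries, so its indicator is at
    most 2^m 2^(-count), and a draw is near with probability at least (k + 1) / N. *)
Lemma expect_heavy N q m : (k <= n)%nat -> (n <= N)%nat -> (0 < N)%nat -> (1 <= m)%nat ->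
  expect N q (fun l => INR (count (heavy_ball (valid l) m) (seq 0 n))) <=
  INR n * (2 ^ m * (1 - INR (k + 1) / (2 * INR N)) ^ q).
Proof.
  intros Hkn HnN HN Hm.
  rewrite (expect_ext _ _ _ (fun l => rsum n (fun x => if heavy_ball (valid l) m x then 1 else 0)))
    by (intros; apply count_rsum).
  rewrite (expect_rsum N q n (fun x l => if heavy_ball (valid l) m x then 1 else 0)) by exact HN.
  rewrite <- rsum_const. apply rsum_le. intros x Hx.
  assert (HN0 : 0 < INR N) by (apply lt_0_INR; lia).
  destruct (le_lt_dec (k + 1) n) as [Hk|Hk].
  - set (f := fun v => (Nat.ltb v n && near x v)%bool).
    eapply Rle_trans with (expect N q (fun l => 2 ^ m * (/ 2) ^ count f l)).
    + apply expect_le. intros l _.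
      assert (Hnn : 0 <= 2 ^ m * (/ 2) ^ count f l).
      { apply Rmult_le_pos; apply pow_le; lra. }
      destruct (heavy_ball (valid l) m x) eqn:Eh; [|exact Hnn].
      assert (Hc : (count f l < m)%nat).
      { apply heavy_near in Eh; [|exact Hm|].
        - destruct Eh as [_ Eh]. unfold valid in Eh. rewrite count_filter in Eh. exact Eh.
        - intros t Ht. apply filter_In in Ht. apply Nat.ltb_lt, Ht. }
      replace m with (count f l + (m - count f l))%nat by lia.
      rewrite pow_add, Rmult_assoc, (Rmult_comm (2 ^ (m - count f l))), <- Rmult_assoc.
      rewrite <- Rpow_mult_distr, Rinv_r, pow1, Rmult_1_l by lra. apply pow_R1_Rle. lra.
    + rewrite expect_scal, expect_pow by exact HN.
      apply Rmult_le_compat_l; [apply pow_le; lra|].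
      assert (Hfc : count f (seq 0 N) = count (near x) (seq 0 n)).
      { replace N with (n + (N - n))%nat by lia. rewrite seq_app, count_app.
        replace (count f (seq (0 + n) (N - n))) with 0%nat.
        - rewrite Nat.add_0_r. apply count_ext. intros y Hy. apply in_seq in Hy.
          unfold f. replace (Nat.ltb y n) with true; [reflexivity|]. symmetry. apply Nat.ltb_lt. lia.
        - symmetry. unfold count. replace (filter f (seq (0 + n) (N - n))) with (@nil nat); [reflexivity|].
          symmetry. assert (Hy : forall y, In y (filter f (seq (0 + n) (N - n))) -> False).
          { intros y Hy. apply filter_In in Hy. destruct Hy as [Hy E]. apply in_seq in Hy.
            unfold f in E. apply andb_true_iff in E. destruct E as [E _]. apply Nat.ltb_lt in E. lia. }
          destruct (filter f (seq (0 + n) (N - n))) as [|y l]; [reflexivity|].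
          exfalso. apply (Hy y). simpl. auto. }
      rewrite Hfc. apply pow_incr.
      pose proof (near_count x Hk) as Hnc. apply le_INR in Hnc.
      pose proof (count_seq_le (near x) n) as Hle.
      assert (Hle' : INR (count (near x) (seq 0 n)) <= INR N) by (apply le_INR; lia).
      assert (INR (count (near x) (seq 0 n)) / (2 * INR N) <= 1).
      { apply Rmult_le_reg_r with (2 * INR N); [lra|]. unfold Rdiv.
        rewrite Rmult_assoc, Rinv_l by lra. lra. }
      assert (INR (k + 1) / (2 * INR N) <= INR (count (near x) (seq 0 n)) / (2 * INR N)).
      { apply Rmult_le_compat_r; [left; apply Rinv_0_lt_compat; lra|exact Hnc]. }
      lra.
  - rewrite (expect_ext _ _ _ (fun _ => 0)).
    + rewrite expect_const by exact HN. apply Rmult_le_pos; [apply pow_le; lra|].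
      apply pow_le. assert (Hle : INR (k + 1) <= INR (2 * N)) by (apply le_INR; lia).
      rewrite mult_INR in Hle. simpl (INR 2) in Hle.
      assert (INR (k + 1) / (2 * INR N) <= 1); [|lra].
      apply Rmult_le_reg_r with (2 * INR N); [lra|]. unfold Rdiv.
      rewrite Rmult_assoc, Rinv_l by lra. lra.
    + intros l _. destruct (heavy_ball (valid l) m x) eqn:Eh; [|reflexivity].
      apply heavy_near in Eh; [lia|exact Hm|]. intros t Ht. apply filter_In in Ht. apply Nat.ltb_lt, Ht.
Qed.

End Balls.

(** * The program *)

(* Integer variables: 0 n, 1 k, 3 loop index, 4 input pointer, 5 b, 6 range of a
   draw, 7 number of draws, 8-10 see [draw], 11 the sample T, 12 its length,
   13 status (0 idle, 1 covered, 2 active), 14 rank m, 15 number of balls, 16 k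
   times the number of heavy balls, 17 and 18 loop flags, 19 chosen point,
   20 counter, 21 inner loop index.
   Real variables: 1 big, 2 radii, 3 current radius, 4 next radius, 5 largest
   distance below the radius, 6 least positive distance, 7 output radius,
   8 distance; array 10 + j holds the j-th coordinates. *)

Fixpoint sq_dist (l : list nat) (e1 e2 : iexp) : rexp :=
  match l with
  | [] => RC0
  | j :: l =>
      let u := ROp OpSub (RA (10 + j) e1) (RA (10 + j) e2) in
      ROp OpAdd (ROp OpMul u u) (sq_dist l e1 e2)
  end.

Definition distance (d : nat) (e1 e2 : iexp) : rexp := RRoot (sq_dist (seq 0 d) e1 e2).

Definition block (l : list cmd) : cmd := fold_right Seq Skip l.

Fixpoint times (m : nat) (e : iexp) : iexp :=
  match m with O => IC 0 | S m => IPlus e (times m e) end.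

Definition two : rexp := ROp OpAdd RC1 RC1.

Section Program.

Variable d : nat.

(** The coordinates are copied because the output overwrites them. Scalar 4 tracks i d by
    addition. *)
Definition read_input : cmd :=
  Seq (assign 4 (IC 0))
  (for_loop 3 (var 0)
    (Seq (block (map (fun j => GetLow (10 + j) (var 3) (IPlus (var 4) (IC j))) (seq 0 d)))
         (assign 4 (IPlus (var 4) (IC d))))).

(** One more than twice the largest distance from point 0: it exceeds every distance and takes
    linear time. *)
Definition find_big : cmd :=
  Seq (rassign 1 RC0)
  (Seq (for_loop 3 (var 0)
     (If (BR (distance d (var 3) (IC 0)) (rvar 1)) Skip
         (rassign 1 (distance d (var 3) (IC 0)))))
  (rassign 1 (ROp OpAdd RC1 (ROp OpAdd (rvar 1) (rvar 1))))).

(** The test (b + 1)^4 <= k is made in real arithmetic, where multiplication exists. *)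
Definition find_root : cmd :=
  Seq (assign 5 (IC 1))
  (While (BR (let u := ROp OpAdd (RN (var 5)) RC1 in ROp OpMul (ROp OpMul u u) (ROp OpMul u u)) (RN (var 1)))
     (inc 5)).

Definition find_range : cmd :=
  Seq (assign 6 (IC 1)) (While (less (var 6) (var 0)) (assign 6 (IPlus (var 6) (var 6)))).

(** The loop runs while (number of draws) k < 16 n b, which amounts to 16 n b / k rounds, rounded
    up, without integer division. *)
Definition sample_table : cmd :=
  Seq (assign 7 (IC 0)) (Seq (assign 12 (IC 0))
  (While (BR (ROp OpAdd (ROp OpMul (RN (var 7)) (RN (var 1))) RC1)
             (ROp OpMul (RN (IC 16)) (ROp OpMul (RN (var 0)) (RN (var 5)))))
    (Seq draw
    (Seq (If (less (var 8) (var 0)) (Seq (SetI 11 (var 12) (var 8)) (inc 12)) Skip)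
         (inc 7))))).

Definition sample_active : cmd :=
  Seq (assign 7 (IC 0))
  (While (BR (ROp OpAdd (ROp OpMul (RN (var 7)) (ROp OpMul (RN (var 5)) (RN (var 5)))) RC1)
             (RN (var 0)))
    (Seq draw
    (Seq (If (less (var 8) (var 0)) (SetI 13 (var 8) (IC 2)) Skip)
         (inc 7)))).

Definition dist_table : rexp := distance d (IA 11 (var 21)) (var 3).

Definition next_radius : cmd :=
  Seq (rassign 4 (rvar 1))
  (for_loop 21 (var 12)
     (If (BR dist_table (rvar 3)) Skip
     (If (BR (rvar 4) dist_table) Skip (rassign 4 dist_table)))).

Definition count_table : cmd :=
  Seq (assign 20 (IC 0))
  (for_loop 21 (var 12) (If (BR dist_table (rvar 3)) (inc 20) Skip)).

(** Visits the distinct table distances in increasing order. Every round adds an entry to the closed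
    ball or reaches the cap, so at most m passes over the table are made and no sorting is
    involved. *)
Definition point_radius : cmd :=
  Seq (rassign 3 (ROp OpSub RC0 RC1)) (Seq (assign 20 (IC 0))
  (Seq (While (less (var 20) (var 14))
    (Seq next_radius
    (Seq (rassign 3 (rvar 4))
    (If (BR (rvar 1) (rvar 3)) (assign 20 (var 14)) count_table))))
  (SetR 2 (var 3) (rvar 3)))).

Definition is_active : bexp := BI (IC 2) (IA 13 (var 3)).

Definition active_radii : cmd := for_loop 3 (var 0) (If is_active point_radius Skip).

(** The value n of scalar 19 means that no active point has been found. *)
Definition scan : cmd :=
  Seq (assign 19 (var 0))
  (for_loop 3 (var 0)
    (If is_active
      (If (BI (var 0) (var 19)) (assign 19 (var 3))
      (If (BR (RA 2 (var 3)) (RA 2 (var 19))) Skip (assign 19 (var 3))))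
      Skip)).

Definition chosen_radius : rexp := RA 2 (var 19).

(** Measures against all n points, not against the table: the number of points in an output ball is
    checked exactly. The initial value 1 of the least positive distance keeps the tiny radius
    positive when there is no other point. *)
Definition measure_ball : cmd :=
  Seq (assign 20 (IC 0)) (Seq (rassign 5 RC0) (Seq (rassign 6 RC1)
  (for_loop 3 (var 0)
    (Seq (rassign 8 (distance d (var 3) (var 19)))
    (Seq (If (BR chosen_radius (rvar 8)) Skip
           (Seq (inc 20) (If (BR (rvar 5) (rvar 8)) (rassign 5 (rvar 8)) Skip)))
    (If (BR (rvar 8) RC0) Skip
       (If (BR (rvar 6) (rvar 8)) Skip (rassign 6 (rvar 8))))))))).

Definition tiny_radius : cmd := rassign 7 (ROp OpDiv (rvar 6) two).

(** The midpoint between the radius and the largest distance below it turns the open ball into a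
    closed one with the same points. Half the least positive distance isolates the center. *)
Definition output_radius : cmd :=
  If (BR chosen_radius RC0) tiny_radius
  (If (BI (var 20) (var 1)) (rassign 7 (ROp OpDiv (ROp OpAdd (rvar 5) chosen_radius) two))
  (Seq tiny_radius (assign 16 (IPlus (var 16) (var 1))))).

Definition output_ball : cmd :=
  Seq (block (map (fun j => SetLow (IPlus (times (d + 1) (var 15)) (IC j)) (RA (10 + j) (var 19))) (seq 0 d)))
  (Seq (SetLow (IPlus (times (d + 1) (var 15)) (IC d)) (rvar 7)) (inc 15)).

Definition mark_ball : cmd :=
  for_loop 3 (var 0)
    (If (BR (distance d (var 3) (var 19)) (rvar 7)) (SetI 13 (var 3) (IC 1)) Skip).

(** Discards all balls, installs the exact table and leaves every point idle, so that the next
    [activate] makes all of them active. *)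
Definition restart : cmd :=
  Seq (for_loop 3 (var 0) (Seq (SetI 11 (var 3) (var 3)) (SetI 13 (var 3) (IC 0))))
  (Seq (assign 12 (var 0)) (Seq (assign 14 (IPlus (var 1) (IC 1)))
  (Seq (assign 15 (IC 0)) (Seq (assign 16 (IC 0)) (assign 18 (IC 0)))))).

Definition process : cmd :=
  Seq measure_ball (Seq output_radius
  (If (BI (var 16) (var 0)) (Seq output_ball mark_ball) restart)).

Definition greedy_loop : cmd :=
  Seq (assign 18 (IC 1))
  (While (BI (IC 1) (var 18))
    (Seq scan (If (BI (var 0) (var 19)) (assign 18 (IC 0)) process))).

(** Serves both the second greedy choice and the exact rerun: whatever is neither covered nor active
    becomes active, and scalar 17 records whether a further phase is due. *)
Definition activate : cmd :=
  Seq (assign 17 (IC 0))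
  (for_loop 3 (var 0)
    (If (BI (IA 13 (var 3)) (IC 0)) (Seq (SetI 13 (var 3) (IC 2)) (assign 17 (IC 1))) Skip)).

Definition phases : cmd :=
  While (BI (IC 1) (var 17)) (Seq active_radii (Seq greedy_loop activate)).

(** Replacing k by n when k > n costs nothing in the cover bound and gives k <= n to all later
    estimates. *)
Definition main : cmd :=
  If (BI (var 0) (IC 0)) Skip
  (Seq (If (BI (var 0) (var 1)) (assign 1 (var 0)) Skip)
  (Seq read_input (Seq find_big (Seq find_root (Seq find_range (Seq sample_table (Seq sample_active
  (Seq (assign 14 (var 5)) (Seq (assign 15 (IC 0)) (Seq (assign 16 (IC 0)) (Seq (assign 17 (IC 1))
  (Seq phases (assign 0 (var 15)))))))))))))).

End Program.

(** * Verification of the program *)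

Section Verification.

Variables (d n k beta : nat) (pt : nat -> list R) (big : R).

Notation det := (det beta).

Definition point_dist (i j : nat) : R := edist d (pt i) (pt j).

Notation pdist := point_dist.

Record env (s : store) : Prop := {
  env_n : ia s 0 0 = n;
  env_k : ia s 1 0 = k;
  env_pt : forall i j, (i < n)%nat -> (j < d)%nat -> ra s (10 + j) i = nth j (pt i) 0;
  env_big : ra s 1 0 = big }.

Lemma env_keep A B s s' : env s -> keep A B s s' ->
  Forall (fun a => 2 <= a)%nat A -> Forall (fun b => 2 <= b < 10)%nat B -> env s'.
Proof.
  intros [H1 H2 H3 H4] (K1 & K2 & _) HA HB. rewrite Forall_forall in HA, HB.
  assert (A0 : forall a, (a < 2)%nat -> ~ In a A) by (intros a Ha Hi; specialize (HA a Hi); lia).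
  assert (B0 : forall a, ~ (2 <= a < 10)%nat -> ~ In a B) by (intros a Ha Hi; specialize (HB a Hi); lia).
  split.
  - rewrite K1 by (apply A0; lia). exact H1.
  - rewrite K1 by (apply A0; lia). exact H2.
  - intros i j Hi Hj. rewrite K2 by (apply B0; lia). auto.
  - rewrite K2 by (apply B0; lia). exact H4.
Qed.

Lemma reval_distance s e1 e2 i j : env s -> ieval e1 s = i -> ieval e2 s = j ->
  (i < n)%nat -> (j < n)%nat -> reval (distance d e1 e2) s = pdist i j.
Proof.
  intros [_ _ Hp _] E1 E2 Hi Hj. unfold distance, point_dist, edist, dist2. cbn [reval]. f_equal.
  assert (H : forall l, (forall x, In x l -> (x < d)%nat) -> reval (sq_dist l e1 e2) s =
    fold_right Rplus 0 (map (fun j0 => (nth j0 (pt i) 0 - nth j0 (pt j) 0) ^ 2) l)).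
  { induction l as [|x l IH]; intros Hl; [reflexivity|].
    cbn [sq_dist reval opsem map fold_right]. rewrite IH by (intros; apply Hl; simpl; auto).
    rewrite E1, E2, !Hp by (auto; apply Hl; simpl; auto). simpl. ring. }
  apply H. intros x Hx. apply in_seq in Hx. lia.
Qed.

Record table (T : list nat) (m : nat) (s : store) : Prop := {
  table_length : ia s 12 0 = length T;
  table_nth : forall t, (t < length T)%nat -> ia s 11 t = nth t T 0%nat;
  table_rank : ia s 14 0 = m }.

Lemma table_keep A B T m s s' : table T m s -> keep A B s s' ->
  Forall (fun a => ~ In a [11; 12; 14])%nat A -> table T m s'.
Proof.
  intros [H1 H2 H3] (K1 & _ & _) HA. rewrite Forall_forall in HA.
  assert (A0 : forall a, In a [11; 12; 14]%nat -> ~ In a A) by (intros a Ha Hi; specialize (HA a Hi); tauto).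
  split.
  - rewrite K1 by (apply A0; simpl; tauto). exact H1.
  - intros t Ht. rewrite K1 by (apply A0; simpl; tauto). auto.
  - rewrite K1 by (apply A0; simpl; tauto). exact H3.
Qed.

Definition table_ok (T : list nat) (m : nat) : Prop :=
  (forall t, In t T -> (t < n)%nat) /\ (1 <= m)%nat.

Hypothesis big_pos : 0 < big.
Hypothesis pt_sep : forall x y, (x < n)%nat -> (y < n)%nat -> x <> y -> 0 < pdist x y.
Hypothesis pt_big : forall x y, (x < n)%nat -> (y < n)%nat -> pdist x y < big.
Hypothesis low_size : (n * (d + 1) <= beta)%nat.

(** Budget form of the rules: [t] is fixed beforehand and reduced command by command, so that linear
    inequalities remain at the leaves. *)
Lemma det_seq_setI a e1 e2 c s t Q :
  det c (setI s a (ieval e1 s) (ieval e2 s)) (t - 1) Q -> det (Seq (SetI a e1 e2) c) s t Q.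
Proof.
  intros H. eapply det_le; [eapply det_seq|].
  - apply det_setI. exact (eq_refl (setI _ _ _ _)).
  - intros s' <-. exact H.
  - lra.
Qed.

Lemma det_seq_setR a e1 e2 c s t Q :
  det c (setR s a (ieval e1 s) (reval e2 s)) (t - 1) Q -> det (Seq (SetR a e1 e2) c) s t Q.
Proof.
  intros H. eapply det_le; [eapply det_seq|].
  - apply det_setR. exact (eq_refl (setR _ _ _ _)).
  - intros s' <-. exact H.
  - lra.
Qed.

Lemma det_last_setI a e1 e2 s t (Q : store -> Prop) :
  1 <= t -> Q (setI s a (ieval e1 s) (ieval e2 s)) -> det (SetI a e1 e2) s t Q.
Proof. intros Ht H. eapply det_le; [apply det_setI; exact H|exact Ht]. Qed.

Lemma det_last_setR a e1 e2 s t (Q : store -> Prop) :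
  1 <= t -> Q (setR s a (ieval e1 s) (reval e2 s)) -> det (SetR a e1 e2) s t Q.
Proof. intros Ht H. eapply det_le; [apply det_setR; exact H|exact Ht]. Qed.

Lemma det_last_skip s t (Q : store -> Prop) : 0 <= t -> Q s -> det Skip s t Q.
Proof. intros Ht H. eapply det_le; [apply det_skip; exact H|exact Ht]. Qed.

Lemma det_branch b c1 c2 s t Q :
  det (if beval b s then c1 else c2) s (t - 1) Q -> det (If b c1 c2) s t Q.
Proof. intros H. eapply det_le; [apply det_if; exact H|lra]. Qed.

Lemma det_seq_then c1 c2 s t1 t (Q1 Q : store -> Prop) :
  det c1 s t1 Q1 -> (forall s', Q1 s' -> det c2 s' (t - t1) Q) -> det (Seq c1 c2) s t Q.
Proof. intros H1 H2. eapply det_le; [eapply det_seq; [exact H1|exact H2]|lra]. Qed.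

Lemma firstn_S_nth (T : list nat) j : (j < length T)%nat -> firstn (S j) T = firstn j T ++ [nth j T 0%nat].
Proof.
  revert j. induction T as [|a T IH]; intros j Hj; simpl in Hj; [lia|].
  destruct j as [|j]; [reflexivity|]. simpl. f_equal. apply IH. lia.
Qed.

Lemma eval_dist_table T m s x j : env s -> table T m s -> table_ok T m ->
  ia s 3 0 = x -> (x < n)%nat -> ia s 21 0 = j -> (j < length T)%nat ->
  reval (dist_table d) s = pdist (nth j T 0%nat) x.
Proof.
  intros He [H1 H2 H3] [Hok _] Hx Hxn Hj Hlt. apply reval_distance; auto.
  - cbn [ieval var]. rewrite Hj. auto.
  - apply Hok. apply nth_In. exact Hlt.
Qed.

Lemma det_next_radius T m s x cur :
  env s -> table T m s -> table_ok T m -> ia s 3 0 = x -> (x < n)%nat ->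
  ra s 3 0 = cur -> cur < big ->
  det (next_radius d) s (INR (length T) * 5 + 3) (fun s' =>
    keep [21]%nat [4]%nat s s' /\
    let v := ra s' 4 0 in
    v <= big /\ cur < v /\ (forall t, In t T -> pdist t x <= cur \/ v <= pdist t x) /\
    (v = big \/ exists t, In t T /\ pdist t x = v)).
Proof.
  intros He Ht Hok Hx Hxn Hcur Hlt. unfold next_radius. apply det_seq_setR.
  eapply det_le; [|apply Req_le; instantiate (1 := INR (length T) * (3 + 2) + 2); lra].
  apply det_for with (I := fun j s' =>
      ia s' 21 0 = j /\ keep [21]%nat [4]%nat s s' /\
      let v := ra s' 4 0 in
      v <= big /\ cur < v /\ (forall t, In t (firstn j T) -> pdist t x <= cur \/ v <= pdist t x) /\
      (v = big \/ exists t, In t (firstn j T) /\ pdist t x = v)).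
  - intros j s' _ (E & Hk & _). split; [exact E|]. cbn [ieval var].
    rewrite (proj1 Hk) by (simpl; lia). apply Ht.
  - intros j s' Hj (E & Hk & V1 & V2 & V3 & V4).
    assert (He' : env s') by (eapply env_keep; [exact He|exact Hk|index_tac|index_tac]).
    assert (Ht' : table T m s') by (eapply table_keep; [exact Ht|exact Hk|index_tac]).
    assert (Hx' : ia s' 3 0 = x) by (rewrite (proj1 Hk) by (simpl; lia); exact Hx).
    assert (Hc' : ra s' 3 0 = cur) by (rewrite (proj1 (proj2 Hk)) by (simpl; lia); exact Hcur).
    pose proof (eval_dist_table T m s' x j He' Ht' Hok Hx' Hxn E Hj) as Ed.
    set (w := pdist (nth j T 0%nat) x) in *.
    rewrite firstn_S_nth by exact Hj.
    apply det_branch. cbn [beval]. rewrite Ed. cbn [reval rvar ieval]. rewrite Hc'.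
    destruct (Rleb w cur) eqn:E1; [|apply det_branch; cbn [beval]; rewrite Ed; cbn [reval rvar ieval];
      destruct (Rleb (ra s' 4 0) w) eqn:E2].
    + apply Rleb_true in E1. apply det_last_skip; [lra|].
      split; [exact E|]. split; [reflexivity|]. split; [keep_tac|].
      split; [exact V1|]. split; [exact V2|]. split.
      * intros t Hin. apply in_app_iff in Hin. destruct Hin as [Hin|[<-|[]]]; [auto|left; exact E1].
      * destruct V4 as [V4|(t & Hin & V4)]; [left; exact V4|right; exists t; split; [apply in_app_iff; auto|exact V4]].
    + apply Rleb_true in E2. apply det_last_skip; [lra|].
      split; [exact E|]. split; [reflexivity|]. split; [keep_tac|].
      split; [exact V1|]. split; [exact V2|]. split.
      * intros t Hin. apply in_app_iff in Hin. destruct Hin as [Hin|[<-|[]]]; [auto|right; exact E2].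
      * destruct V4 as [V4|(t & Hin & V4)]; [left; exact V4|right; exists t; split; [apply in_app_iff; auto|exact V4]].
    + apply Rleb_false in E1, E2. apply det_last_setR; [lra|]. cbn [ieval]. rewrite Ed.
      reduce. split; [exact E|]. split; [reflexivity|]. split; [keep_tac|].
      assert (w < big \/ big <= w) by lra.
      split; [lra|]. split; [lra|]. split.
      * intros t Hin. apply in_app_iff in Hin. destruct Hin as [Hin|[<-|[]]]; [|right; fold w; lra].
        destruct (V3 t Hin); [auto|right; lra].
      * right. exists (nth j T 0%nat). split; [apply in_app_iff; simpl; auto|reflexivity].
  - reduce. rewrite (env_big s He). split; [reflexivity|]. split; [keep_tac|].
    split; [lra|]. split; [lra|]. split; [simpl; tauto|auto].
  - intros s' (_ & Hk & V). rewrite firstn_all in V. split; assumption.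
Qed.

Lemma det_count_table T m s x cur :
  env s -> table T m s -> table_ok T m -> ia s 3 0 = x -> (x < n)%nat ->
  ra s 3 0 = cur ->
  det (count_table d) s (INR (length T) * 4 + 3) (fun s' =>
    keep [20; 21]%nat [] s s' /\ ia s' 20 0 = count (fun t => Rleb (pdist t x) cur) T).
Proof.
  intros He Ht Hok Hx Hxn Hcur. unfold count_table. apply det_seq_setI.
  eapply det_le; [|apply Req_le; instantiate (1 := INR (length T) * (2 + 2) + 2); lra].
  apply det_for with (I := fun j s' =>
      ia s' 21 0 = j /\ keep [20; 21]%nat [] s s' /\
      ia s' 20 0 = count (fun t => Rleb (pdist t x) cur) (firstn j T)).
  - intros j s' _ (E & Hk & _). split; [exact E|]. cbn [ieval var].
    rewrite (proj1 Hk) by (simpl; lia). apply Ht.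
  - intros j s' Hj (E & Hk & V).
    assert (He' : env s') by (eapply env_keep; [exact He|exact Hk|index_tac|index_tac]).
    assert (Ht' : table T m s') by (eapply table_keep; [exact Ht|exact Hk|index_tac]).
    assert (Hx' : ia s' 3 0 = x) by (rewrite (proj1 Hk) by (simpl; lia); exact Hx).
    assert (Hc' : ra s' 3 0 = cur) by (rewrite (proj1 (proj2 Hk)) by (simpl; lia); exact Hcur).
    pose proof (eval_dist_table T m s' x j He' Ht' Hok Hx' Hxn E Hj) as Ed.
    apply det_branch. cbn [beval]. rewrite Ed. cbn [reval rvar ieval]. rewrite Hc'.
    rewrite firstn_S_nth, count_app, count_cons by exact Hj.
    destruct (Rleb (pdist (nth j T 0%nat) x) cur) eqn:E1.
    + apply det_last_setI; [lra|]. reduce. split; [exact E|]. split; [reflexivity|]. split; [keep_tac|].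
      rewrite V. reflexivity.
    + apply det_last_skip; [lra|].
      reduce. split; [exact E|]. split; [reflexivity|]. split; [keep_tac|].
      rewrite V. unfold count at 3. simpl. lia.
  - reduce. split; [reflexivity|]. split; [keep_tac|reflexivity].
  - intros s' (_ & Hk & V). rewrite firstn_all in V. split; assumption.
Qed.

Lemma pdist_nonneg i j : 0 <= pdist i j.
Proof. apply edist_nonneg. Qed.

Lemma det_point_radius T m s x :
  env s -> table T m s -> table_ok T m -> ia s 3 0 = x -> (x < n)%nat ->
  det (point_radius d) s (INR m * (INR (length T) * 9 + 10) + 4) (fun s' =>
    keep [20; 21]%nat [2; 3; 4]%nat s s' /\
    ra s' 2 x = radius pdist big T m x /\ (forall y, y <> x -> ra s' 2 y = ra s 2 y)).
Proof.
  intros He Ht Hok Hx Hxn. unfold point_radius.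
  set (u := INR (length T) * 9 + 10).
  assert (Hu : 10 <= u) by (unfold u; pose proof (pos_INR (length T)); lra).
  assert (Hloop : forall f c s', (m - c <= f)%nat ->
    keep [20; 21]%nat [3; 4]%nat s s' -> ia s' 20 0 = c ->
    (((c < m)%nat /\ c = count (fun t => Rleb (pdist t x) (ra s' 3 0)) T /\ ra s' 3 0 < big) \/
    ((m <= c)%nat /\ is_radius pdist big T m x (ra s' 3 0))) ->
    det (While (less (var 20) (var 14))
      (Seq (next_radius d) (Seq (rassign 3 (rvar 4))
      (If (BR (rvar 1) (rvar 3)) (assign 20 (var 14)) (count_table d))))) s' (INR f * u + 1)
      (fun s2 => keep [20; 21]%nat [3; 4]%nat s s2 /\
         is_radius pdist big T m x (ra s2 3 0))).
  { induction f as [|f IH]; intros c s' Hf Hk Hc Hcase;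
      assert (He' : env s') by (eapply env_keep; [exact He|exact Hk|index_tac|index_tac]);
      assert (Ht' : table T m s') by (eapply table_keep; [exact Ht|exact Hk|index_tac]);
      assert (Hx' : ia s' 3 0 = x) by (rewrite (proj1 Hk) by (simpl; lia); exact Hx);
      (destruct Hcase as [(C1 & C2 & C3)|(C1 & C2)];
        [|eapply det_le; [apply det_while_false;
            [rewrite beval_less; cbn [ieval var]; apply Nat.ltb_ge; rewrite Hc, (table_rank _ _ _ Ht'); exact C1
            |split; assumption]
          |rewrite <- (Rplus_0_l 1) at 1; apply Rplus_le_compat_r, Rmult_le_pos; [apply pos_INR|lra]]]).
    - lia.
    - eapply det_le; [apply det_while_true with (Q1 := fun s2 => exists c2, (c < c2)%nat /\
          keep [20; 21]%nat [3; 4]%nat s s2 /\ ia s2 20 0 = c2 /\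
          (((c2 < m)%nat /\ c2 = count (fun t => Rleb (pdist t x) (ra s2 3 0)) T /\ ra s2 3 0 < big) \/
           ((m <= c2)%nat /\ is_radius pdist big T m x (ra s2 3 0)))) (t1 := u - 1)|..].
      + rewrite beval_less; cbn [ieval var]; apply Nat.ltb_lt; rewrite Hc, (table_rank _ _ _ Ht'); exact C1.
      + eapply det_seq_then; [apply det_next_radius with (T := T) (m := m); eauto|].
        { intros s2 (Hk2 & V1 & V2 & V3 & V4).
          apply det_seq_setR. reduce.
          assert (Hk' : keep [20; 21]%nat [3; 4]%nat s (setR s2 3 0 (ra s2 4 0))).
          { keep_tac. eapply keep_trans; [exact Hk|]. eapply keep_incl; [| |exact Hk2]; intros a; simpl; tauto. }
          set (v := ra s2 4 0) in *.
          set (s3 := setR s2 3 0 v) in *.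
          assert (He3 : env s3) by (eapply env_keep; [exact He|exact Hk'|index_tac|index_tac]).
          assert (Ht3 : table T m s3) by (eapply table_keep; [exact Ht|exact Hk'|index_tac]).
          assert (Hx3 : ia s3 3 0 = x) by (rewrite (proj1 Hk') by (simpl; lia); exact Hx).
          (* No table distance lies strictly between the old radius and v, so the open ball of
             radius v holds only what the old closed ball held. *)
          assert (Hcnt : (count (fun t => Rltb (pdist t x) v) T <= c)%nat).
          { rewrite C2. apply count_le. intros t Hin Htv. apply Rltb_true in Htv. apply Rleb_true.
            destruct (V3 t Hin); lra. }
          apply det_branch.
          cbn [beval reval rvar ieval]. rewrite (env_big _ He3).
          change (ra s3 3 0) with v.
          destruct (Rleb big v) eqn:Eb.
          (* At the cap the counter is set to m by force, which ends the loop. *)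
          -- apply Rleb_true in Eb. apply det_last_setI; [unfold u; pose proof (pos_INR (length T)); lra|].
             exists m. reduce. rewrite (table_rank _ _ _ Ht3). split; [exact C1|].
             split; [apply keep_setI; [simpl; tauto|exact Hk']|].
             split; [reflexivity|]. right. split; [lia|].
             change (ra s3 3 0) with v. split; [exact V1|]. split; [lia|]. right. lra.
          -- apply Rleb_false in Eb.
             eapply det_weaken; [apply det_count_table with (T := T) (m := m) (x := x) (cur := v); auto|unfold u; lra|].
             intros s4 (Hk4 & V5). exists (count (fun t => Rleb (pdist t x) v) T).
             assert (Hv : ra s4 3 0 = v) by (rewrite (proj1 (proj2 Hk4)) by (simpl; lia); reflexivity).
             split; [|split; [|split]].
             ++ rewrite C2. destruct V4 as [V4|(t & Hin & V4)]; [lra|].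
                apply count_lt with (x := t); [|exact Hin| |].
                ** intros y Hy Hyc. apply Rleb_true in Hyc. apply Rleb_true. lra.
                ** apply Rleb_false. lra.
                ** apply Rleb_true. lra.
             ++ eapply keep_trans; [exact Hk'|]. eapply keep_incl; [| |exact Hk4]; intros a; simpl; tauto.
             ++ exact V5.
             ++ rewrite Hv. destruct (le_lt_dec m (count (fun t => Rleb (pdist t x) v) T)) as [Hle|Hlt].
                ** right. split; [exact Hle|]. split; [exact V1|]. split; [lia|]. left. exact Hle.
                ** left. split; [exact Hlt|]. split; [reflexivity|exact Eb]. }
      + intros s2 (c2 & Hc2 & Hk2 & E2 & Hcase2). apply (IH c2 s2); auto. lia.
      + rewrite S_INR. lra. }
  apply det_seq_setR. reduce. apply det_seq_setI. eapply det_seq_then.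
  - reduce. apply (Hloop m 0%nat).
    + lia.
    + keep_tac.
    + reflexivity.
    (* The start radius -1 is below every distance, so the closed ball holds none of the entries and
       the count 0 is right. *)
    + left. reduce. split; [apply Hok|]. split; [|lra].
      symmetry. unfold count. replace (filter _ T) with (@nil nat); [reflexivity|].
      clear. symmetry. induction T as [|t T' IH]; [reflexivity|]. cbn [filter].
      replace (Rleb (pdist t x) (0 - 1)) with false; [exact IH|].
      symmetry. apply Rleb_false. pose proof (pdist_nonneg t x). lra.
  - intros s2 (Hk2 & Hr). apply det_last_setR; [lra|]. reduce.
    assert (Hx2 : ia s2 3 0 = x) by (rewrite (proj1 Hk2) by (simpl; lia); exact Hx).
    rewrite Hx2. split; [|split].
    + keep_tac. eapply keep_incl; [| |exact Hk2]; intros a; simpl; tauto.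
    + rewrite Nat.eqb_refl. eapply is_radius_unique; [exact Hr|]. apply radius_spec. apply Hok.
    + intros y Hy. apply Nat.eqb_neq in Hy. rewrite Hy. apply Hk2. simpl. lia.
Qed.

Notation rad T m := (radius pdist big T m).
Notation cov T m := (covers n k pdist big T m).
Notation heavy T m := (heavy_ball n k pdist big T m).
Notation light T m := (light_ball n k pdist big T m).

Lemma pdist_refl x : pdist x x = 0.
Proof. apply edist_refl. Qed.

Lemma pdist_sym x y : pdist x y = pdist y x.
Proof. apply edist_sym. Qed.

(** The closed ball stored in slot [idx] has exactly the points that the greedy choice regards as
    covered by x. *)
Definition ball_ok (T : list nat) (m : nat) (s : store) (idx x : nat) : Prop :=
  (forall j, (j < d)%nat -> low s (idx * (d + 1) + j) = nth j (pt x) 0) /\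
  0 < low s (idx * (d + 1) + d) /\
  forall i, (i < n)%nat -> Rleb (pdist i x) (low s (idx * (d + 1) + d)) = cov T m x i.

(* [sel] lists the centers chosen so far and [P] the active points. *)
Record config (T : list nat) (m : nat) (sel : list nat) (P : nat -> bool) (s : store) : Prop := {
  config_env : env s;
  config_table : table T m s;
  config_status : forall i, (i < n)%nat -> ia s 13 i =
    if existsb (fun x => cov T m x i) sel then 1%nat else if P i then 2%nat else 0%nat;
  config_fresh : forall i, (i < n)%nat -> P i = true -> existsb (fun x => cov T m x i) sel = false;
  config_count : ia s 15 0 = length sel;
  config_heavy : ia s 16 0 = (k * count (heavy T m) sel)%nat;
  config_few : (k * count (heavy T m) sel <= n)%nat;
  config_NoDup : NoDup sel;
  config_in : forall x, In x sel -> (x < n)%nat;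
  config_balls : forall idx, (idx < length sel)%nat -> ball_ok T m s idx (nth idx sel 0%nat) }.

Lemma config_n T m sel P s : config T m sel P s -> ia s 0 0 = n.
Proof. intros H. apply env_n. eapply config_env, H. Qed.

Lemma config_keep A B T m sel P s s' : config T m sel P s -> keep A B s s' ->
  Forall (fun a => ~ In a [0; 1; 11; 12; 13; 14; 15; 16])%nat A -> Forall (fun b => 2 <= b < 10)%nat B ->
  config T m sel P s'.
Proof.
  intros [C1 C2 C3 C4 C5 C6 C7 C8 C9 C10] Hk HA HB.
  assert (A0 : forall a i, In a [0; 1; 11; 12; 13; 14; 15; 16]%nat -> ia s' a i = ia s a i).
  { intros a i Ha. apply Hk. rewrite Forall_forall in HA. intros Hi. specialize (HA a Hi). tauto. }
  assert (Hlow : forall i, low s' i = low s i) by apply Hk.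
  constructor; auto.
  - eapply env_keep; [exact C1|exact Hk| |exact HB].
    eapply Forall_impl; [|exact HA]. intros a Ha. simpl in Ha. lia.
  - eapply table_keep; [exact C2|exact Hk|].
    eapply Forall_impl; [|exact HA]. intros a Ha. simpl in *. tauto.
  - intros i Hi. rewrite A0 by (simpl; tauto). auto.
  - rewrite A0 by (simpl; tauto). exact C5.
  - rewrite A0 by (simpl; tauto). exact C6.
  - intros idx Hidx. destruct (C10 idx Hidx) as (B1 & B2 & B3). unfold ball_ok.
    rewrite Hlow. split; [|split; [exact B2|exact B3]].
    intros j Hj. rewrite Hlow. auto.
Qed.

Definition radii_ok (T : list nat) (m : nat) (P : nat -> bool) (s : store) : Prop :=
  forall i, (i < n)%nat -> P i = true -> ra s 2 i = rad T m i.

Lemma config_active T m sel P s i : config T m sel P s -> (i < n)%nat ->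
  Nat.leb 2 (ia s 13 i) = P i.
Proof.
  intros Hc Hi. rewrite (config_status _ _ _ _ _ Hc) by exact Hi.
  destruct (P i) eqn:E; [rewrite (config_fresh _ _ _ _ _ Hc) by assumption; reflexivity|].
  destruct (existsb _ sel); reflexivity.
Qed.

Lemma rsum_active (P : nat -> bool) (u : R) : rsum n (fun i => if P i then u else 1) <= INR n + INR (count P (seq 0 n)) * u.
Proof.
  rewrite count_rsum, Rmult_comm, <- rsum_scal. rewrite <- (Rmult_1_r (INR n)), <- rsum_const, <- rsum_plus.
  apply rsum_le. intros i _. destruct (P i); lra.
Qed.

Lemma det_active_radii T m sel P s :
  config T m sel P s -> table_ok T m ->
  det (active_radii d) s
    (3 * INR n + 2 + INR (count P (seq 0 n)) * (INR m * (INR (length T) * 9 + 10) + 5))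
    (fun s' => config T m sel P s' /\ radii_ok T m P s').
Proof.
  intros Hc Hok. unfold active_radii.
  set (u := INR m * (INR (length T) * 9 + 10) + 5).
  assert (Hu : 5 <= u).
  { unfold u. pose proof (pos_INR m). pose proof (pos_INR (length T)).
    assert (0 <= INR m * (INR (length T) * 9 + 10)) by (apply Rmult_le_pos; lra). lra. }
  eapply det_le; [apply det_for_sum with (n := n) (t := fun i => if P i then u else 1)
    (I := fun j s' => ia s' 3 0 = j /\ keep [3; 20; 21]%nat [2; 3; 4]%nat s s' /\
      forall i, (i < j)%nat -> P i = true -> ra s' 2 i = rad T m i)|].
  - intros j s' _ (E & Hk & _). split; [exact E|]. cbn [ieval var]. use_keep Hk. eapply config_n, Hc.
  - intros j s' Hj (E & Hk & Hr).
    assert (Hc' : config T m sel P s') by (eapply config_keep; [exact Hc|exact Hk|index_tac|index_tac]).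
    apply det_branch. cbn [beval is_active ieval var]. rewrite E.
    rewrite (config_active _ _ _ _ _ _ Hc' Hj). destruct (P j) eqn:Pj.
    + eapply det_weaken; [apply det_point_radius with (T := T) (m := m) (x := j);
        [eapply config_env, Hc'|eapply config_table, Hc'|exact Hok|exact E|exact Hj]|unfold u; lra|].
      intros s2 (Hk2 & R1 & R2). split; [use_keep Hk2; exact E|]. reduce. split; [reflexivity|]. split.
      * keep_tac. eapply keep_trans; [exact Hk|]. eapply keep_incl; [| |exact Hk2]; intros a; simpl; tauto.
      * intros i Hi Pi. destruct (Nat.eq_dec i j) as [->|Hne]; [exact R1|].
        rewrite R2 by exact Hne. apply Hr; [lia|exact Pi].
    + apply det_last_skip; [lra|]. split; [exact E|]. reduce. split; [reflexivity|]. split; [keep_tac|].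
      intros i Hi Pi. destruct (Nat.eq_dec i j) as [->|Hne]; [congruence|]. apply Hr; [lia|exact Pi].
  - reduce. split; [reflexivity|]. split; [keep_tac|]. intros; lia.
  - intros s' (_ & Hk & Hr). split; [|exact Hr].
    eapply config_keep; [exact Hc|exact Hk|index_tac|index_tac].
  - pose proof (rsum_active P u). lra.
Qed.

Lemma det_scan T m sel P s :
  config T m sel P s -> radii_ok T m P s ->
  det scan s (INR n * 6 + 3) (fun s' => keep [3; 19]%nat [] s s' /\
    (ia s' 19 0 = n /\ (forall i, (i < n)%nat -> P i = false) \/
     is_pick n (rad T m) P (ia s' 19 0))).
Proof.
  intros Hc Hr. unfold scan. apply det_seq_setI.
  eapply det_le; [|apply Req_le; instantiate (1 := INR n * (4 + 2) + 2); lra].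
  apply det_for with (I := fun j s' => ia s' 3 0 = j /\ keep [3; 19]%nat [] s s' /\
    let x := ia s' 19 0 in
    ((x = n /\ (forall i, (i < j)%nat -> P i = false)) \/
     ((x < j)%nat /\ (x < n)%nat /\ P x = true /\ forall y, (y < j)%nat -> P y = true ->
       rad T m y < rad T m x \/ (rad T m y = rad T m x /\ (x <= y)%nat)))).
  - intros j s' _ (E & Hk & _). split; [exact E|]. cbn [ieval var]. use_keep Hk. eapply config_n, Hc.
  - intros j s' Hj (E & Hk & Hx).
    assert (Hc' : config T m sel P s') by (eapply config_keep; [exact Hc|exact Hk|index_tac|index_tac]).
    assert (Hr' : forall i, (i < n)%nat -> P i = true -> ra s' 2 i = rad T m i).
    { intros i Hi Pi. rewrite (proj1 (proj2 Hk)) by (simpl; lia). auto. }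
    assert (Hn' : ia s' 0 0 = n) by (eapply config_n, Hc').
    apply det_branch. cbn [beval is_active ieval var]. rewrite E.
    rewrite (config_active _ _ _ _ _ _ Hc' Hj). destruct (P j) eqn:Pj.
    + apply det_branch. cbn [beval ieval var]. rewrite Hn'.
      destruct (Nat.leb_spec n (ia s' 19 0)) as [Hle|Hlt].
      * apply det_last_setI; [lra|]. reduce. rewrite E. split; [reflexivity|]. split; [reflexivity|]. split; [keep_tac|].
        destruct Hx as [[_ Hx]|Hx]; [|lia]. right. split; [lia|]. split; [exact Hj|]. split; [exact Pj|].
        intros y Hy Py. destruct (Nat.eq_dec y j) as [->|]; [right; split; [reflexivity|lia]|].
        rewrite Hx in Py by lia. discriminate.
      * destruct Hx as [[Hx _]|(X1 & X2 & X3 & X4)]; [lia|].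
        apply det_branch. cbn [beval reval ieval var]. rewrite E, !Hr' by assumption.
        destruct (Rleb (rad T m j) (rad T m (ia s' 19 0))) eqn:El.
        -- apply Rleb_true in El. apply det_last_skip; [lra|]. reduce.
           split; [exact E|]. split; [reflexivity|]. split; [keep_tac|].
           right. split; [lia|]. split; [exact X2|]. split; [exact X3|].
           intros y Hy Py. destruct (Nat.eq_dec y j) as [->|]; [|apply X4; [lia|exact Py]].
           destruct (Req_dec (rad T m j) (rad T m (ia s' 19 0))); [right; split; [assumption|lia]|left; lra].
        -- apply Rleb_false in El. apply det_last_setI; [lra|]. reduce. rewrite E.
           split; [reflexivity|]. split; [reflexivity|]. split; [keep_tac|].
           right. split; [lia|]. split; [exact Hj|]. split; [exact Pj|].
           intros y Hy Py. destruct (Nat.eq_dec y j) as [->|]; [right; split; [reflexivity|lia]|].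
           left. destruct (X4 y) as [|[]]; [lia|exact Py|lra|lra].
    + apply det_last_skip; [lra|]. reduce. split; [exact E|]. split; [reflexivity|]. split; [keep_tac|].
      destruct Hx as [[X1 X2]|(X1 & X2 & X3 & X4)].
      * left. split; [exact X1|]. intros i Hi. destruct (Nat.eq_dec i j) as [->|]; [exact Pj|apply X2; lia].
      * right. split; [lia|]. split; [exact X2|]. split; [exact X3|].
        intros y Hy Py. destruct (Nat.eq_dec y j) as [->|]; [congruence|apply X4; [lia|exact Py]].
  - reduce. split; [reflexivity|]. split; [keep_tac|]. left. split; [eapply config_n, Hc|intros; lia].
  - intros s' (_ & Hk & Hx). split; [exact Hk|].
    destruct Hx as [Hx|(X1 & X2 & X3 & X4)]; [left; exact Hx|right]. split; [exact X2|]. split; assumption.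
Qed.

Lemma det_measure_ball s x r :
  env s -> ia s 19 0 = x -> (x < n)%nat -> ra s 2 x = r ->
  det (measure_ball d) s (INR n * 10 + 5) (fun s' => keep [3; 20]%nat [5; 6; 8]%nat s s' /\
    ia s' 20 0 = count (fun i => Rltb (pdist i x) r) (seq 0 n) /\
    (let v := ra s' 5 0 in 0 <= v /\ (0 < r -> v < r) /\
       forall i, (i < n)%nat -> pdist i x < r -> pdist i x <= v) /\
    (let v := ra s' 6 0 in 0 < v /\ forall i, (i < n)%nat -> 0 < pdist i x -> v <= pdist i x)).
Proof.
  intros He Hx Hxn Hr. unfold measure_ball.
  apply det_seq_setI. apply det_seq_setR. apply det_seq_setR.
  eapply det_le; [|apply Req_le; instantiate (1 := INR n * (8 + 2) + 2); lra].
  apply det_for with (I := fun j s' => ia s' 3 0 = j /\ keep [3; 20]%nat [5; 6; 8]%nat s s' /\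
    ia s' 20 0 = count (fun i => Rltb (pdist i x) r) (seq 0 j) /\
    (let v := ra s' 5 0 in 0 <= v /\ (0 < r -> v < r) /\
       forall i, (i < j)%nat -> pdist i x < r -> pdist i x <= v) /\
    (let v := ra s' 6 0 in 0 < v /\ forall i, (i < j)%nat -> 0 < pdist i x -> v <= pdist i x)).
  - intros j s' _ (E & Hk & _). split; [exact E|]. cbn [ieval var]. use_keep Hk. apply He.
  - intros j s' Hj (E & Hk & Hcnt & (V1 & V2 & V3) & (W1 & W2)).
    assert (He' : env s') by (eapply env_keep; [exact He|exact Hk|index_tac|index_tac]).
    assert (Hx' : ia s' 19 0 = x) by (use_keep Hk; exact Hx).
    assert (Hr' : ra s' 2 x = r) by (rewrite (proj1 (proj2 Hk)) by (simpl; lia); exact Hr).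
    apply det_seq_setR. cbn [ieval].
    rewrite (reval_distance s' (var 3) (var 19) j x He' E Hx' Hj Hxn).
    set (w := pdist j x). assert (Hw0 : 0 <= w) by apply pdist_nonneg.
    set (s1 := setR s' 8 0 w).
    rewrite seq_S, count_app, count_cons.
    eapply det_seq_then with (t1 := 4) (Q1 := fun s2 =>
      ia s2 3 0 = j /\ keep [3; 20]%nat [5; 6; 8]%nat s s2 /\ ra s2 8 0 = w /\
      ra s2 6 0 = ra s' 6 0 /\
      ia s2 20 0 = (count (fun i => Rltb (pdist i x) r) (seq 0 j) + (if Rltb w r then 1 else 0))%nat /\
      (let v := ra s2 5 0 in 0 <= v /\ (0 < r -> v < r) /\
         forall i, (i < S j)%nat -> pdist i x < r -> pdist i x <= v)).
    + apply det_branch. unfold s1. unfold chosen_radius. reduce. rewrite Hx', Hr'.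
      change (Rltb w r) with (negb (Rleb r w)).
      destruct (Rleb r w) eqn:E1.
      * apply Rleb_true in E1. apply det_last_skip; [lra|]. reduce.
        split; [exact E|]. split; [keep_tac|]. split; [reflexivity|]. split; [reflexivity|].
        split; [rewrite Hcnt; simpl; lia|]. split; [exact V1|]. split; [exact V2|].
        intros i Hi Hlt. destruct (Nat.eq_dec i j) as [->|]; [fold w in Hlt; lra|apply V3; [lia|exact Hlt]].
      * apply Rleb_false in E1. apply det_seq_setI. apply det_branch. reduce.
        destruct (Rleb (ra s' 5 0) w) eqn:E2.
        -- apply Rleb_true in E2. apply det_last_setR; [lra|]. reduce.
           split; [exact E|]. split; [keep_tac|]. split; [reflexivity|]. split; [reflexivity|].
           split; [rewrite Hcnt; reflexivity|]. split; [exact Hw0|]. split; [intros; exact E1|].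
           intros i Hi Hlt. destruct (Nat.eq_dec i j) as [->|]; [fold w; lra|].
           eapply Rle_trans; [apply V3; [lia|exact Hlt]|exact E2].
        -- apply Rleb_false in E2. apply det_last_skip; [lra|]. reduce.
           split; [exact E|]. split; [keep_tac|]. split; [reflexivity|]. split; [reflexivity|].
           split; [rewrite Hcnt; reflexivity|]. split; [exact V1|]. split; [exact V2|].
           intros i Hi Hlt. destruct (Nat.eq_dec i j) as [->|]; [fold w; lra|apply V3; [lia|exact Hlt]].
    + intros s2 (A1 & A2 & A3 & A4 & A5 & A6).
      assert (Hcount : ia s2 20 0 = (count (fun i => Rltb (pdist i x) r) (seq 0 j) +
        ((if Rltb (pdist (0 + j) x) r then 1 else 0) + count (fun i => Rltb (pdist i x) r) []))%nat).
      { rewrite A5. simpl. fold w. unfold count at 3. simpl. lia. }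
      apply det_branch. cbn [beval reval rvar ieval]. rewrite A3.
      destruct (Rleb w 0) eqn:E1; [|apply det_branch; cbn [beval reval rvar ieval]; rewrite A3, A4;
        destruct (Rleb (ra s' 6 0) w) eqn:E2].
      * apply Rleb_true in E1. apply det_last_skip; [lra|]. reduce.
        split; [exact A1|]. split; [reflexivity|]. split; [keep_tac|]. split; [exact Hcount|].
        split; [exact A6|]. rewrite A4. split; [exact W1|].
        intros i Hi Hpos. destruct (Nat.eq_dec i j) as [->|]; [fold w in Hpos; lra|apply W2; [lia|exact Hpos]].
      * apply Rleb_true in E2. apply det_last_skip; [lra|]. reduce.
        split; [exact A1|]. split; [reflexivity|]. split; [keep_tac|]. split; [exact Hcount|].
        split; [exact A6|]. rewrite A4. split; [exact W1|].
        intros i Hi Hpos. destruct (Nat.eq_dec i j) as [->|]; [exact E2|apply W2; [lia|exact Hpos]].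
      * apply Rleb_false in E1, E2. apply det_last_setR; [lra|]. reduce. rewrite A3.
        split; [exact A1|]. split; [reflexivity|]. split; [keep_tac|]. split; [exact Hcount|].
        split; [exact A6|]. split; [exact E1|].
        intros i Hi Hpos. destruct (Nat.eq_dec i j) as [->|]; [fold w; lra|].
        assert (ra s' 6 0 <= pdist i x) by (apply W2; [lia|exact Hpos]). lra.
  - reduce. split; [reflexivity|]. split; [keep_tac|]. split; [reflexivity|]. split.
    + split; [lra|]. split; [auto|]. intros; lia.
    + split; [lra|]. intros; lia.
  - intros s' (_ & H). exact H.
Qed.

Lemma Rleb_tiny x i v : (x < n)%nat -> (i < n)%nat -> 0 < v ->
  (forall j, (j < n)%nat -> 0 < pdist j x -> v <= pdist j x) ->
  Rleb (pdist i x) (v / (1 + 1)) = Nat.eqb i x.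
Proof.
  intros Hx Hi Hv H. destruct (Nat.eqb_spec i x) as [->|Hne].
  - apply Rleb_true. rewrite pdist_refl. lra.
  - apply Rleb_false. pose proof (pt_sep i x Hi Hx Hne) as Hp. specialize (H i Hi Hp). lra.
Qed.

Lemma det_output_radius T m sel x s :
  env s -> ia s 19 0 = x -> (x < n)%nat -> ra s 2 x = rad T m x ->
  ia s 16 0 = (k * count (heavy T m) sel)%nat ->
  ia s 20 0 = count (fun i => Rltb (pdist i x) (rad T m x)) (seq 0 n) ->
  (let v := ra s 5 0 in 0 <= v /\ (0 < rad T m x -> v < rad T m x) /\
     forall i, (i < n)%nat -> pdist i x < rad T m x -> pdist i x <= v) ->
  (let v := ra s 6 0 in 0 < v /\ forall i, (i < n)%nat -> 0 < pdist i x -> v <= pdist i x) ->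
  det output_radius s 4 (fun s' => keep [16]%nat [7]%nat s s' /\
    ia s' 16 0 = (k * count (heavy T m) (sel ++ [x]))%nat /\
    0 < ra s' 7 0 /\
    forall i, (i < n)%nat -> Rleb (pdist i x) (ra s' 7 0) = cov T m x i).
Proof.
  intros He Hx Hxn Hr H16 H20 (V1 & V2 & V3) (W1 & W2). unfold output_radius.
  rewrite count_app, count_cons.
  change (count (heavy T m) []) with 0%nat.
  assert (Eh : heavy T m x = (Rltb 0 (rad T m x) && Nat.ltb k (ia s 20 0))%bool)
    by (rewrite H20; reflexivity).
  assert (El : light T m x = (Rltb 0 (rad T m x) && Nat.leb (ia s 20 0) k)%bool)
    by (rewrite H20; reflexivity).
  change (Rltb 0 (rad T m x)) with (negb (Rleb (rad T m x) 0)) in Eh, El.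
  rewrite Eh. unfold covers. rewrite El.
  apply det_branch. unfold chosen_radius. cbn [beval reval ieval var]. rewrite Hx, Hr.
  destruct (Rleb (rad T m x) 0) eqn:E1.
  - apply det_last_setR; [lra|]. unfold two. reduce. cbn [negb andb]. split; [keep_tac|].
    split; [rewrite H16; lia|]. split; [lra|]. intros i Hi. apply Rleb_tiny; auto.
  - apply Rleb_false in E1. cbn [negb andb]. apply det_branch. cbn [beval ieval var].
    rewrite (env_k _ He). rewrite (Nat.ltb_antisym (ia s 20 0) k).
    destruct (Nat.leb (ia s 20 0) k) eqn:E2.
    + apply det_last_setR; [lra|]. unfold two. reduce. rewrite Hx, Hr. cbn [negb]. split; [keep_tac|].
      specialize (V2 E1). split; [rewrite H16; lia|]. split; [lra|]. intros i Hi.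
      destruct (Rltb (pdist i x) (rad T m x)) eqn:E3.
      * apply Rltb_true in E3. apply Rleb_true. specialize (V3 i Hi E3). lra.
      * apply Rltb_false in E3. apply Rleb_false. lra.
    + unfold tiny_radius. apply det_seq_setR. apply det_last_setI; [lra|]. unfold two. reduce.
      cbn [negb]. split; [keep_tac|]. rewrite (env_k _ He).
      split; [rewrite H16; lia|]. split; [lra|]. intros i Hi. apply Rleb_tiny; auto.
Qed.

Lemma ieval_times c e s : ieval (times c e) s = (c * ieval e s)%nat.
Proof. induction c as [|c IH]; simpl; [reflexivity|]. rewrite IH. reflexivity. Qed.

Lemma det_write_center x q l : forall s,
  ia s 19 0 = x -> ia s 15 0 = q -> (q * (d + 1) + d < beta)%nat ->
  (forall j, In j l -> (j < d)%nat) ->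
  det (block (map (fun j => SetLow (IPlus (times (d + 1) (var 15)) (IC j)) (RA (10 + j) (var 19))) l)) s
    (INR (length l)) (fun s' => ia s' = ia s /\ ra s' = ra s /\
      (forall j, In j l -> low s' (q * (d + 1) + j) = ra s (10 + j) x) /\
      (forall a, (forall j, In j l -> a <> q * (d + 1) + j)%nat -> low s' a = low s a)).
Proof.
  induction l as [|j l IH]; intros s Hx Hq Hb Hl.
  - apply det_last_skip; [simpl; lra|]. split; [reflexivity|]. split; [reflexivity|]. split; [simpl; tauto|auto].
  - cbn [map block fold_right]. change (length (j :: l)) with (S (length l)). rewrite S_INR.
    assert (Ea : ieval (IPlus (times (d + 1) (var 15)) (IC j)) s = (q * (d + 1) + j)%nat).
    { cbn [ieval]. rewrite ieval_times. cbn [ieval var]. rewrite Hq. lia. }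
    assert (Hj : (j < d)%nat) by (apply Hl; simpl; auto).
    set (a0 := (q * (d + 1) + j)%nat) in *.
    set (s1 := setLow s a0 (ra s (10 + j) x)).
    eapply det_weaken; [apply det_seq with (Q1 := fun s' => s' = s1); [|intros s' ->; apply (IH s1)]|..].
    + apply det_setLow; [rewrite Ea; unfold a0; lia|]. rewrite Ea. cbn [reval ieval var]. rewrite Hx. reflexivity.
    + exact Hx.
    + exact Hq.
    + exact Hb.
    + intros; apply Hl; simpl; auto.
    + lra.
    + intros s' (E1 & E2 & E3 & E4). split; [exact E1|]. split; [exact E2|]. split.
      * intros j' Hj'. destruct (in_dec Nat.eq_dec j' l) as [Hin|Hnin]; [apply E3; exact Hin|].
        destruct Hj' as [<-|Hj']; [|contradiction].
        fold a0. rewrite E4.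
        -- unfold s1, setLow. cbn [low]. apply updR_same.
        -- intros j' Hj' E. apply Hnin. replace j with j' by (unfold a0 in E; lia). exact Hj'.
      * intros a Ha. rewrite E4 by (intros j' Hj'; apply Ha; simpl; auto).
        unfold s1, setLow. cbn [low]. apply updR_other. apply Ha. simpl. auto.
Qed.

Lemma cov_refl T m x : cov T m x x = true.
Proof. apply covers_refl. exact pdist_refl. Qed.

Lemma det_mark_ball s x v :
  env s -> ia s 19 0 = x -> (x < n)%nat -> ra s 7 0 = v ->
  det (mark_ball d) s (INR n * 4 + 2) (fun s' => keep [3; 13]%nat [] s s' /\
    forall i, (i < n)%nat -> ia s' 13 i = if Rleb (pdist i x) v then 1%nat else ia s 13 i).
Proof.
  intros He Hx Hxn Hv. unfold mark_ball.
  eapply det_le; [|apply Req_le; instantiate (1 := INR n * (2 + 2) + 2); lra].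
  apply det_for with (I := fun j s' => ia s' 3 0 = j /\ keep [3; 13]%nat [] s s' /\
    forall i, (i < n)%nat -> ia s' 13 i =
      if (Nat.ltb i j && Rleb (pdist i x) v)%bool then 1%nat else ia s 13 i).
  - intros j s' _ (E & Hk & _). split; [exact E|]. cbn [ieval var]. use_keep Hk. apply He.
  - intros j s' Hj (E & Hk & Hs).
    assert (He' : env s') by (eapply env_keep; [exact He|exact Hk|index_tac|index_tac]).
    assert (Hx' : ia s' 19 0 = x) by (use_keep Hk; exact Hx).
    assert (Hv' : ra s' 7 0 = v) by (rewrite (proj1 (proj2 Hk)) by (simpl; lia); exact Hv).
    apply det_branch. cbn [beval].
    rewrite (reval_distance s' (var 3) (var 19) j x He' E Hx' Hj Hxn).
    cbn [reval rvar ieval]. rewrite Hv'.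
    destruct (Rleb (pdist j x) v) eqn:E1.
    + apply det_last_setI; [lra|]. reduce. rewrite E. split; [reflexivity|]. split; [reflexivity|].
      split; [keep_tac|]. intros i Hi.
      destruct (Nat.eqb_spec i j) as [->|Hne].
      * rewrite E1. replace (Nat.ltb j (S j)) with true by (symmetry; apply Nat.ltb_lt; lia). reflexivity.
      * rewrite Hs by exact Hi. replace (Nat.ltb i (S j)) with (Nat.ltb i j); [reflexivity|].
        destruct (Nat.ltb_spec i j); destruct (Nat.ltb_spec i (S j)); lia.
    + apply det_last_skip; [lra|]. reduce. split; [exact E|]. split; [reflexivity|].
      split; [keep_tac|]. intros i Hi. rewrite Hs by exact Hi.
      destruct (Nat.eq_dec i j) as [->|Hne]; [rewrite E1, !andb_false_r; reflexivity|].
      replace (Nat.ltb i (S j)) with (Nat.ltb i j); [reflexivity|].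
      destruct (Nat.ltb_spec i j); destruct (Nat.ltb_spec i (S j)); lia.
  - reduce. split; [reflexivity|]. split; [keep_tac|]. intros i Hi. reflexivity.
  - intros s' (_ & Hk & Hs). split; [exact Hk|]. intros i Hi. rewrite Hs by exact Hi.
    replace (Nat.ltb i n) with true by (symmetry; apply Nat.ltb_lt; exact Hi). reflexivity.
Qed.

Lemma det_output_ball s x q :
  env s -> ia s 19 0 = x -> (x < n)%nat -> ia s 15 0 = q -> (q < n)%nat ->
  det (output_ball d) s (INR d + 2) (fun s' =>
    (forall a i, a <> 15%nat -> ia s' a i = ia s a i) /\ ra s' = ra s /\ ia s' 15 0 = S q /\
    (forall j, (j < d)%nat -> low s' (q * (d + 1) + j) = nth j (pt x) 0) /\
    low s' (q * (d + 1) + d) = ra s 7 0 /\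
    (forall a, (a < q * (d + 1))%nat -> low s' a = low s a)).
Proof.
  intros He Hx Hxn Hq Hqn. unfold output_ball.
  (* A slot has d + 1 registers, and q < n keeps it below the arrays. *)
  assert (Hb : (q * (d + 1) + d < beta)%nat) by nia.
  eapply det_seq_then; [apply det_write_center with (x := x) (q := q); auto|].
  - intros j Hj. apply in_seq in Hj. lia.
  - rewrite length_seq. intros s1 (E1 & E2 & E3 & E4).
    assert (Ea : ieval (IPlus (times (d + 1) (var 15)) (IC d)) s1 = (q * (d + 1) + d)%nat).
    { cbn [ieval]. rewrite ieval_times. cbn [ieval var]. rewrite E1, Hq. lia. }
    eapply det_seq_then with (t1 := 1) (Q1 := fun s2 => s2 = setLow s1 (q * (d + 1) + d) (ra s 7 0)).
    + apply det_setLow; [rewrite Ea; exact Hb|]. rewrite Ea. cbn [reval rvar ieval]. rewrite E2. reflexivity.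
    + intros s2 ->. apply det_last_setI; [lra|]. reduce. rewrite E1.
      split; [|split; [exact E2|split; [rewrite Hq; lia|split; [|split]]]].
      * intros a i Ha. rewrite upd2_other by exact Ha. reflexivity.
      * intros j Hj. rewrite updR_other by lia. rewrite E3 by (apply in_seq; lia).
        apply He; assumption.
      * apply updR_same.
      * intros a Ha. rewrite updR_other by lia. apply E4. intros j Hj. lia.
Qed.

Lemma count_seq_all f m : (forall i, (i < m)%nat -> f i = false) -> count f (seq 0 m) = 0%nat.
Proof.
  intros H. unfold count. replace (filter f (seq 0 m)) with (@nil nat); [reflexivity|].
  symmetry. assert (Hin : forall i, In i (filter f (seq 0 m)) -> False).
  { intros i Hi. apply filter_In in Hi. destruct Hi as [Hi E]. apply in_seq in Hi.
    rewrite H in E by lia. discriminate. }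
  destruct (filter f (seq 0 m)) as [|i l]; [reflexivity|]. exfalso. apply (Hin i). simpl. auto.
Qed.

Definition idle : nat -> bool := fun _ => false.

Lemma det_restart s :
  env s ->
  det restart s (INR n * 4 + 7) (fun s' =>
    config (seq 0 n) (k + 1) [] idle s' /\ ia s' 18 0 = 0%nat).
Proof.
  intros He. unfold restart.
  eapply det_seq_then with (t1 := INR n * (2 + 2) + 2).
  - apply det_for with (I := fun j s' => ia s' 3 0 = j /\ keep [3; 11; 13]%nat [] s s' /\
      forall i, (i < j)%nat -> ia s' 11 i = i /\ ia s' 13 i = 0%nat).
    + intros j s' _ (E & Hk & _). split; [exact E|]. cbn [ieval var]. use_keep Hk. apply He.
    + intros j s' Hj (E & Hk & Hs). apply det_seq_setI. apply det_last_setI; [lra|].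
      reduce. rewrite E. split; [reflexivity|]. split; [reflexivity|]. split; [keep_tac|].
      intros i Hi. destruct (Nat.eqb_spec i j) as [->|Hne]; [auto|]. apply Hs. lia.
    + reduce. split; [reflexivity|]. split; [keep_tac|]. intros; lia.
    + intros s' H. exact H.
  - intros s' (_ & Hk & Hs). cbv beta.
    repeat (apply det_seq_setI). apply det_last_setI; [lra|].
    assert (He' : env s') by (eapply env_keep; [exact He|exact Hk|index_tac|index_tac]).
    split; [|reflexivity]. constructor; try reflexivity.
    + eapply env_keep with (A := [12; 14; 15; 16; 18]%nat) (B := []); [exact He'|keep_tac|index_tac|index_tac].
    + constructor; reduce.
      * rewrite length_seq. apply He'.
      * intros t Ht. rewrite length_seq in Ht. rewrite seq_nth by exact Ht. apply Hs. exact Ht.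
      * rewrite (env_k _ He'). reflexivity.
    + intros i Hi. reduce. simpl. apply Hs. exact Hi.
    + reduce. unfold count. simpl. lia.
    + unfold count. simpl. lia.
    + constructor.
    + simpl. tauto.
    + simpl. intros; lia.
Qed.

Lemma det_process T m sel P s x :
  config T m sel P s -> radii_ok T m P s -> ia s 19 0 = x -> is_pick n (rad T m) P x ->
  det (process d) s (INR n * 14 + INR d + 20) (fun s' =>
    (config T m (sel ++ [x]) (residue (cov T m) P x) s' /\
     radii_ok T m (residue (cov T m) P x) s' /\ ia s' 18 0 = ia s 18 0) \/
    (config (seq 0 n) (k + 1) [] idle s' /\ ia s' 18 0 = 0%nat /\
     (n < k * count (heavy T m) (sel ++ [x]))%nat)).
Proof.
  intros Hc Hr Hx (Hxn & Px & _). unfold process.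
  pose proof (config_env _ _ _ _ _ Hc) as He.
  assert (Hrx : ra s 2 x = rad T m x) by (apply Hr; assumption).
  eapply det_seq_then; [apply det_measure_ball; eassumption|].
  intros s1 (K1 & H20 & H5 & H6).
  assert (C1 : config T m sel P s1) by (eapply config_keep; [exact Hc|exact K1|index_tac|index_tac]).
  pose proof (config_env _ _ _ _ _ C1) as He1.
  assert (R2 : forall i, ra s1 2 i = ra s 2 i) by (intros i; apply K1; simpl; lia).
  assert (X1 : ia s1 19 0 = x) by (use_keep K1; exact Hx).
  eapply det_seq_then; [apply det_output_radius with (T := T) (m := m) (sel := sel) (x := x); auto|].
  { rewrite R2. exact Hrx. }
  { apply (config_heavy _ _ _ _ _ C1). }
  intros s2 (K2 & H16 & Hpos & Hcov).
  assert (He2 : env s2) by (eapply env_keep; [exact He1|exact K2|index_tac|index_tac]).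
  assert (X2 : ia s2 19 0 = x) by (use_keep K2; exact X1).
  apply det_branch. cbn [beval ieval var]. rewrite H16, (env_n _ He2).
  destruct (Nat.leb_spec (k * count (heavy T m) (sel ++ [x])) n) as [Hle|Hlt].
  (* An active point is uncovered, hence no earlier center. So centers stay distinct, and fewer than
     n slots are occupied. *)
  - assert (Hfx : existsb (fun x0 => cov T m x0 x) sel = false) by (apply (config_fresh _ _ _ _ _ Hc); assumption).
    assert (Hnew : ~ In x sel).
    { intros Hin. assert (E : existsb (fun x0 => cov T m x0 x) sel = true); [|congruence].
      apply existsb_exists. exists x. split; [exact Hin|apply cov_refl]. }
    assert (Hnd : NoDup (sel ++ [x])).
    { apply NoDup_app; [apply (config_NoDup _ _ _ _ _ Hc)|constructor; [simpl; tauto|constructor]|].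
      intros y Hy [<-|[]]. contradiction. }
    assert (Hin : forall y, In y (sel ++ [x]) -> (y < n)%nat).
    { intros y Hy. apply in_app_iff in Hy. destruct Hy as [Hy|[<-|[]]]; [|exact Hxn].
      apply (config_in _ _ _ _ _ Hc). exact Hy. }
    assert (Hlen : (length sel < n)%nat).
    { assert (H : (length (sel ++ [x]) <= length (seq 0 n))%nat).
      { apply NoDup_incl_length; [exact Hnd|]. intros y Hy. apply in_seq. specialize (Hin y Hy). lia. }
      rewrite length_app, length_seq in H. simpl in H. lia. }
    eapply det_seq_then; [apply det_output_ball with (x := x) (q := length sel); auto|].
    { use_keep K2. apply (config_count _ _ _ _ _ C1). }
    intros s3 (I3 & R3 & Q3 & L1 & L2 & L3).
    assert (He3 : env s3).
    { destruct He2 as [A1 A2 A3 A4]. constructor; rewrite ?I3, ?R3 by lia; auto. }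
    eapply det_weaken; [apply det_mark_ball with (x := x) (v := ra s2 7 0); auto|lra|].
    + rewrite I3 by lia. exact X2.
    + rewrite R3. reflexivity.
    + intros s4 (K4 & M4). left.
      assert (I4 : forall a i, a <> 3%nat -> a <> 13%nat -> a <> 15%nat -> a <> 16%nat -> a <> 20%nat ->
        ia s4 a i = ia s a i).
      { intros a i H1 H2 H3 H4 H7. use_keep K4. rewrite I3 by exact H3. use_keep K2. use_keep K1. reflexivity. }
      assert (L4 : forall i, low s4 i = low s3 i) by (intros i; apply K4).
      split; [|split].
      * constructor.
        -- eapply env_keep; [exact He3|exact K4|index_tac|index_tac].
        -- destruct (config_table _ _ _ _ _ Hc) as [A1 A2 A3].
           constructor; [|intros t Ht|]; rewrite I4 by lia; auto.
        -- intros i Hi. rewrite M4 by exact Hi. rewrite Hcov by exact Hi.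
           rewrite existsb_app. cbn [existsb]. rewrite orb_false_r.
           rewrite I3 by lia. use_keep K2. use_keep K1. rewrite (config_status _ _ _ _ _ Hc) by exact Hi.
           unfold residue.
           destruct (existsb (fun x0 => cov T m x0 i) sel) eqn:Ee; destruct (cov T m x i) eqn:Ec; simpl;
             rewrite ?andb_true_r; reflexivity.
        -- intros i Hi Pi. unfold residue in Pi. apply andb_true_iff in Pi. destruct Pi as [Pi Ci].
           apply negb_true_iff in Ci. rewrite existsb_app. cbn [existsb]. rewrite Ci, orb_false_r.
           rewrite (config_fresh _ _ _ _ _ Hc) by assumption. reflexivity.
        -- use_keep K4. rewrite Q3, length_app. simpl. lia.
        -- use_keep K4. rewrite I3 by lia. exact H16.
        -- exact Hle.
        -- exact Hnd.
        -- exact Hin.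
        -- intros idx Hidx. rewrite length_app in Hidx. simpl in Hidx. unfold ball_ok.
           destruct (Nat.eq_dec idx (length sel)) as [->|Hne].
           ++ rewrite nth_middle. rewrite L4, L2. split; [|split; [exact Hpos|exact Hcov]].
              intros j Hj. rewrite L4. apply L1. exact Hj.
           ++ rewrite app_nth1 by lia. destruct (config_balls _ _ _ _ _ Hc idx) as (B1 & B2 & B3); [lia|].
              assert (L0 : forall a, (a < length sel * (d + 1))%nat -> low s4 a = low s a).
              { intros a Ha. rewrite L4, L3 by exact Ha. rewrite (proj2 (proj2 K2)). apply K1. }
              rewrite L0 by nia. split; [|split; [exact B2|exact B3]].
              intros j Hj. rewrite L0 by nia. apply B1. exact Hj.
      * intros i Hi Pi. unfold residue in Pi. apply andb_true_iff in Pi. destruct Pi as [Pi _].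
        rewrite (proj1 (proj2 K4)) by (simpl; lia). rewrite R3.
        rewrite (proj1 (proj2 K2)) by (simpl; lia). rewrite R2. apply Hr; assumption.
      * apply I4; lia.
  - eapply det_weaken; [apply det_restart; exact He2|pose proof (pos_INR d); lra|].
    intros s3 (C3 & E3). right. split; [exact C3|]. split; [exact E3|exact Hlt].
Qed.

(** One round per pick and a last scan that finds nothing. If the loop aborts, the second disjunct
    records that the full list has too many heavy balls, which an accurate table excludes. *)
Lemma det_greedy_loop T m P l : greedy n (rad T m) (cov T m) P l -> forall sel s,
  config T m sel P s -> radii_ok T m P s ->
  det (greedy_loop d) s ((INR (length l) + 1) * (INR n * 20 + INR d + 26) + 2) (fun s' =>
    config T m (sel ++ l) idle s' \/
    (config (seq 0 n) (k + 1) [] idle s' /\ (n < k * count (heavy T m) (sel ++ l))%nat)).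
Proof.
  intros Hg sel s Hc Hr. unfold greedy_loop. apply det_seq_setI.
  set (u := INR n * 20 + INR d + 26).
  assert (Hu : 26 <= u) by (unfold u; pose proof (pos_INR n); pose proof (pos_INR d); lra).
  cbn [ieval]. set (s0 := setI s 18 0 1).
  assert (Hc0 : config T m sel P s0).
  { eapply config_keep with (A := [18]%nat) (B := []); [exact Hc|unfold s0; keep_tac|index_tac|index_tac]. }
  assert (Hr0 : radii_ok T m P s0) by exact Hr.
  assert (Hf0 : ia s0 18 0 = 1%nat) by reflexivity.
  clearbody s0. clear Hc Hr s.
  eapply det_le with (t := (INR (length l) + 1) * u + 1); [|lra].
  revert sel s0 Hc0 Hr0 Hf0. induction Hg as [P HP|P x l Hx Hg IH]; intros sel s Hc Hr Hf.
  - eapply det_le; [apply det_while_true with (t1 := u - 1) (t2 := 1) (Q1 := fun s' =>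
      config T m sel P s' /\ ia s' 18 0 = 0%nat)|..].
    + cbn [beval ieval var]. rewrite Hf. reflexivity.
    + eapply det_seq_then; [apply det_scan with (T := T) (m := m) (sel := sel) (P := P); assumption|].
      intros s1 (K1 & [[E1 _]|(A1 & A2 & _)]); [|rewrite HP in A2 by exact A1; discriminate].
      assert (C1 : config T m sel P s1) by (eapply config_keep; [exact Hc|exact K1|index_tac|index_tac]).
      apply det_branch. cbn [beval ieval var]. rewrite E1, (config_n _ _ _ _ _ C1), Nat.leb_refl.
      apply det_last_setI; [unfold u; pose proof (pos_INR n); pose proof (pos_INR d); lra|].
      split; [|reflexivity].
      eapply config_keep with (A := [18]%nat) (B := []); [exact C1|keep_tac|index_tac|index_tac].
    + intros s2 (C2 & E2). apply det_while_false.
      * cbn [beval ieval var]. rewrite E2. reflexivity.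
      * left. rewrite app_nil_r.
        destruct C2 as [B1 B2 B3 B4 B5 B6 B7 B8 B9 B10]. constructor; auto.
        -- intros i Hi. rewrite B3, HP by exact Hi. reflexivity.
        -- intros i Hi. discriminate.
    + simpl. lra.
  - eapply det_le; [apply det_while_true with (t1 := u - 1) (t2 := (INR (length l) + 1) * u + 1) (Q1 := fun s' =>
    (config T m (sel ++ [x]) (residue (cov T m) P x) s' /\
     radii_ok T m (residue (cov T m) P x) s' /\ ia s' 18 0 = 1%nat) \/
    (config (seq 0 n) (k + 1) [] idle s' /\ ia s' 18 0 = 0%nat /\
     (n < k * count (heavy T m) (sel ++ [x]))%nat))|..].
    + cbn [beval ieval var]. rewrite Hf. reflexivity.
    + eapply det_seq_then; [apply det_scan with (T := T) (m := m) (sel := sel) (P := P); assumption|].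
      intros s1 (K1 & Hpk).
      assert (C1 : config T m sel P s1) by (eapply config_keep; [exact Hc|exact K1|index_tac|index_tac]).
      destruct Hpk as [[E1 Hnone]|Hpk].
      { destruct Hx as (A1 & A2 & _). rewrite Hnone in A2 by exact A1. discriminate. }
      assert (Ex : ia s1 19 0 = x) by (eapply is_pick_unique; eassumption).
      apply det_branch. cbn [beval ieval var]. rewrite Ex, (config_n _ _ _ _ _ C1).
      replace (Nat.leb n x) with false by (symmetry; apply Nat.leb_gt; apply Hx).
      eapply det_weaken; [apply det_process with (T := T) (m := m) (sel := sel) (P := P) (x := x); auto| |].
      * intros i Hi Pi. rewrite (proj1 (proj2 K1)) by (simpl; lia). apply Hr; assumption.
      * unfold u. lra.
      * intros s2 [(C2 & R2 & F2)|H2]; [left|right; exact H2].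
        split; [exact C2|]. split; [exact R2|]. rewrite F2. use_keep K1. exact Hf.
    + intros s2 [(C2 & R2 & F2)|(C2 & F2 & H2)].
      * eapply det_weaken; [apply IH; eassumption|apply Rle_refl|].
        intros s3. rewrite <- app_assoc. simpl. tauto.
      * eapply det_le; [apply det_while_false|].
        -- cbn [beval ieval var]. rewrite F2. reflexivity.
        (* The abort was caused by a prefix of the list; the picks after it can only add heavy
           balls. *)
        -- right. split; [exact C2|]. change (x :: l) with ([x] ++ l). rewrite app_assoc, (count_app _ _ l). nia.
        -- rewrite <- (Rplus_0_l 1) at 1. apply Rplus_le_compat_r, Rmult_le_pos; [|lra].
           pose proof (pos_INR (length l)). lra.
    + change (length (x :: l)) with (S (length l)). rewrite S_INR. lra.
Qed.

Lemma det_activate T m sel s :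
  config T m sel idle s ->
  det activate s (INR n * 5 + 3) (fun s' =>
    config T m sel (uncovered (cov T m) sel) s' /\
    ia s' 17 0 = if Nat.eqb (count (uncovered (cov T m) sel) (seq 0 n)) 0 then 0%nat else 1%nat).
Proof.
  intros Hc. unfold activate. apply det_seq_setI.
  set (un := uncovered (cov T m) sel).
  eapply det_le; [|apply Req_le; instantiate (1 := INR n * (3 + 2) + 2); lra].
  apply det_for with (I := fun j s' => ia s' 3 0 = j /\ keep [3; 13; 17]%nat [] s s' /\
    (forall i, (i < n)%nat -> ia s' 13 i = if (Nat.ltb i j && un i)%bool then 2%nat else ia s 13 i) /\
    ia s' 17 0 = if Nat.eqb (count un (seq 0 j)) 0 then 0%nat else 1%nat).
  - intros j s' _ (E & Hk & _). split; [exact E|]. cbn [ieval var]. use_keep Hk. eapply config_n, Hc.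
  - intros j s' Hj (E & Hk & Hs & H17).
    assert (Hsj : ia s' 13 j = if un j then 0%nat else 1%nat).
    { rewrite Hs by exact Hj. rewrite Nat.ltb_irrefl. cbn [andb].
      rewrite (config_status _ _ _ _ _ Hc) by exact Hj. unfold un, uncovered, idle.
      destruct (existsb _ sel); reflexivity. }
    apply det_branch. cbn [beval ieval var]. rewrite E, Hsj.
    rewrite seq_S, count_app, count_cons. cbn [plus].
    destruct (un j) eqn:Eu; cbn [Nat.leb].
    + apply det_seq_setI. apply det_last_setI; [lra|]. reduce. rewrite E.
      split; [reflexivity|]. split; [reflexivity|]. split; [keep_tac|]. split.
      * intros i Hi. destruct (Nat.eqb_spec i j) as [->|Hne].
        -- rewrite Eu. replace (Nat.ltb j (S j)) with true by (symmetry; apply Nat.ltb_lt; lia). reflexivity.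
        -- rewrite Hs by exact Hi. replace (Nat.ltb i (S j)) with (Nat.ltb i j); [reflexivity|].
           destruct (Nat.ltb_spec i j); destruct (Nat.ltb_spec i (S j)); lia.
      * match goal with |- _ = (if Nat.eqb ?a 0 then _ else _) => destruct a eqn:Ea end; [lia|reflexivity].
    + apply det_last_skip; [lra|]. reduce.
      split; [exact E|]. split; [reflexivity|]. split; [keep_tac|]. split.
      * intros i Hi. rewrite Hs by exact Hi.
        destruct (Nat.eq_dec i j) as [->|Hne]; [rewrite Eu, !andb_false_r; reflexivity|].
        replace (Nat.ltb i (S j)) with (Nat.ltb i j); [reflexivity|].
        destruct (Nat.ltb_spec i j); destruct (Nat.ltb_spec i (S j)); lia.
      * rewrite H17. change (count un []) with 0%nat. rewrite !Nat.add_0_r. reflexivity.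
  - reduce. split; [reflexivity|]. split; [keep_tac|]. split; [|reflexivity]. intros i Hi. reflexivity.
  - intros s' (_ & Hk & Hs & H17). split; [|exact H17].
    destruct Hc as [B1 B2 B3 B4 B5 B6 B7 B8 B9 B10].
    assert (Hk0 : forall a i, a <> 3%nat -> a <> 13%nat -> a <> 17%nat -> ia s' a i = ia s a i).
    { intros a i H1 H2 H3. apply Hk. simpl. lia. }
    constructor; auto.
    + eapply env_keep; [exact B1|exact Hk|index_tac|index_tac].
    + eapply table_keep; [exact B2|exact Hk|index_tac].
    + intros i Hi. rewrite Hs by exact Hi. rewrite B3 by exact Hi.
      replace (Nat.ltb i n) with true by (symmetry; apply Nat.ltb_lt; exact Hi).
      cbn [andb]. fold un. unfold un, uncovered, idle. destruct (existsb _ sel); reflexivity.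
    + intros i Hi Ui. unfold uncovered in Ui. apply negb_true_iff in Ui. exact Ui.
    + rewrite Hk0 by lia. exact B5.
    + rewrite Hk0 by lia. exact B6.
    + intros idx Hidx. destruct (B10 idx Hidx) as (A1 & A2 & A3). unfold ball_ok.
      assert (Hl : forall a, low s' a = low s a) by apply Hk.
      rewrite Hl. split; [|split; [exact A2|exact A3]]. intros j Hj. rewrite Hl. auto.
Qed.

(** * Number of balls and cost of the phases *)

Hypothesis k_pos : (1 <= k)%nat.
Hypothesis k_le_n : (k <= n)%nat.

Notation M := (multiplicity d).

(* The second condition bounds the number of disjoint groups of [m] elements of
   [T] by a multiple of [n / k]. *)
Definition dense (T : list nat) (m : nat) : Prop :=
  table_ok T m /\ (k * length T <= 17 * n * m)%nat.

(** Concerns all n balls, chosen or not. As the picks of all phases are distinct, an accurate table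
    never leads to a restart. *)
Definition accurate (T : list nat) (m : nat) : Prop :=
  (k * count (heavy T m) (seq 0 n) <= n)%nat.

Lemma pdist_multiplicity (l : list nat) (r : nat -> R) p : NoDup l -> (forall x, In x l -> (x < n)%nat) ->
  (p < n)%nat -> (forall x, In x l -> pdist x p <= r x) ->
  (forall x y, In x l -> In y l -> x <> y -> r x <= pdist x y) -> (length l <= M)%nat.
Proof.
  intros Hnd Hin Hp Hr Hsep. apply ball_multiplicity with (pt := pt) (r := r) (p := pt p); auto.
  intros x y Hx Hy Hxy. split; [apply pt_sep; auto|apply Hsep; auto].
Qed.

(** Multiply the packing bound by k, use k <= n for the summand m and density for |T|, then cancel
    m. *)
Lemma greedy_good_bound T m P l : dense T m -> greedy n (rad T m) (cov T m) P l ->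
  (k * count (fun x => negb (heavy T m x)) l <= (17 * M + 1) * n)%nat.
Proof.
  intros [[H1 H2] H3] Hg.
  pose proof (greedy_good_count n k pdist big pdist_sym pdist_nonneg pdist_refl pt_big big_pos T m H2
    M pdist_multiplicity P l Hg H1) as H.
  set (c := count _ l) in *.
  assert (Hm : (k * m * c <= k * m + 17 * M * n * m)%nat) by nia.
  assert (Hm' : (m * (k * c) <= m * ((17 * M + 1) * n))%nat) by nia.
  apply Nat.mul_le_mono_pos_l in Hm'; lia.
Qed.

Lemma count_negb (f : nat -> bool) l : (count f l + count (fun x => negb (f x)) l = length l)%nat.
Proof. symmetry. apply length_filter_split. Qed.

Lemma count_sub (f : nat -> bool) l : NoDup l -> (forall x, In x l -> (x < n)%nat) ->
  (count f l <= count f (seq 0 n))%nat.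
Proof.
  intros Hnd Hin. apply NoDup_incl_length; [apply NoDup_filter; exact Hnd|].
  intros x Hx. apply filter_In in Hx. apply filter_In. split; [|apply Hx].
  apply in_seq. specialize (Hin x (proj1 Hx)). lia.
Qed.

Lemma greedy_length_bound T m P l : dense T m -> accurate T m -> greedy n (rad T m) (cov T m) P l ->
  (k * length l <= (17 * M + 2) * n)%nat.
Proof.
  intros Hd Ha Hg. pose proof (greedy_good_bound T m P l Hd Hg) as H.
  assert (Hh : (count (heavy T m) l <= count (heavy T m) (seq 0 n))%nat).
  { apply count_sub; [eapply greedy_NoDup; [apply cov_refl|exact Hg]|].
    intros x Hx. eapply greedy_in; eassumption. }
  unfold accurate in Ha. rewrite <- (count_negb (heavy T m) l). nia.
Qed.

(** 34 M + 3 is 2 (17 M + 1), for the balls of two greedy lists that are not heavy, plus 1 for the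
    at most n / k heavy ones. *)
Definition finished (s : store) : Prop := exists T m sel,
  config T m sel idle s /\ (forall i, (i < n)%nat -> existsb (fun x => cov T m x i) sel = true) /\
  (k * length sel <= (34 * M + 3) * n)%nat.

Definition unit_cost (T : list nat) (m : nat) : R := INR m * (INR (length T) * 9 + 10) + 5.

(** For [a] active points, whose radii are computed, and [l] picks, each with passes over all n
    points. *)
Definition phase_cost (T : list nat) (m a l : nat) : R :=
  INR a * unit_cost T m + (INR l + 1) * (INR n * 20 + INR d + 26) + INR n * 8 + 7.

Definition flagged (T : list nat) (m : nat) (sel : list nat) (s : store) : Prop :=
  config T m sel (uncovered (cov T m) sel) s /\
  ia s 17 0 = if Nat.eqb (count (uncovered (cov T m) sel) (seq 0 n)) 0 then 0%nat else 1%nat.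

Definition phase : cmd := Seq (active_radii d) (Seq (greedy_loop d) activate).

Lemma det_phase T m sel P l s :
  config T m sel P s -> table_ok T m -> greedy n (rad T m) (cov T m) P l ->
  det phase s (phase_cost T m (count P (seq 0 n)) (length l)) (fun s' =>
    flagged T m (sel ++ l) s' \/
    (flagged (seq 0 n) (k + 1) [] s' /\ (n < k * count (heavy T m) (sel ++ l))%nat)).
Proof.
  intros Hc Hok Hg. unfold phase, phase_cost, unit_cost.
  eapply det_seq_then; [apply det_active_radii with (T := T) (m := m) (sel := sel) (P := P); assumption|].
  intros s1 [C1 R1].
  eapply det_seq_then; [apply det_greedy_loop with (1 := Hg) (sel := sel); assumption|].
  intros s2 [C2|[C2 H2]].
  - eapply det_weaken; [apply det_activate with (T := T) (m := m) (sel := sel ++ l); exact C2|lra|].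
    intros s3 H3. left. exact H3.
  - eapply det_weaken; [apply det_activate with (1 := C2)|lra|].
    intros s3 H3. right. split; [exact H3|exact H2].
Qed.

Lemma flagged_done T m sel s : flagged T m sel s ->
  (forall i, (i < n)%nat -> existsb (fun x => cov T m x i) sel = true) ->
  ia s 17 0 = 0%nat /\ config T m sel idle s.
Proof.
  intros [Hc H17] Hall.
  assert (Hu : forall i, (i < n)%nat -> uncovered (cov T m) sel i = false).
  { intros i Hi. unfold uncovered. rewrite Hall by exact Hi. reflexivity. }
  rewrite (count_seq_all _ n Hu) in H17. split; [exact H17|].
  destruct Hc as [B1 B2 B3 B4 B5 B6 B7 B8 B9 B10]. constructor; auto.
  - intros i Hi. rewrite B3, Hu by exact Hi. reflexivity.
  - intros i Hi E. discriminate.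
Qed.

Lemma uncovered_cov T m sel i : uncovered (cov T m) sel i = false ->
  existsb (fun x => cov T m x i) sel = true.
Proof. unfold uncovered. apply negb_false_iff. Qed.

(** A greedy list for all uncovered points completes the cover, and accuracy rules out a restart; so
    the loop ends after at most one more phase. *)
Lemma det_last_phase T m sel l s :
  flagged T m sel s -> table_ok T m -> accurate T m ->
  greedy n (rad T m) (cov T m) (uncovered (cov T m) sel) l ->
  det (phases d) s (phase_cost T m (count (uncovered (cov T m) sel) (seq 0 n)) (length l) + 2) (fun s' =>
    config T m (sel ++ l) idle s' /\
    forall i, (i < n)%nat -> existsb (fun x => cov T m x i) (sel ++ l) = true).
Proof.
  intros Hf Hok Hacc Hg. unfold phases. fold phase.
  assert (Hpc : 0 <= phase_cost T m (count (uncovered (cov T m) sel) (seq 0 n)) (length l)).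
  { unfold phase_cost, unit_cost.
    pose proof (pos_INR (count (uncovered (cov T m) sel) (seq 0 n))). pose proof (pos_INR (length l)).
    pose proof (pos_INR n). pose proof (pos_INR d). pose proof (pos_INR m). pose proof (pos_INR (length T)).
    repeat first [apply Rplus_le_le_0_compat | apply Rmult_le_pos]; lra. }
  assert (Hall : forall i, (i < n)%nat -> existsb (fun x => cov T m x i) (sel ++ l) = true).
  { intros i Hi. rewrite existsb_app. destruct (uncovered (cov T m) sel i) eqn:E.
    - rewrite (greedy_covers _ _ _ _ _ Hg i Hi E). apply orb_true_r.
    - rewrite (uncovered_cov _ _ _ _ E). reflexivity. }
  destruct (Nat.eq_dec (count (uncovered (cov T m) sel) (seq 0 n)) 0) as [Hz|Hnz].
  - assert (Hu : forall i, (i < n)%nat -> uncovered (cov T m) sel i = false).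
    { intros i Hi. destruct (uncovered (cov T m) sel i) eqn:E; [|reflexivity].
      assert (0 < count (uncovered (cov T m) sel) (seq 0 n))%nat; [|lia].
      apply count_pos with (x := i); [apply in_seq; lia|exact E]. }
    assert (l = []) by (eapply greedy_unique; [exact Hg|apply greedy_nil; exact Hu]). subst l.
    rewrite app_nil_r in *.
    destruct (flagged_done _ _ _ _ Hf) as [F1 F2]; [exact Hall|].
    eapply det_le; [apply det_while_false|].
    + cbn [beval ieval var]. rewrite F1. reflexivity.
    + split; assumption.
    + lra.
  - destruct Hf as [Hc H17]. apply Nat.eqb_neq in Hnz. rewrite Hnz in H17.
    eapply det_le; [eapply det_while_true with (t2 := 1); [|apply det_phase with (1 := Hc) (2 := Hok) (3 := Hg)|]|].
    + cbn [beval ieval var]. rewrite H17. reflexivity.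
    + intros s' [F|[_ F]].
      * destruct (flagged_done _ _ _ _ F Hall) as [F1 F2].
        apply det_while_false; [cbn [beval ieval var]; rewrite F1; reflexivity|]. split; assumption.
      * exfalso. unfold accurate in Hacc.
        assert (H : (count (heavy T m) (sel ++ l) <= count (heavy T m) (seq 0 n))%nat); [|nia].
        apply count_sub.
        -- apply NoDup_app; [apply (config_NoDup _ _ _ _ _ Hc)|eapply greedy_NoDup; [apply cov_refl|exact Hg]|].
           intros x Hx Hx'. destruct (greedy_in _ _ _ _ _ Hg x Hx') as [A1 A2].
           unfold uncovered in A2. apply negb_true_iff in A2.
           assert (E : existsb (fun x0 => cov T m x0 x) sel = true); [|congruence].
           apply existsb_exists. exists x. split; [exact Hx|apply cov_refl].
        -- intros x Hx. apply in_app_iff in Hx. destruct Hx as [Hx|Hx].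
           ++ apply (config_in _ _ _ _ _ Hc). exact Hx.
           ++ eapply greedy_in; eassumption.
    + lra.
Qed.

Lemma exact_dense : dense (seq 0 n) (k + 1).
Proof.
  split; [split; [|lia]|].
  - intros t Ht. apply in_seq in Ht. lia.
  - rewrite length_seq. nia.
Qed.

(** With T = S the radius is defined so that the open ball has fewer than k + 1 points: no ball is
    heavy. *)
Lemma exact_accurate : accurate (seq 0 n) (k + 1).
Proof.
  unfold accurate. rewrite count_seq_all; [lia|]. intros x Hx.
  unfold heavy_ball. destruct (radius_spec pdist big (seq 0 n) (k + 1) x) as (_ & H & _); [lia|].
  apply andb_false_iff. right. apply Nat.ltb_ge. unfold open_count. lia.
Qed.

Lemma finished_intro T m sel l s : dense T m ->
  config T m (sel ++ l) idle s ->
  (forall i, (i < n)%nat -> existsb (fun x => cov T m x i) (sel ++ l) = true) ->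
  (exists P, greedy n (rad T m) (cov T m) P sel) -> (exists P, greedy n (rad T m) (cov T m) P l) ->
  finished s.
Proof.
  intros Hd Hc Hall [P1 G1] [P2 G2]. exists T, m, (sel ++ l). split; [exact Hc|]. split; [exact Hall|].
  pose proof (greedy_good_bound T m P1 sel Hd G1). pose proof (greedy_good_bound T m P2 l Hd G2).
  pose proof (config_few _ _ _ _ _ Hc) as Hf. rewrite count_app in Hf.
  rewrite length_app, <- (count_negb (heavy T m) sel), <- (count_negb (heavy T m) l). nia.
Qed.

Lemma greedy_nil_idle T m : greedy n (rad T m) (cov T m) idle [].
Proof. apply greedy_nil. reflexivity. Qed.

Notation everything := (seq 0 n).

Lemma greedy_length_le T m Q l : greedy n (rad T m) (cov T m) Q l -> (length l <= n)%nat.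
Proof.
  intros Hl. assert (H : (length l <= length everything)%nat); [|rewrite length_seq in H; exact H].
  apply NoDup_incl_length; [eapply greedy_NoDup; [apply cov_refl|exact Hl]|].
  intros x Hx. apply in_seq. destruct (greedy_in _ _ _ _ _ Hl x Hx). lia.
Qed.

Lemma det_exact_phase s : flagged everything (k + 1) [] s ->
  det (phases d) s (phase_cost everything (k + 1) n n + 2) finished.
Proof.
  intros Hf. destruct (greedy_exists n (rad everything (k + 1)) (cov everything (k + 1)) (cov_refl _ _)
    (uncovered (cov everything (k + 1)) [])) as [l Hl].
  eapply det_weaken; [apply det_last_phase with (1 := Hf) (4 := Hl)|..].
  - apply exact_dense.
  - apply exact_accurate.
  - assert (H1 : (length l <= n)%nat).
    { eapply greedy_length_le. eassumption. }
    pose proof (count_seq_le (uncovered (cov everything (k + 1)) []) n) as H2.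
    apply le_INR in H1, H2. unfold phase_cost.
    assert (0 <= unit_cost everything (k + 1)).
    { unfold unit_cost. pose proof (pos_INR (k + 1)). pose proof (pos_INR (length everything)).
      repeat first [apply Rplus_le_le_0_compat | apply Rmult_le_pos]; lra. }
    pose proof (pos_INR n). pose proof (pos_INR d).
    apply Rplus_le_compat_r. apply Rplus_le_compat_r. apply Rplus_le_compat_r.
    apply Rplus_le_compat; apply Rmult_le_compat_r; lra.
  - intros s' [C Hall]. eapply finished_intro; [apply exact_dense|exact C|exact Hall| |eauto].
    exists idle. apply greedy_nil_idle.
Qed.

Section Phases.

Variables (T : list nat) (m : nat) (P : nat -> bool) (s : store).

Hypothesis T_dense : dense T m.
Hypothesis start_config : config T m [] P s.
Hypothesis start_flag : ia s 17 0 = 1%nat.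

Let l1 := greedy_list n (rad T m) (cov T m) P.
Let l2 := greedy_list n (rad T m) (cov T m) (uncovered (cov T m) l1).

Lemma start_greedy : greedy n (rad T m) (cov T m) P l1.
Proof. apply greedy_list_spec. apply cov_refl. Qed.

Lemma rest_greedy : greedy n (rad T m) (cov T m) (uncovered (cov T m) l1) l2.
Proof. apply greedy_list_spec. apply cov_refl. Qed.

Lemma det_phases_accurate : accurate T m ->
  det (phases d) s
    (phase_cost T m (count P everything) (length l1) +
     phase_cost T m (count (uncovered (cov T m) l1) everything) (length l2) + 3) finished.
Proof.
  intros Hacc. pose proof start_greedy as G1. pose proof rest_greedy as G2.
  eapply det_le; [apply det_while_true with (Q1 := flagged T m l1)|].
  - cbn [beval ieval var]. rewrite start_flag. reflexivity.
  - eapply det_weaken; [apply det_phase with (1 := start_config) (3 := G1); apply T_dense|apply Rle_refl|].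
    intros s' [F|[_ F]]; [exact F|exfalso]. simpl in F. unfold accurate in Hacc.
    assert (H : (count (heavy T m) l1 <= count (heavy T m) everything)%nat); [|nia].
    apply count_sub; [eapply greedy_NoDup; [apply cov_refl|exact G1]|].
    intros x Hx. apply (greedy_in _ _ _ _ _ G1 x Hx).
  - intros s' F.
    eapply det_weaken; [apply det_last_phase with (1 := F) (4 := G2); [apply T_dense|exact Hacc]|apply Rle_refl|].
    intros s2 [C Hall]. eapply finished_intro; eauto.
  - lra.
Qed.

(** A restart may strike in the first phase, in the second or never; both sampled phases and the
    exact one are charged in full. The exact table cannot cause another restart. *)
Lemma det_phases_any :
  det (phases d) s
    (phase_cost T m n n + phase_cost T m n n + phase_cost everything (k + 1) n n + 5) finished.
Proof.
  pose proof start_greedy as G1. pose proof rest_greedy as G2.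
  assert (Hu : forall T' m', 0 <= unit_cost T' m').
  { intros T' m'. unfold unit_cost. pose proof (pos_INR m'). pose proof (pos_INR (length T')).
    repeat first [apply Rplus_le_le_0_compat | apply Rmult_le_pos]; lra. }
  assert (Hmono : forall a l, (a <= n)%nat -> (l <= n)%nat -> phase_cost T m a l <= phase_cost T m n n).
  { intros a l Ha Hl. apply le_INR in Ha, Hl. unfold phase_cost. specialize (Hu T m).
    pose proof (pos_INR n). pose proof (pos_INR d).
    apply Rplus_le_compat_r. apply Rplus_le_compat_r.
    apply Rplus_le_compat; apply Rmult_le_compat_r; lra. }
  assert (Hpos : forall T' m', 0 <= phase_cost T' m' n n).
  { intros T' m'. unfold phase_cost, unit_cost.
    pose proof (pos_INR n). pose proof (pos_INR d). pose proof (pos_INR m'). pose proof (pos_INR (length T')).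
    repeat first [apply Rplus_le_le_0_compat | apply Rmult_le_pos]; lra. }
  pose proof (Hpos T m) as Hp1. pose proof (Hpos everything (k + 1)%nat) as Hp2.
  eapply det_le; [apply det_while_true with (Q1 := fun s' => flagged T m l1 s' \/ flagged everything (k + 1) [] s')
    (t1 := phase_cost T m n n) (t2 := phase_cost T m n n + phase_cost everything (k + 1) n n + 3)|].
  - cbn [beval ieval var]. rewrite start_flag. reflexivity.
  - eapply det_weaken; [apply det_phase with (1 := start_config) (3 := G1); apply T_dense| |].
    + apply Hmono; [apply count_seq_le|eapply greedy_length_le; eassumption].
    + intros s' [F|[F _]]; [left|right]; exact F.
  - intros s' [[C F]|F].
    + destruct (Nat.eqb_spec (count (uncovered (cov T m) l1) everything) 0) as [Hz|Hnz].
      * assert (Hun : forall i, (i < n)%nat -> uncovered (cov T m) l1 i = false).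
        { intros i Hi. destruct (uncovered (cov T m) l1 i) eqn:E; [|reflexivity].
          assert (0 < count (uncovered (cov T m) l1) everything)%nat; [|lia].
          apply count_pos with (x := i); [apply in_seq; lia|exact E]. }
        assert (Hall : forall i, (i < n)%nat -> existsb (fun x => cov T m x i) l1 = true).
        { intros i Hi. apply uncovered_cov. auto. }
        destruct (flagged_done T m l1 s') as [F1 F2]; [|exact Hall|].
        { split; [exact C|]. rewrite Hz. exact F. }
        eapply det_le; [apply det_while_false|lra].
        -- cbn [beval ieval var]. rewrite F1. reflexivity.
        -- apply finished_intro with (T := T) (m := m) (sel := l1) (l := []); auto.
           ++ rewrite app_nil_r. exact F2.
           ++ rewrite app_nil_r. exact Hall.
           ++ eauto.
           ++ exists idle. apply greedy_nil_idle.
      * eapply det_le; [apply det_while_true with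
          (Q1 := fun s' => flagged T m (l1 ++ l2) s' \/ flagged everything (k + 1) [] s')
          (t1 := phase_cost T m n n) (t2 := phase_cost everything (k + 1) n n + 2)|].
        -- cbn [beval ieval var]. rewrite F. reflexivity.
        -- eapply det_weaken; [apply det_phase with (1 := C) (3 := G2); apply T_dense| |].
           ++ apply Hmono; [apply count_seq_le|eapply greedy_length_le; eassumption].
           ++ intros s2 [F2|[F2 _]]; [left|right]; exact F2.
        -- intros s2 [F2|F2]; [|apply det_exact_phase; exact F2].
           assert (Hall : forall i, (i < n)%nat -> existsb (fun x => cov T m x i) (l1 ++ l2) = true).
           { intros i Hi. rewrite existsb_app. destruct (uncovered (cov T m) l1 i) eqn:E.
             - rewrite (greedy_covers _ _ _ _ _ G2 i Hi E). apply orb_true_r.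
             - rewrite (uncovered_cov _ _ _ _ E). reflexivity. }
           destruct (flagged_done _ _ _ _ F2 Hall) as [F3 F4].
           eapply det_le; [apply det_while_false|lra].
           ++ cbn [beval ieval var]. rewrite F3. reflexivity.
           ++ eapply finished_intro; eauto.
        -- lra.
    + eapply det_le; [apply det_exact_phase; exact F|lra].
  - lra.
Qed.

End Phases.

End Verification.

(** * Reading the input and choosing the parameters *)

Section Start.

Variables (d n k beta : nat) (pt : nat -> list R).

Notation det := (det beta).
Notation pdist := (point_dist d pt).

Hypothesis n_pos : (1 <= n)%nat.
Hypothesis low_size : (n * (d + 1) <= beta)%nat.

Lemma det_read_point i p l : forall s,
  ia s 3 0 = i -> ia s 4 0 = p -> (p + d <= beta)%nat ->
  (forall j, In j l -> (j < d)%nat) ->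
  det (block (map (fun j => GetLow (10 + j) (var 3) (IPlus (var 4) (IC j))) l)) s (INR (length l))
    (fun s' => ia s' = ia s /\ low s' = low s /\
      (forall j, In j l -> ra s' (10 + j) i = low s (p + j)) /\
      (forall a i', (i' <> i \/ forall j, In j l -> a <> 10 + j)%nat -> ra s' a i' = ra s a i')).
Proof.
  induction l as [|j l IH]; intros s Hi Hp Hb Hl.
  - apply det_last_skip; [simpl; lra|]. split; [reflexivity|]. split; [reflexivity|]. split; [simpl; tauto|auto].
  - cbn [map block fold_right]. change (length (j :: l)) with (S (length l)). rewrite S_INR.
    assert (Hj : (j < d)%nat) by (apply Hl; simpl; auto).
    set (s1 := setR s (10 + j) i (low s (p + j))).
    eapply det_weaken; [apply det_seq with (Q1 := fun s' => s' = s1); [|intros s' ->; apply (IH s1)]|..].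
    + apply det_getLow; [cbn [ieval var]; rewrite Hp; lia|]. cbn [ieval var]. rewrite Hi, Hp. reflexivity.
    + exact Hi.
    + exact Hp.
    + exact Hb.
    + intros; apply Hl; simpl; auto.
    + lra.
    + intros s' (E1 & E2 & E3 & E4). split; [exact E1|]. split; [exact E2|]. split.
      * intros j' Hj'. destruct (in_dec Nat.eq_dec j' l) as [Hin|Hnin]; [apply E3; exact Hin|].
        destruct Hj' as [<-|Hj']; [|contradiction].
        rewrite E4.
        -- unfold s1, setR. cbn [ra]. apply upd2_same.
        -- right. intros j' Hj' E. apply Hnin. replace j with j' by lia. exact Hj'.
      * intros a i' Ha. rewrite E4 by (destruct Ha as [Ha|Ha]; [left; exact Ha|right; intros; apply Ha; simpl; auto]).
        unfold s1, setR. cbn [ra]. destruct Ha as [Ha|Ha].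
        -- unfold upd2. apply Nat.eqb_neq in Ha. rewrite Ha. destruct (Nat.eqb a (10 + j)); reflexivity.
        -- apply upd2_other. apply Ha. simpl. auto.
Qed.

Lemma det_read_input s :
  ia s 0 0 = n -> (forall i j, (i < n)%nat -> (j < d)%nat -> low s (i * d + j) = nth j (pt i) 0) ->
  det (read_input d) s (INR n * (INR d + 3) + 3) (fun s' =>
    (forall a i, a <> 3%nat -> a <> 4%nat -> ia s' a i = ia s a i) /\
    forall i j, (i < n)%nat -> (j < d)%nat -> ra s' (10 + j) i = nth j (pt i) 0).
Proof.
  intros Hn Hlow. unfold read_input. apply det_seq_setI.
  eapply det_le; [|apply Req_le; instantiate (1 := INR n * (INR d + 1 + 2) + 2); lra].
  apply det_for with (I := fun j s' => ia s' 3 0 = j /\ ia s' 4 0 = (j * d)%nat /\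
    (forall a i, a <> 3%nat -> a <> 4%nat -> ia s' a i = ia s a i) /\ low s' = low s /\
    forall i j', (i < j)%nat -> (j' < d)%nat -> ra s' (10 + j') i = nth j' (pt i) 0).
  - intros j s' _ (E & _ & Hk & _). split; [exact E|]. cbn [ieval var]. rewrite Hk by lia. exact Hn.
  - intros j s' Hj (E3 & E4 & Hk & Hl & Hr).
    eapply det_seq_then; [apply det_read_point with (i := j) (p := (j * d)%nat); auto|].
    + nia.
    + intros j' Hj'. apply in_seq in Hj'. lia.
    + rewrite length_seq. intros s2 (A1 & A2 & A3 & A4). apply det_last_setI; [lra|].
      reduce. rewrite A1. split; [exact E3|]. split; [reflexivity|].
      split; [rewrite E4; lia|]. split; [|split].
      * intros a i H1 H2. rewrite !upd2_other by assumption. auto.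
      * rewrite A2. exact Hl.
      * intros i j' Hi Hj'. destruct (Nat.eq_dec i j) as [->|Hne].
        -- rewrite A3 by (apply in_seq; lia). rewrite Hl. apply Hlow; assumption.
        -- rewrite A4 by (left; exact Hne). apply Hr; [lia|exact Hj'].
  - reduce. split; [reflexivity|]. split; [reflexivity|]. split; [|split; [reflexivity|intros; lia]].
    intros a i H1 H2. rewrite !upd2_other by assumption. reflexivity.
  - intros s' (_ & _ & Hk & _ & Hr). split; assumption.
Qed.

Lemma det_find_big s : env d n k pt (ra s 1 0) s ->
  det (find_big d) s (INR n * 4 + 4) (fun s' => keep [3]%nat [1]%nat s s' /\
    0 < ra s' 1 0 /\ forall i j, (i < n)%nat -> (j < n)%nat -> pdist i j < ra s' 1 0).
Proof.
  intros He. unfold find_big. apply det_seq_setR.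
  eapply det_seq_then with (t1 := INR n * (2 + 2) + 2).
  - apply det_for with (I := fun j s' => ia s' 3 0 = j /\ keep [3]%nat [1]%nat s s' /\
      0 <= ra s' 1 0 /\ forall i, (i < j)%nat -> pdist i 0%nat <= ra s' 1 0).
    + intros j s' _ (E & Hk & _). split; [exact E|]. cbn [ieval var]. use_keep Hk. apply He.
    + intros j s' Hj (E & Hk & H0 & Hm).
      assert (He' : env d n k pt (ra s' 1 0) s').
      { destruct He as [A1 A2 A3 A4]. constructor; auto; use_keep Hk; auto.
        intros i j' Hi Hj'. rewrite (proj1 (proj2 Hk)) by (simpl; lia). auto. }
      apply det_branch. cbn [beval].
      rewrite (reval_distance _ _ _ _ _ s' (var 3) (IC 0) j 0 He' E eq_refl Hj n_pos).
      cbn [reval rvar ieval].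
      destruct (Rleb (pdist j 0) (ra s' 1 0)) eqn:E1.
      * apply Rleb_true in E1. apply det_last_skip; [lra|]. reduce.
        split; [exact E|]. split; [reflexivity|]. split; [keep_tac|]. split; [exact H0|].
        intros i Hi. destruct (Nat.eq_dec i j) as [->|]; [exact E1|apply Hm; lia].
      * apply Rleb_false in E1. apply det_last_setR; [lra|].
        rewrite (reval_distance _ _ _ _ _ s' (var 3) (IC 0) j 0 He' E eq_refl Hj n_pos). reduce.
        split; [exact E|]. split; [reflexivity|]. split; [keep_tac|]. split; [lra|].
        intros i Hi. destruct (Nat.eq_dec i j) as [->|]; [lra|].
        assert (pdist i 0 <= ra s' 1 0) by (apply Hm; lia). lra.
    + reduce. split; [reflexivity|]. split; [keep_tac|]. split; [lra|]. intros; lia.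
    + intros s' H. exact H.
  - intros s' (_ & Hk & H0 & Hm). apply det_last_setR; [lra|]. reduce. split; [keep_tac|]. split; [lra|].
    intros i j Hi Hj. pose proof (edist_le_double d (pt i) (pt j) (pt 0%nat) _ (Hm i Hi) (Hm j Hj)).
    unfold point_dist in *. lra.
Qed.

End Start.

Lemma le_pow4 b : (b <= b ^ 4)%nat.
Proof.
  destruct b as [|b]; [simpl; lia|]. rewrite <- (Nat.pow_1_r (S b)) at 1.
  apply Nat.pow_le_mono_r; lia.
Qed.

(** Linear search with the crude bound k on the number of rounds, affordable since k is at most n by
    then. *)
Lemma det_find_root beta k s : (1 <= k)%nat -> ia s 1 0 = k ->
  det beta find_root s (2 * INR k + 2) (fun s' => keep [5]%nat [] s s' /\
    exists b, ia s' 5 0 = b /\ (1 <= b)%nat /\ (b ^ 4 <= k)%nat /\ (k < (b + 1) ^ 4)%nat).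
Proof.
  intros Hk1 Hk. unfold find_root. apply det_seq_setI.
  set (w := While _ _).
  assert (Hloop : forall f b s', (k - b <= f)%nat -> (1 <= b)%nat -> (b ^ 4 <= k)%nat ->
    ia s' 5 0 = b -> keep [5]%nat [] s s' ->
    det beta w s' (2 * INR f + 1) (fun s' => keep [5]%nat [] s s' /\
    exists b, ia s' 5 0 = b /\ (1 <= b)%nat /\ (b ^ 4 <= k)%nat /\ (k < (b + 1) ^ 4)%nat)).
  { induction f as [|f IH]; intros b s' Hf Hb Hb4 E5 Hkp;
    assert (E1 : ia s' 1 0 = k) by (use_keep Hkp; exact Hk);
    assert (Hev : beval (BR (let u := ROp OpAdd (RN (var 5)) RC1 in ROp OpMul (ROp OpMul u u) (ROp OpMul u u)) (RN (var 1))) s'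
      = Nat.leb ((b + 1) ^ 4) k)
      by (cbn [beval reval opsem ieval var]; rewrite E5, E1;
          replace ((INR b + 1) * (INR b + 1) * ((INR b + 1) * (INR b + 1))) with (INR ((b + 1) ^ 4))
            by (rewrite pow_INR, plus_INR; simpl; ring);
          destruct (Nat.leb_spec ((b + 1) ^ 4) k) as [H|H];
          [apply Rleb_true, le_INR; exact H|apply Rleb_false, lt_INR; exact H]);
    pose proof (le_pow4 b) as Hb1;
    destruct (Nat.leb_spec ((b + 1) ^ 4) k) as [Hle|Hlt].
    - exfalso. pose proof (le_pow4 (b + 1)). lia.
    - eapply det_le; [apply det_while_false; [exact Hev|]|simpl; lra].
      split; [exact Hkp|]. exists b. auto.
    - eapply det_le; [apply det_while_true with (t1 := 1) (t2 := 2 * INR f + 1) (Q1 := fun s2 => s2 = setI s' 5 0 (b + 1));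
        [exact Hev| |]|rewrite S_INR; lra].
      + apply det_setI. reduce. rewrite E5. reflexivity.
      + intros s2 ->. apply (IH (b + 1)%nat); [lia|lia|exact Hle|reflexivity|keep_tac].
    - eapply det_le; [apply det_while_false; [exact Hev|]|pose proof (pos_INR (S f)); lra].
      split; [exact Hkp|]. exists b. auto. }
  eapply det_le; [apply (Hloop k 1%nat); [lia|lia|simpl; lia|reflexivity|keep_tac]|lra].
Qed.

(** Since 2^L < 2 n, more than half of the values of a draw are points. *)
Lemma det_find_range beta n s : (1 <= n)%nat -> ia s 0 0 = n ->
  det beta find_range s (2 * INR n + 2) (fun s' => keep [6]%nat [] s s' /\
    exists L, ia s' 6 0 = (2 ^ L)%nat /\ (n <= 2 ^ L)%nat /\ (2 ^ L < 2 * n)%nat).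
Proof.
  intros n_pos Hn. unfold find_range. apply det_seq_setI.
  set (w := While _ _).
  assert (Hloop : forall f L s', (n - 2 ^ L <= f)%nat -> (2 ^ L < 2 * n)%nat ->
    ia s' 6 0 = (2 ^ L)%nat -> keep [6]%nat [] s s' ->
    det beta w s' (2 * INR f + 1) (fun s' => keep [6]%nat [] s s' /\
    exists L, ia s' 6 0 = (2 ^ L)%nat /\ (n <= 2 ^ L)%nat /\ (2 ^ L < 2 * n)%nat)).
  { induction f as [|f IH]; intros L s' Hf HL E6 Hkp;
    assert (E0 : ia s' 0 0 = n) by (use_keep Hkp; exact Hn);
    assert (Hev : beval (less (var 6) (var 0)) s' = Nat.ltb (2 ^ L) n)
      by (rewrite beval_less; cbn [ieval var]; rewrite E6, E0; reflexivity);
    destruct (Nat.ltb_spec (2 ^ L) n) as [Hlt|Hge].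
    - lia.
    - eapply det_le; [apply det_while_false; [exact Hev|]|simpl; lra].
      split; [exact Hkp|]. exists L. auto.
    - eapply det_le; [apply det_while_true with (t1 := 1) (t2 := 2 * INR f + 1)
        (Q1 := fun s2 => s2 = setI s' 6 0 (2 ^ L + 2 ^ L)); [exact Hev| |]|rewrite S_INR; lra].
      + apply det_setI. reduce. rewrite E6. reflexivity.
      + assert (H2 : (0 < 2 ^ L)%nat) by (apply Nat.neq_0_lt_0, Nat.pow_nonzero; lia).
        intros s2 ->. apply (IH (S L)); [simpl; lia|simpl; lia|reduce; simpl; lia|keep_tac].
    - eapply det_le; [apply det_while_false; [exact Hev|]|pose proof (pos_INR (S f)); lra].
      split; [exact Hkp|]. exists L. auto. }
  eapply det_le; [apply (Hloop n 0%nat); [lia|simpl; lia|reflexivity|keep_tac]|lra].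
Qed.


Definition ceil_div (x y : nat) : nat := ((x + y - 1) / y)%nat.

(** Translates the division-free tests of the sampling loops into numbers of draws. *)
Lemma ceil_div_lt x y z : (1 <= y)%nat -> (z < ceil_div x y <-> z * y < x)%nat.
Proof.
  intros Hy. unfold ceil_div.
  pose proof (Nat.div_mod (x + y - 1) y) as E. pose proof (Nat.mod_upper_bound (x + y - 1) y) as U.
  set (q := ((x + y - 1) / y)%nat) in *. set (r := ((x + y - 1) mod y)%nat) in *.
  split; intros H; nia.
Qed.

(** * A run as a function of its two samples *)

Section Run.

Variables (d n k beta : nat) (pt : nat -> list R) (big : R) (b L : nat).

Notation det := (det beta).
Notation ecost := (ecost beta).
Notation pdist := (point_dist d pt).
Notation env := (env d n k pt big).

Hypothesis big_pos : 0 < big.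
Hypothesis pt_sep : forall x y, (x < n)%nat -> (y < n)%nat -> x <> y -> 0 < pdist x y.
Hypothesis pt_big : forall x y, (x < n)%nat -> (y < n)%nat -> pdist x y < big.
Hypothesis low_size : (n * (d + 1) <= beta)%nat.
Hypothesis k_pos : (1 <= k)%nat.
Hypothesis k_le_n : (k <= n)%nat.
Hypothesis b_pos : (1 <= b)%nat.

Definition table_draws : nat := ceil_div (16 * n * b) k.
Definition active_draws : nat := ceil_div n (b * b).

Record sampling (l : list nat) (T : list nat) (P : nat -> bool) (s : store) : Prop := {
  sampling_env : env s;
  sampling_root : ia s 5 0 = b;
  sampling_range : ia s 6 0 = (2 ^ L)%nat;
  sampling_count : ia s 7 0 = length l;
  sampling_length : ia s 12 0 = length T;
  sampling_table : forall t, (t < length T)%nat -> ia s 11 t = nth t T 0%nat;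
  sampling_status : forall i, (i < n)%nat -> ia s 13 i = if P i then 2%nat else 0%nat }.

Lemma ecost_seq_det c1 c2 s t Q (K : store -> R -> Prop) B :
  det c1 s t Q -> (forall s', Q s' -> ecost c2 K s' B) -> ecost (Seq c1 c2) K s (B + t).
Proof.
  intros H1 H2. apply ecost_seq with (K1 := fun s' B' => Q s' /\ B' = B).
  - apply H1. auto.
  - intros s' B' [HQ ->]. auto.
Qed.

Lemma sampling_keep l T P s s' : sampling l T P s ->
  keep [8; 9; 10]%nat [] s s' -> sampling l T P s'.
Proof.
  intros [A1 A2 A3 A4 A5 A6 A7] Hk. constructor; auto.
  - eapply env_keep; [exact A1|exact Hk|index_tac|index_tac].
  - use_keep Hk. exact A2.
  - use_keep Hk. exact A3.
  - use_keep Hk. exact A4.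
  - use_keep Hk. exact A5.
  - intros t Ht. use_keep Hk. auto.
  - intros i Hi. use_keep Hk. auto.
Qed.

Lemma valid_app l v : valid n (l ++ [v]) = valid n l ++ (if Nat.ltb v n then [v] else []).
Proof. unfold valid. rewrite filter_app. reflexivity. Qed.

Lemma ecost_sample_table s (K : store -> R -> Prop) (F : list nat -> R) :
  env s -> ia s 5 0 = b -> ia s 6 0 = (2 ^ L)%nat ->
  (forall i, (i < n)%nat -> ia s 13 i = 0%nat) ->
  (forall l s', length l = table_draws -> sampling l (valid n l) idle s' -> K s' (F l)) ->
  ecost sample_table K s
    (expect (2 ^ L) table_draws F + (INR table_draws * (4 * INR L + 8) + 1) + 1 + 1).
Proof.
  intros He Hb HL Hst HK. unfold sample_table.
  eapply ecost_seq_det; [apply det_setI; exact (eq_refl (setI _ _ _ _))|]. intros s1 <-.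
  eapply ecost_seq_det; [apply det_setI; exact (eq_refl (setI _ _ _ _))|]. intros s2 <-.
  eapply ecost_weaken; [apply ecost_draws with (L := L) (m := table_draws) (t := 4) (l := [])
    (rel := fun l s' => sampling l (valid n l) idle s') (F := F)|].
  - intros l s' [A1 A2 A3 A4 A5 A6 A7]. split; [|exact A3].
    cbn [beval reval opsem ieval var]. rewrite A4, A2, (env_n _ _ _ _ _ _ A1), (env_k _ _ _ _ _ _ A1).
    pose proof (ceil_div_lt (16 * n * b) k (length l) k_pos) as Hc. fold table_draws in Hc.
    replace (INR 16 * (INR n * INR b)) with (INR (16 * n * b)) by (rewrite !mult_INR; ring).
    replace (INR (length l) * INR k + 1) with (INR (length l * k + 1)) by (rewrite plus_INR, mult_INR; reflexivity).
    destruct (Nat.ltb_spec (length l) table_draws) as [H|H].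
    + apply Rleb_true, le_INR. lia.
    + apply Rleb_false, lt_INR. lia.
  - intros l s' s3 v Hs Hlen Hv [Hd Hk].
    pose proof (sampling_keep _ _ _ _ _ Hs Hk) as [A1 A2 A3 A4 A5 A6 A7].
    eapply det_seq_then with (t1 := 3) (Q1 := fun s4 => ia s4 7 0 = length l /\
      forall s5, keep [7]%nat [] s4 s5 -> ia s5 7 0 = length (l ++ [v]) ->
        sampling (l ++ [v]) (valid n (l ++ [v])) idle s5).
    + apply det_branch. rewrite beval_less. cbn [ieval var]. rewrite Hd, (env_n _ _ _ _ _ _ A1).
      rewrite valid_app. destruct (Nat.ltb_spec v n) as [Hvn|Hvn].
      * apply det_seq_setI. apply det_last_setI; [lra|]. reduce. split; [exact A4|].
        intros s5 Hk5 H7. constructor; auto.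
        -- eapply env_keep with (A := [7; 11; 12]%nat) (B := []); [exact A1| |index_tac|index_tac].
           eapply keep_trans; [|eapply keep_incl; [| |exact Hk5]; intros a; simpl; tauto].
           keep_tac.
        -- use_keep Hk5. exact A2.
        -- use_keep Hk5. exact A3.
        -- use_keep Hk5. reduce. rewrite A5, length_app. reflexivity.
        -- intros t Ht. use_keep Hk5. reduce. rewrite A5, Hd. rewrite length_app in Ht. simpl in Ht.
           destruct (Nat.eqb_spec t (length (valid n l))) as [->|Hne].
           ++ rewrite nth_middle. reflexivity.
           ++ rewrite app_nth1 by lia. apply A6. lia.
        -- intros i Hi. use_keep Hk5. reduce. apply A7. exact Hi.
      * apply det_last_skip; [lra|]. split; [exact A4|].
        intros s5 Hk5 H7. rewrite app_nil_r. constructor; auto.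
        -- eapply env_keep; [exact A1|exact Hk5|index_tac|index_tac].
        -- use_keep Hk5. exact A2.
        -- use_keep Hk5. exact A3.
        -- use_keep Hk5. exact A5.
        -- intros t Ht. use_keep Hk5. apply A6. exact Ht.
        -- intros i Hi. use_keep Hk5. apply A7. exact Hi.
    + intros s4 [H7 H4]. apply det_last_setI; [lra|]. apply H4; [keep_tac|].
      reduce. rewrite H7, length_app. reflexivity.
  - intros l s' Hl Hs. apply HK; assumption.
  - reflexivity.
  - constructor; reduce; auto.
    + eapply env_keep with (A := [7; 12]%nat) (B := []); [exact He|keep_tac|index_tac|index_tac].
    + simpl. intros; lia.
  - change (expect (2 ^ L) table_draws (fun l' => F ([] ++ l'))) with (expect (2 ^ L) table_draws F). lra.
Qed.

Lemma ecost_sample_active T l0 s (K : store -> R -> Prop) (F : list nat -> R) :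
  sampling l0 T idle s ->
  (forall l s', length l = active_draws -> sampling l T (sampled l) s' -> K s' (F l)) ->
  ecost sample_active K s
    (expect (2 ^ L) active_draws F + (INR active_draws * (4 * INR L + 7) + 1) + 1).
Proof.
  intros Hs0 HK. unfold sample_active.
  eapply ecost_seq_det; [apply det_setI; exact (eq_refl (setI _ _ _ _))|]. intros s1 <-.
  eapply ecost_weaken; [apply ecost_draws with (L := L) (m := active_draws) (t := 3) (l := [])
    (rel := fun l s' => sampling l T (sampled l) s') (F := F)|].
  - intros l s' [A1 A2 A3 A4 A5 A6 A7]. split; [|exact A3].
    cbn [beval reval opsem ieval var]. rewrite A4, A2, (env_n _ _ _ _ _ _ A1).
    assert (Hbb : (1 <= b * b)%nat) by nia.
    pose proof (ceil_div_lt n (b * b) (length l) Hbb) as Hc. fold active_draws in Hc.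
    replace (INR (length l) * (INR b * INR b) + 1) with (INR (length l * (b * b) + 1))
      by (rewrite plus_INR, !mult_INR; reflexivity).
    destruct (Nat.ltb_spec (length l) active_draws) as [H|H].
    + apply Rleb_true, le_INR. lia.
    + apply Rleb_false, lt_INR. lia.
  - intros l s' s3 v Hs Hlen Hv [Hd Hk].
    pose proof (sampling_keep _ _ _ _ _ Hs Hk) as [A1 A2 A3 A4 A5 A6 A7].
    assert (Hsm : forall i, sampled (l ++ [v]) i = (sampled l i || Nat.eqb i v)%bool).
    { intros i. unfold sampled. rewrite existsb_app. simpl. rewrite orb_false_r. reflexivity. }
    eapply det_seq_then with (t1 := 2) (Q1 := fun s4 => ia s4 7 0 = length l /\
      forall s5, keep [7]%nat [] s4 s5 -> ia s5 7 0 = length (l ++ [v]) ->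
        sampling (l ++ [v]) T (sampled (l ++ [v])) s5).
    + apply det_branch. rewrite beval_less. cbn [ieval var]. rewrite Hd, (env_n _ _ _ _ _ _ A1).
      destruct (Nat.ltb_spec v n) as [Hvn|Hvn].
      * apply det_last_setI; [lra|]. reduce. split; [exact A4|].
        intros s5 Hk5 H7. constructor; auto.
        -- eapply env_keep with (A := [7; 13]%nat) (B := []); [exact A1| |index_tac|index_tac].
           eapply keep_trans; [|eapply keep_incl; [| |exact Hk5]; intros a; simpl; tauto].
           keep_tac.
        -- use_keep Hk5. exact A2.
        -- use_keep Hk5. exact A3.
        -- use_keep Hk5. exact A5.
        -- intros t Ht. use_keep Hk5. apply A6. exact Ht.
        -- intros i Hi. use_keep Hk5. reduce. rewrite Hsm, Hd.
           destruct (Nat.eqb i v); [rewrite orb_true_r; reflexivity|].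
           rewrite orb_false_r. apply A7. exact Hi.
      * apply det_last_skip; [lra|]. split; [exact A4|].
        intros s5 Hk5 H7. constructor; auto.
        -- eapply env_keep; [exact A1|exact Hk5|index_tac|index_tac].
        -- use_keep Hk5. exact A2.
        -- use_keep Hk5. exact A3.
        -- use_keep Hk5. exact A5.
        -- intros t Ht. use_keep Hk5. apply A6. exact Ht.
        -- intros i Hi. use_keep Hk5. rewrite Hsm.
           replace (Nat.eqb i v) with false by (symmetry; apply Nat.eqb_neq; lia).
           rewrite orb_false_r. apply A7. exact Hi.
    + intros s4 [H7 H4]. apply det_last_setI; [lra|]. apply H4; [keep_tac|].
      reduce. rewrite H7, length_app. reflexivity.
  - intros l s' Hl Hs. apply HK; assumption.
  - reflexivity.
  - destruct Hs0 as [A1 A2 A3 A4 A5 A6 A7]. constructor; reduce; auto.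
    eapply env_keep with (A := [7]%nat) (B := []); [exact A1|keep_tac|index_tac|index_tac].
  - change (expect (2 ^ L) active_draws (fun l' => F ([] ++ l'))) with (expect (2 ^ L) active_draws F). lra.
Qed.

Notation rad T := (radius pdist big T b).
Notation cov T := (covers n k pdist big T b).

Definition is_accurate (T : list nat) : bool :=
  Nat.leb (k * count (heavy_ball n k pdist big T b) (seq 0 n)) n.

(** Once both samples are fixed the rest is deterministic. For an inaccurate table the worst case is
    charged, whether or not a restart takes place. *)
Definition run_cost (T X : list nat) : R :=
  if is_accurate T then
    phase_cost d n T b (count (sampled X) (seq 0 n)) (length (greedy_list n (rad T) (cov T) (sampled X))) +
    phase_cost d n T b (missed n (rad T) (cov T) X)
      (length (greedy_list n (rad T) (cov T) (uncovered (cov T) (greedy_list n (rad T) (cov T) (sampled X))))) + 3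
  else phase_cost d n T b n n + phase_cost d n T b n n + phase_cost d n (seq 0 n) (k + 1) n n + 5.

Definition wrap_up : cmd :=
  Seq (assign 14 (var 5)) (Seq (assign 15 (IC 0)) (Seq (assign 16 (IC 0)) (Seq (assign 17 (IC 1))
  (Seq (phases d) (assign 0 (var 15)))))).

Definition output (s : store) : Prop :=
  exists s1, finished d n k pt big s1 /\ s = setI s1 0 0 (ia s1 15 0).

Lemma det_wrap_up T X s : sampling X T (sampled X) s -> dense n k T b ->
  det wrap_up s (run_cost T X + 5) output.
Proof.
  intros [A1 A2 A3 A4 A5 A6 A7] Hd. unfold wrap_up. repeat apply det_seq_setI.
  cbn [ieval]. 
  set (s1 := setI _ 17 0 1).
  assert (Hc : config d n k pt big T b [] (sampled X) s1).
  { constructor; try reflexivity.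
    - eapply env_keep with (A := [14; 15; 16; 17]%nat) (B := []); [exact A1|unfold s1; keep_tac|index_tac|index_tac].
    - constructor; unfold s1; reduce; auto.
    - intros i Hi. unfold s1. reduce. cbn [existsb]. apply A7. exact Hi.
    - unfold s1. reduce. unfold count. simpl. lia.
    - unfold count. simpl. lia.
    - constructor.
    - simpl. tauto.
    - simpl. intros; lia. }
  assert (Hf : ia s1 17 0 = 1%nat) by reflexivity.
  clearbody s1.
  eapply det_seq_then with (t1 := run_cost T X).
  - unfold run_cost. destruct (is_accurate T) eqn:E.
    + apply Nat.leb_le in E. apply det_phases_accurate with (k := k) (big := big) (pt := pt); assumption.
    + apply det_phases_any with (k := k) (big := big) (pt := pt) (P := sampled X) (T := T) (m := b); assumption.
  - intros s2 Hfin. apply det_last_setI; [lra|]. exists s2. split; [exact Hfin|reflexivity].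
Qed.

(** The 17 is 16 from the number of draws and 1 for rounding up, because k <= n b. *)
Lemma valid_dense l : length l = table_draws -> dense n k (valid n l) b.
Proof.
  intros Hl. split; [split; [|exact b_pos]|].
  - intros t Ht. apply filter_In in Ht. apply Nat.ltb_lt, Ht.
  - assert (H : (length (valid n l) <= table_draws)%nat).
    { rewrite <- Hl. apply filter_length_le. }
    assert (H2 : (k * table_draws < 16 * n * b + k)%nat).
    { unfold table_draws, ceil_div. 
      pose proof (Nat.Div0.mul_div_le (16 * n * b + k - 1) k). nia. }
    nia.
Qed.

Definition sampled_part : cmd := Seq sample_table (Seq sample_active wrap_up).

Lemma ecost_sampled_part s :
  env s -> ia s 5 0 = b -> ia s 6 0 = (2 ^ L)%nat ->
  (forall i, (i < n)%nat -> ia s 13 i = 0%nat) ->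
  ecost sampled_part (fun s' B => output s' /\ B = 0) s
    (expect (2 ^ L) table_draws (fun l =>
       expect (2 ^ L) active_draws (fun X => run_cost (valid n l) X) +
       (INR active_draws * (4 * INR L + 7) + 7)) + INR table_draws * (4 * INR L + 8) + 3).
Proof.
  intros He Hb HL Hst. unfold sampled_part.
  apply ecost_seq with (K1 := fun s' B => exists l, length l = table_draws /\ sampling l (valid n l) idle s' /\
    B = expect (2 ^ L) active_draws (fun X => run_cost (valid n l) X) + (INR active_draws * (4 * INR L + 7) + 7)).
  - eapply ecost_weaken; [apply ecost_sample_table|]; auto.
    + intros l s' Hl Hs. exists l. split; [exact Hl|]. split; [exact Hs|reflexivity].
    + lra.
  - intros s' B (l & Hl & Hs & ->).
    apply ecost_seq with (K1 := fun s' B => exists X, sampling X (valid n l) (sampled X) s' /\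
      B = run_cost (valid n l) X + 5).
    + eapply ecost_weaken; [apply ecost_sample_active with (T := valid n l) (l0 := l)
        (F := fun X => run_cost (valid n l) X + 5)|]; auto.
      * intros X s2 HX Hs2. exists X. auto.
      * rewrite (expect_plus _ _ (fun X => run_cost (valid n l) X) (fun _ => 5)), expect_const; [lra|].
        apply Nat.neq_0_lt_0, Nat.pow_nonzero. lia.
    + intros s2 B (X & Hs2 & ->). rewrite <- (Rplus_0_l (_ + 5)).
      apply ecost_det with (Q := output); [apply det_wrap_up; [exact Hs2|apply valid_dense; exact Hl]|auto].
Qed.

End Run.

(** * The expected cost of a run *)

Lemma two_le_exp_1 : 2 <= exp 1.
Proof. pose proof (exp_ineq1_le 1). lra. Qed.

Lemma exp_mult_INR x m : exp x ^ m = exp (INR m * x).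
Proof.
  induction m as [|m IH]; [simpl; rewrite Rmult_0_l, exp_0; reflexivity|].
  rewrite S_INR. simpl pow. rewrite IH, <- exp_plus. f_equal. ring.
Qed.

Lemma pow_one_minus_le y m : 0 <= y <= 1 -> (1 - y) ^ m <= exp (- (INR m * y)).
Proof.
  intros Hy. replace (- (INR m * y)) with (INR m * - y) by ring. rewrite <- exp_mult_INR.
  apply pow_incr. pose proof (exp_ineq1_le (- y)). lra.
Qed.

(** With x = (t + 1) / 4, the bound x^12 <= e^(12 x) = e^(3 t + 3) leaves the factor e^3 <= 27. *)
Lemma poly_exp_bound t : 0 <= t -> (t + 1) ^ 12 * exp (- (3 * t)) <= 4 ^ 12 * 27.
Proof.
  intros Ht. set (x := (t + 1) / 4).
  assert (Hx : (t + 1) = 4 * x) by (unfold x; lra).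
  assert (Hxe : x <= exp x) by (pose proof (exp_ineq1_le x); lra).
  assert (H0 : 0 <= x) by (unfold x; lra).
  rewrite Hx, Rpow_mult_distr, Rmult_assoc. apply Rmult_le_compat_l; [apply pow_le; lra|].
  eapply Rle_trans; [apply Rmult_le_compat_r; [left; apply exp_pos|apply pow_incr; split; [exact H0|exact Hxe]]|].
  rewrite exp_mult_INR, <- exp_plus.
  replace (INR 12 * x + - (3 * t)) with (INR 3 * 1) by (simpl; unfold x; lra).
  rewrite <- exp_mult_INR. replace 27 with (3 ^ 3) by (simpl; lra).
  apply pow_incr. split; [left; apply exp_pos|apply exp_le_3].
Qed.

(** Strengthened by the bound on the increment 2 L + 1, so that both double along the induction. *)
Lemma square_le_pow2 L : (L * L <= 4 * 2 ^ L)%nat.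
Proof.
  assert (H : (L * L <= 4 * 2 ^ L /\ 2 * L + 1 <= 4 * 2 ^ L)%nat); [|apply H].
  induction L as [|L [H1 H2]]; [simpl; lia|].
  assert (1 <= 2 ^ L)%nat by (apply Nat.neq_0_lt_0, Nat.pow_nonzero; lia).
  cbn [Nat.pow]. split; nia.
Qed.

(** * Estimates for the expected cost *)

Section Bound.

Variables (d n k : nat) (pt : nat -> list R) (big : R) (b L : nat).

Notation pdist := (point_dist d pt).

Hypothesis big_pos : 0 < big.
Hypothesis pt_sep : forall x y, (x < n)%nat -> (y < n)%nat -> x <> y -> 0 < pdist x y.
Hypothesis pt_big : forall x y, (x < n)%nat -> (y < n)%nat -> pdist x y < big.
Hypothesis k_pos : (1 <= k)%nat.
Hypothesis k_le_n : (k <= n)%nat.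
Hypothesis b_pos : (1 <= b)%nat.
Hypothesis b_low : (b ^ 4 <= k)%nat.
Hypothesis b_high : (k < (b + 1) ^ 4)%nat.
Hypothesis L_low : (n <= 2 ^ L)%nat.
Hypothesis L_high : (2 ^ L < 2 * n)%nat.

Notation N := (2 ^ L)%nat.
Notation mT := (table_draws n k b).
Notation mX := (active_draws n b).
Notation M := (multiplicity d).
Notation rad T := (radius pdist big T b).
Notation cov T := (covers n k pdist big T b).

Lemma table_draws_bounds : (16 * n * b <= mT * k /\ mT * k <= 17 * n * b)%nat.
Proof.
  pose proof (ceil_div_lt (16 * n * b) k mT k_pos) as H1.
  pose proof (ceil_div_lt (16 * n * b) k (mT - 1) k_pos) as H2.
  unfold table_draws in *. set (q := ceil_div (16 * n * b) k) in *. clearbody q.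
  split; [apply Nat.nlt_ge; intros H; apply H1 in H; lia|].
  destruct (Nat.eq_dec q 0) as [->|Hq]; [lia|].
  assert (H : ((q - 1) * k < 16 * n * b)%nat) by (apply H2; lia). nia.
Qed.

Lemma square_le_k : (b * b <= k)%nat.
Proof.
  replace (b * b)%nat with (b ^ 2)%nat by (simpl; lia).
  etransitivity; [|exact b_low]. apply Nat.pow_le_mono_r; lia.
Qed.

Lemma active_draws_bounds : (n <= mX * (b * b) /\ mX * (b * b) <= 2 * n)%nat.
Proof.
  assert (Hbb : (1 <= b * b)%nat) by nia.
  pose proof (ceil_div_lt n (b * b) mX Hbb) as H1.
  pose proof (ceil_div_lt n (b * b) (mX - 1) Hbb) as H2.
  pose proof square_le_k as Hk.
  unfold active_draws in *. set (q := ceil_div n (b * b)) in *. clearbody q.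
  split; [apply Nat.nlt_ge; intros H; apply H1 in H; lia|].
  destruct (Nat.eq_dec q 0) as [->|Hq]; [lia|].
  assert (H : ((q - 1) * (b * b) < n)%nat) by (apply H2; lia). nia.
Qed.

(** Compare squares: L^2 <= 4 2^L < 8 n and b^4 <= k <= n, so the product is at most 8 n^2. This
    absorbs the log n flips of a draw. *)
Lemma log_bound : (L * (b * b) <= 3 * n)%nat.
Proof.
  pose proof (square_le_pow2 L) as H1.
  assert (H2 : (b * b * (b * b) <= n)%nat).
  { replace (b * b * (b * b))%nat with (b ^ 4)%nat by (simpl; lia). lia. }
  apply Nat.square_le_simpl_nonneg; [lia|].
  replace (L * (b * b) * (L * (b * b)))%nat with ((L * L) * (b * b * (b * b)))%nat by ring.
  assert (H3 : (L * L <= 8 * n)%nat) by lia.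
  assert (H4 : ((L * L) * (b * b * (b * b)) <= 8 * n * n)%nat) by (apply Nat.mul_le_mono; assumption).
  nia.
Qed.

Lemma k_le_16 : (k <= 16 * (b * b * (b * b)))%nat.
Proof.
  assert (H : ((b + 1) ^ 4 <= (2 * b) ^ 4)%nat) by (apply Nat.pow_le_mono_l; lia).
  replace ((2 * b) ^ 4)%nat with (16 * (b * b * (b * b)))%nat in H by (simpl; ring). lia.
Qed.

(** 958 = 4 . 96 + 7 . 32 + 4 . 51 + 8 . 17 + 10, term by term from the bounds [A1] to [A5]. *)
Lemma sampling_bound :
  (INR mX * (4 * INR L + 7) + 7 + INR mT * (4 * INR L + 8) + 3) * INR k <= 958 * (INR n * INR n).
Proof.
  pose proof table_draws_bounds as [T1 T2]. pose proof active_draws_bounds as [X1 X2].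
  pose proof log_bound as H3. pose proof k_le_16 as H4. pose proof square_le_k as H5.
  set (c := (b * b)%nat) in *. assert (Hbc : (b <= c)%nat) by (unfold c; nia).
  assert (A1 : (mX * L * k <= 96 * (n * n))%nat).
  { transitivity (mX * L * (16 * (c * c)))%nat; [apply Nat.mul_le_mono_l; exact H4|].
    replace (mX * L * (16 * (c * c)))%nat with (16 * ((mX * c) * (L * c)))%nat by ring.
    assert ((mX * c) * (L * c) <= (2 * n) * (3 * n))%nat by (apply Nat.mul_le_mono; assumption). nia. }
  assert (A2 : (mX * k <= 32 * (n * n))%nat).
  { transitivity (mX * (16 * (c * c)))%nat; [apply Nat.mul_le_mono_l; exact H4|].
    replace (mX * (16 * (c * c)))%nat with (16 * ((mX * c) * c))%nat by ring.
    assert ((mX * c) * c <= (2 * n) * n)%nat by (apply Nat.mul_le_mono; lia). nia. }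
  assert (A3 : (mT * L * k <= 51 * (n * n))%nat).
  { replace (mT * L * k)%nat with ((mT * k) * L)%nat by ring.
    transitivity (17 * n * b * L)%nat; [apply Nat.mul_le_mono_r; exact T2|].
    replace (17 * n * b * L)%nat with (17 * n * (L * b))%nat by ring.
    assert (L * b <= 3 * n)%nat by nia. nia. }
  assert (A4 : (mT * k <= 17 * (n * n))%nat) by nia.
  assert (A5 : (k <= n * n)%nat) by nia.
  apply le_INR in A1, A2, A3, A4, A5. rewrite ?mult_INR in *.
  replace (INR 96) with 96 in A1 by (simpl; lra).
  replace (INR 32) with 32 in A2 by (simpl; lra).
  replace (INR 51) with 51 in A3 by (simpl; lra).
  replace (INR 17) with 17 in A4 by (simpl; lra).
  nra.
Qed.

(** 168 = 9 . 17 + 10 + 5, from |T| k <= 17 n b and k <= n. *)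
Lemma unit_cost_bound T : (length T <= mT)%nat ->
  unit_cost T b * INR k <= 168 * INR n * (INR b * INR b).
Proof.
  intros HT. pose proof table_draws_bounds as [_ T2].
  assert (H : ((b * (length T * 9 + 10) + 5) * k <= 168 * n * (b * b))%nat).
  { assert ((length T * k <= 17 * n * b)%nat) by nia.
    replace ((b * (length T * 9 + 10) + 5) * k)%nat with (9 * b * (length T * k) + 10 * (b * k) + 5 * k)%nat by ring.
    assert (b * k <= n * (b * b))%nat by nia. assert (k <= n * (b * b))%nat by nia. nia. }
  apply le_INR in H. unfold unit_cost. rewrite ?mult_INR, ?plus_INR, ?mult_INR, ?plus_INR, ?mult_INR in H.
  replace (INR 168) with 168 in H by (simpl; lra).
  replace (INR 9) with 9 in H by (simpl; lra). replace (INR 10) with 10 in H by (simpl; lra).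
  replace (INR 5) with 5 in H by (simpl; lra). exact H.
Qed.

Lemma count_sampled X : (count (sampled X) (seq 0 n) <= length X)%nat.
Proof.
  apply NoDup_incl_length; [apply NoDup_filter, seq_NoDup|].
  intros x Hx. apply filter_In in Hx. apply sampled_true, Hx.
Qed.

(** 336 = 2 . 168 for the radii of the sampled points, as their number times b^2 is at most 2 n; 33
    for the linear terms of two phases; the rest for two greedy loops, with (l + 1) k <= (17 M + 3)
    n and 20 n + d + 26 <= (d + 46) n. *)
Definition overhead : R := 336 + 33 + 2 * (17 * INR M + 3) * (INR d + 46).

Lemma run_cost_accurate T X : (length T <= mT)%nat -> dense n k T b -> length X = mX ->
  is_accurate d n k pt big b T = true ->
  run_cost d n k pt big b T X * INR k <=
  INR (missed n (rad T) (cov T) X) * (168 * INR n * (INR b * INR b)) + overhead * (INR n * INR n).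
Proof.
  intros HT Hd HX Ha. unfold run_cost. rewrite Ha. apply Nat.leb_le in Ha.
  set (l1 := greedy_list n (rad T) (cov T) (sampled X)).
  set (l2 := greedy_list n (rad T) (cov T) (uncovered (cov T) l1)).
  set (w := missed n (rad T) (cov T) X).
  assert (Hrefl : forall x, cov T x x = true) by (intros; apply (cov_refl d n k pt big)).
  assert (B1 : (k * length l1 <= (17 * M + 2) * n)%nat).
  { apply (greedy_length_bound d n k (n * (d + 1)) pt big big_pos pt_sep pt_big (Nat.le_refl _) k_pos k_le_n T b (sampled X)); auto.
    apply greedy_list_spec. exact Hrefl. }
  assert (B2 : (k * length l2 <= (17 * M + 2) * n)%nat).
  { apply (greedy_length_bound d n k (n * (d + 1)) pt big big_pos pt_sep pt_big (Nat.le_refl _) k_pos k_le_n T b (uncovered (cov T) l1)); auto.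
    apply greedy_list_spec. exact Hrefl. }
  pose proof (unit_cost_bound T HT) as HU.
  pose proof (count_sampled X) as HS. rewrite HX in HS.
  pose proof active_draws_bounds as [_ X2].
  set (a := count (sampled X) (seq 0 n)) in *.
  assert (Hac : (a * (b * b) <= 2 * n)%nat) by nia.
  unfold phase_cost. set (U := unit_cost T b) in *.
  apply le_INR in B1, B2, Hac. rewrite ?mult_INR, ?plus_INR, ?mult_INR in *.
  replace (INR 17) with 17 in * by (simpl; lra). replace (INR 2) with 2 in * by (simpl; lra).
  pose proof (le_INR _ _ k_le_n) as Hkn. pose proof (le_INR _ _ k_pos) as Hk1. simpl (INR 1) in Hk1.
  pose proof (pos_INR a). pose proof (pos_INR w). pose proof (pos_INR d). pose proof (pos_INR M).
  pose proof (pos_INR (length l1)). pose proof (pos_INR (length l2)).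
  set (rn := INR n) in *. set (rk := INR k) in *. set (rb := INR b) in *. set (rd := INR d) in *.
  set (rM := INR M) in *. set (r1 := INR (length l1)) in *. set (r2 := INR (length l2)) in *.
  assert (G1 : (r1 + 1) * rk <= (17 * rM + 3) * rn) by nra.
  assert (G2 : (r2 + 1) * rk <= (17 * rM + 3) * rn) by nra.
  assert (G3 : rn * 20 + rd + 26 <= (rd + 46) * rn) by nra.
  assert (G4 : (r1 + 1) * (rn * 20 + rd + 26) * rk <= (17 * rM + 3) * (rd + 46) * (rn * rn)).
  { replace ((r1 + 1) * (rn * 20 + rd + 26) * rk) with (((r1 + 1) * rk) * (rn * 20 + rd + 26)) by ring.
    replace ((17 * rM + 3) * (rd + 46) * (rn * rn)) with (((17 * rM + 3) * rn) * ((rd + 46) * rn)) by ring.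
    apply Rmult_le_compat; nra. }
  assert (G5 : (r2 + 1) * (rn * 20 + rd + 26) * rk <= (17 * rM + 3) * (rd + 46) * (rn * rn)).
  { replace ((r2 + 1) * (rn * 20 + rd + 26) * rk) with (((r2 + 1) * rk) * (rn * 20 + rd + 26)) by ring.
    replace ((17 * rM + 3) * (rd + 46) * (rn * rn)) with (((17 * rM + 3) * rn) * ((rd + 46) * rn)) by ring.
    apply Rmult_le_compat; nra. }
  assert (G6 : INR a * U * rk <= 336 * (rn * rn)).
  { replace (INR a * U * rk) with (INR a * (U * rk)) by ring.
    eapply Rle_trans; [apply Rmult_le_compat_l; [assumption|exact HU]|].
    replace (INR a * (168 * rn * (rb * rb))) with (168 * rn * (INR a * (rb * rb))) by ring. nra. }
  assert (G7 : INR w * U * rk <= INR w * (168 * rn * (rb * rb))).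
  { rewrite Rmult_assoc. apply Rmult_le_compat_l; assumption. }
  assert (G8 : (rn * 16 + 17) * rk <= 33 * (rn * rn)) by nra.
  unfold overhead. fold rM rd. nra.
Qed.

(** Three greedy loops at (2 d + 92) n^2 each, the radii of two sampled phases and of the exact one,
    rounded up. The exact radii, at O(k n) each, bring in the factor k. *)
Definition slow_factor : R := 6 * INR d + 800.

Lemma run_cost_any T X : (length T <= mT)%nat -> is_accurate d n k pt big b T = false ->
  run_cost d n k pt big b T X <= slow_factor * INR k * (INR n * INR n).
Proof.
  intros HT Ha. unfold run_cost. rewrite Ha.
  pose proof (unit_cost_bound T HT) as HU. pose proof square_le_k as Hbk.
  unfold phase_cost. set (U := unit_cost T b) in *.
  assert (HV : unit_cost (seq 0 n) (k + 1) <= 43 * INR k * INR n).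
  { unfold unit_cost. rewrite length_seq, plus_INR. simpl (INR 1).
    pose proof (le_INR _ _ k_le_n) as Hkn. pose proof (le_INR _ _ k_pos) as Hk1. simpl (INR 1) in Hk1. nra. }
  set (V := unit_cost (seq 0 n) (k + 1)) in *. clearbody U V.
  apply le_INR in Hbk. rewrite mult_INR in Hbk.
  pose proof (le_INR _ _ k_le_n) as Hkn. pose proof (le_INR _ _ k_pos) as Hk1. simpl (INR 1) in Hk1.
  pose proof (pos_INR d).
  set (rn := INR n) in *. set (rk := INR k) in *. set (rb := INR b) in *. set (rd := INR d) in *.
  assert (HU' : U <= 168 * rn).
  { apply Rmult_le_reg_r with rk; [lra|]. eapply Rle_trans; [exact HU|]. nra. }
  assert (G1 : (rn + 1) * (rn * 20 + rd + 26) <= (2 * rd + 92) * (rn * rn)).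
  { replace ((2 * rd + 92) * (rn * rn)) with ((2 * rn) * ((rd + 46) * rn)) by ring.
    apply Rmult_le_compat; nra. }
  assert (G2 : rn * U <= 168 * (rn * rn)) by nra.
  assert (G3 : rn * V <= 43 * rk * (rn * rn)) by nra.
  assert (G4 : rn * 8 + 7 <= 15 * (rn * rn)) by nra.
  assert (G5 : 5 <= 5 * (rn * rn)) by nra.
  assert (G6 : 0 <= rn * rn) by nra.
  assert (G7 : rn * rn <= rk * (rn * rn)) by nra.
  unfold slow_factor. fold rd.
  assert (G8 : rd * (rn * rn) <= rk * (rd * (rn * rn))).
  { assert (0 <= rd * (rn * rn)) by nra. nra. }
  nra.
Qed.

(** At most 2 b^2 Q points are missed on average, each costs 168 n b^2 / k, and b^4 <= k; Q k <= (17
    M + 2) n. *)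
Definition missed_factor : R := 336 * (17 * INR M + 2).

Lemma greedy_list_bound T P : dense n k T b -> is_accurate d n k pt big b T = true ->
  (length (greedy_list n (rad T) (cov T) P) <= (17 * M + 2) * n / k)%nat.
Proof.
  intros Hd Ha. apply Nat.leb_le in Ha. apply Nat.div_le_lower_bound; [lia|].
  apply (greedy_length_bound d n k (n * (d + 1)) pt big big_pos pt_sep pt_big (Nat.le_refl _) k_pos k_le_n T b P); auto.
  apply greedy_list_spec. intros; apply (cov_refl d n k pt big).
Qed.

Lemma range_pos : (0 < N)%nat.
Proof. apply Nat.neq_0_lt_0, Nat.pow_nonzero. lia. Qed.

(** The expectation over X for a fixed table. The cost of a rerun appears multiplied by the number
    of heavy balls, so that linearity suffices when T is averaged later. *)
Lemma expect_run_cost T : (length T <= mT)%nat -> dense n k T b ->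
  expect N mX (fun X => run_cost d n k pt big b T X) * INR k <=
  (missed_factor + overhead) * (INR n * INR n) +
  INR (count (heavy_ball n k pdist big T b) (seq 0 n)) * (slow_factor * INR k * INR k * INR k * INR n).
Proof.
  intros HT Hd. pose proof range_pos as HN.
  pose proof (le_INR _ _ k_le_n) as Hkn. pose proof (le_INR _ _ k_pos) as Hk1. simpl (INR 1) in Hk1.
  pose proof (pos_INR d) as Hd0. pose proof (pos_INR M) as HM0.
  pose proof (pos_INR (count (heavy_ball n k pdist big T b) (seq 0 n))) as Hh0.
  assert (Hslow : 0 < slow_factor) by (unfold slow_factor; lra).
  assert (Hsl : 0 <= slow_factor * INR k * INR k * INR k * INR n)
    by (repeat apply Rmult_le_pos; lra).
  destruct (is_accurate d n k pt big b T) eqn:Ha.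
  - rewrite Rmult_comm, <- expect_scal.
    eapply Rle_trans with (expect N mX (fun X => (168 * INR n * (INR b * INR b)) * INR (missed n (rad T) (cov T) X)
      + overhead * (INR n * INR n))).
    + apply expect_le. intros X [HX _]. rewrite Rmult_comm.
      eapply Rle_trans; [apply run_cost_accurate; assumption|]. lra.
    + rewrite expect_plus, expect_scal, expect_const by exact HN.
      set (Q := ((17 * M + 2) * n / k)%nat).
      pose proof (expect_missed n (rad T) (cov T) N mX Q) as HE.
      assert (HE' : expect N mX (fun l => INR (missed n (rad T) (cov T) l)) <= INR N * INR Q / INR (S mX)).
      { apply HE; auto.
        - intros; apply (cov_refl d n k pt big).
        - intros P. apply greedy_list_bound; assumption. }
      clear HE. set (e := expect N mX _) in *.
      assert (HQ : INR Q * INR k <= (17 * INR M + 2) * INR n).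
      { assert (H : (Q * k <= (17 * M + 2) * n)%nat).
        { rewrite Nat.mul_comm. apply Nat.Div0.mul_div_le. }
        apply le_INR in H. rewrite ?mult_INR, ?plus_INR, ?mult_INR in H.
        replace (INR 17) with 17 in H by (simpl; lra). replace (INR 2) with 2 in H by (simpl; lra). exact H. }
      pose proof active_draws_bounds as [X1 _]. apply le_INR in X1. rewrite !mult_INR in X1.
      assert (HS : 0 < INR (S mX)) by (apply lt_0_INR; lia).
      assert (Hb0 : 1 <= INR b) by (apply (le_INR 1); exact b_pos).
      assert (HbS : INR n <= INR (S mX) * (INR b * INR b)) by (rewrite S_INR; nra).
      assert (HNn : INR N <= 2 * INR n).
      { replace 2 with (INR 2) by (simpl; lra). rewrite <- mult_INR. apply le_INR. lia. }
      (* N Q / (mX + 1) with N <= 2 n and mX b^2 >= n. *)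
      assert (He : e <= 2 * (INR b * INR b) * INR Q).
      { eapply Rle_trans; [exact HE'|]. apply Rmult_le_reg_r with (INR (S mX)); [exact HS|].
        unfold Rdiv. rewrite Rmult_assoc, Rinv_l, Rmult_1_r by lra.
        pose proof (pos_INR Q). pose proof (pos_INR N). nra. }
      assert (Hb4 : INR b * INR b * (INR b * INR b) <= INR k).
      { rewrite <- !mult_INR. apply le_INR.
        replace (b * b * (b * b))%nat with (b ^ 4)%nat by (simpl; lia). exact b_low. }
      pose proof (pos_INR Q) as HQ0.
      assert (H1 : 168 * INR n * (INR b * INR b) * e <= 336 * INR n * (INR k * INR Q)).
      { apply Rle_trans with (168 * INR n * (INR b * INR b) * (2 * (INR b * INR b) * INR Q)).
        - apply Rmult_le_compat_l; [nra|exact He].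
        - replace (168 * INR n * (INR b * INR b) * (2 * (INR b * INR b) * INR Q))
            with (336 * INR n * ((INR b * INR b * (INR b * INR b)) * INR Q)) by ring.
          apply Rmult_le_compat_l; [lra|]. apply Rmult_le_compat_r; lra. }
      assert (H2 : 336 * INR n * (INR k * INR Q) <= missed_factor * (INR n * INR n)).
      { unfold missed_factor. nra. }
      assert (H3 : 0 <= INR (count (heavy_ball n k pdist big T b) (seq 0 n)) * (slow_factor * INR k * INR k * INR k * INR n))
        by (apply Rmult_le_pos; assumption).
      lra.
  - assert (H1 : expect N mX (fun X => run_cost d n k pt big b T X) <= slow_factor * INR k * (INR n * INR n)).
    { rewrite <- (expect_const N mX (slow_factor * INR k * (INR n * INR n))) by exact HN.
      apply expect_le. intros X _. apply run_cost_any; assumption. }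
    (* Markov's inequality in disguise: an inaccurate table has more than n / k heavy balls, so one
       factor n of the cost may be traded for k times their number. *)
    assert (H2 : INR n <= INR k * INR (count (heavy_ball n k pdist big T b) (seq 0 n))).
    { rewrite <- mult_INR. apply le_INR. apply Nat.leb_gt in Ha. lia. }
    assert (H3 : 0 <= (missed_factor + overhead) * (INR n * INR n)).
    { apply Rmult_le_pos; [|nra]. unfold missed_factor, overhead.
      assert (0 <= (17 * INR M + 3) * (INR d + 46)) by nra. lra. }
    eapply Rle_trans; [apply Rmult_le_compat_r; [lra|exact H1]|].
    assert (H4 : slow_factor * INR k * INR k * INR n * INR n <=
      slow_factor * INR k * INR k * INR n * (INR k * INR (count (heavy_ball n k pdist big T b) (seq 0 n)))).
    { apply Rmult_le_compat_l; [repeat apply Rmult_le_pos; lra|exact H2]. }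
    lra.
Qed.

Definition failure_factor : R := slow_factor * (4 ^ 12 * 27).

(** A draw is near with probability at least k / (2 n), so 16 n b / k draws give (1 - y)^mT <=
    e^(-4b); against 2^b <= e^b this leaves e^(-3b), which beats k^3 <= (b + 1)^12. *)
Lemma expect_heavy_bound :
  expect N mT (fun l => INR (count (heavy_ball n k pdist big (valid n l) b) (seq 0 n))) *
    (slow_factor * INR k * INR k * INR k * INR n) <= failure_factor * (INR n * INR n).
Proof.
  pose proof range_pos as HN.
  pose proof (le_INR _ _ k_le_n) as Hkn. pose proof (le_INR _ _ k_pos) as Hk1. simpl (INR 1) in Hk1.
  pose proof (pos_INR d) as Hd0.
  assert (Hslow : 0 < slow_factor) by (unfold slow_factor; lra).
  pose proof (expect_heavy n k pdist big N mT b k_le_n L_low HN b_pos) as HE.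
  set (e := expect N mT _) in *.
  set (y := INR (k + 1) / (2 * INR N)) in *.
  assert (HN0 : 0 < INR N) by (apply lt_0_INR; exact HN).
  assert (HNn : INR N <= 2 * INR n) by (replace 2 with (INR 2) by (simpl; lra); rewrite <- mult_INR; apply le_INR; lia).
  assert (Hk1' : INR (k + 1) = INR k + 1) by (rewrite plus_INR; reflexivity).
  assert (Hnn : INR n <= INR N) by (apply le_INR; exact L_low).
  assert (Hy : y * (2 * INR N) = INR k + 1) by (unfold y; rewrite Hk1'; field; lra).
  assert (Hy0 : 0 <= y <= 1).
  { split; apply Rmult_le_reg_r with (2 * INR N); lra. }
  assert (Hp : (1 - y) ^ mT <= exp (- (4 * INR b))).
  { eapply Rle_trans; [apply pow_one_minus_le; exact Hy0|].
    pose proof table_draws_bounds as [T1 _]. apply le_INR in T1. rewrite !mult_INR in T1.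
    replace (INR 16) with 16 in T1 by (simpl; lra).
    pose proof (pos_INR mT).
    assert (H4 : 4 * INR b <= INR mT * y).
    { apply Rmult_le_reg_r with (4 * INR n); [lra|].
      assert (H5 : INR k <= y * (4 * INR n)).
      { destruct Hy0. assert (y * (2 * INR N) <= y * (4 * INR n)) by (apply Rmult_le_compat_l; lra). lra. }
      assert (H6 : INR mT * INR k <= INR mT * (y * (4 * INR n))) by (apply Rmult_le_compat_l; assumption).
      lra. }
    destruct (Req_dec (4 * INR b) (INR mT * y)) as [->|Hne]; [lra|].
    left. apply exp_increasing. lra. }
  assert (H2b : 2 ^ b <= exp (INR b)).
  { rewrite <- (Rmult_1_r (INR b)), <- exp_mult_INR. apply pow_incr. pose proof two_le_exp_1. lra. }
  assert (Hprod : 2 ^ b * (1 - y) ^ mT <= exp (- (3 * INR b))).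
  { replace (- (3 * INR b)) with (INR b + - (4 * INR b)) by ring. rewrite exp_plus.
    apply Rmult_le_compat; try assumption; apply pow_le; lra. }
  assert (Hk3 : INR k * INR k * INR k * exp (- (3 * INR b)) <= 4 ^ 12 * 27).
  { eapply Rle_trans; [|apply (poly_exp_bound (INR b)); apply pos_INR].
    apply Rmult_le_compat_r; [left; apply exp_pos|].
    assert (Hkb : INR k <= (INR b + 1) ^ 4).
    { replace (INR b + 1) with (INR (b + 1)) by (rewrite plus_INR; reflexivity).
      rewrite <- pow_INR. apply le_INR. lia. }
    replace ((INR b + 1) ^ 12) with ((INR b + 1) ^ 4 * (INR b + 1) ^ 4 * (INR b + 1) ^ 4) by ring.
    apply Rmult_le_compat; try lra; [nra|]. apply Rmult_le_compat; lra. }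
  unfold failure_factor.
  assert (He : e <= INR n * exp (- (3 * INR b))).
  { eapply Rle_trans; [exact HE|]. apply Rmult_le_compat_l; [lra|exact Hprod]. }
  eapply Rle_trans; [apply Rmult_le_compat_r; [repeat apply Rmult_le_pos; lra|exact He]|].
  replace (INR n * exp (- (3 * INR b)) * (slow_factor * INR k * INR k * INR k * INR n))
    with (slow_factor * (INR n * INR n) * (INR k * INR k * INR k * exp (- (3 * INR b)))) by ring.
  replace (slow_factor * (4 ^ 12 * 27) * (INR n * INR n))
    with (slow_factor * (INR n * INR n) * (4 ^ 12 * 27)) by ring.
  apply Rmult_le_compat_l; [nra|exact Hk3].
Qed.

Definition total_factor : R := missed_factor + overhead + failure_factor + 958.

Lemma expected_run_bound :
  (expect N mT (fun l => expect N mX (fun X => run_cost d n k pt big b (valid n l) X) +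
       (INR mX * (4 * INR L + 7) + 7)) + INR mT * (4 * INR L + 8) + 3) * INR k
  <= total_factor * (INR n * INR n).
Proof.
  pose proof range_pos as HN. pose proof sampling_bound as HS. pose proof expect_heavy_bound as HH.
  pose proof (le_INR _ _ k_pos) as Hk1. simpl (INR 1) in Hk1.
  rewrite expect_plus, expect_const by exact HN.
  assert (H1 : expect N mT (fun l => expect N mX (fun X => run_cost d n k pt big b (valid n l) X)) * INR k <=
    (missed_factor + overhead) * (INR n * INR n) + failure_factor * (INR n * INR n)).
  { rewrite Rmult_comm, <- expect_scal.
    eapply Rle_trans with (expect N mT (fun l => (missed_factor + overhead) * (INR n * INR n) +
      (slow_factor * INR k * INR k * INR k * INR n) *
      INR (count (heavy_ball n k pdist big (valid n l) b) (seq 0 n)))).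
    - apply expect_le. intros l [Hl _]. rewrite Rmult_comm.
      eapply Rle_trans; [apply expect_run_cost|].
      + rewrite <- Hl. apply filter_length_le.
      + apply (valid_dense d n k (n * (d + 1)) b); auto.
      + lra.
    - rewrite expect_plus, expect_const, expect_scal by exact HN. lra. }
  unfold total_factor. lra.
Qed.

End Bound.

(** * Correctness and total expected time *)

Lemma rwf_distance d e1 e2 : iwf e1 = true -> iwf e2 = true -> rwf (10 + d) (distance d e1 e2) = true.
Proof.
  intros H1 H2. unfold distance. cbn [rwf].
  assert (H : forall l, (forall j, In j l -> (j < d)%nat) -> rwf (10 + d) (sq_dist l e1 e2) = true).
  { induction l as [|j l IH]; intros Hl; [reflexivity|].
    cbn [sq_dist rwf]. rewrite H1, H2, IH by (intros; apply Hl; simpl; auto).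
    replace (Nat.ltb (10 + j) (10 + d)) with true; [reflexivity|].
    symmetry. apply Nat.ltb_lt. specialize (Hl j (or_introl eq_refl)). lia. }
  apply H. intros j Hj. apply in_seq in Hj. lia.
Qed.

Lemma cwf_block w l : (forall c, In c l -> cwf w c = true) -> cwf w (block l) = true.
Proof.
  induction l as [|c l IH]; intros H; [reflexivity|].
  cbn [block fold_right cwf]. rewrite H by (simpl; auto). apply IH. intros; apply H; simpl; auto.
Qed.

Lemma iwf_times m e : iwf e = true -> iwf (times m e) = true.
Proof. intros H. induction m as [|m IH]; simpl; [reflexivity|]. rewrite H. exact IH. Qed.

Lemma cwf_main d : cwf (10 + d) (main d) = true.
Proof.
  assert (Hd : forall e1 e2, iwf e1 = true -> iwf e2 = true -> rwf (10 + d) (distance d e1 e2) = true)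
    by (intros; apply rwf_distance; assumption).
  assert (H1 : cwf (10 + d) (read_input d) = true).
  { unfold read_input, for_loop. cbn [cwf]. rewrite cwf_block; [reflexivity|].
    intros c Hc. apply in_map_iff in Hc. destruct Hc as (j & <- & Hj). apply in_seq in Hj.
    cbn [cwf]. replace (Nat.ltb (10 + j) (10 + d)) with true; [reflexivity|].
    symmetry. apply Nat.ltb_lt. lia. }
  assert (H2 : cwf (10 + d) (output_ball d) = true).
  { unfold output_ball. cbn [cwf]. rewrite cwf_block.
    - cbn [iwf]. rewrite iwf_times by reflexivity. reflexivity.
    - intros c Hc. apply in_map_iff in Hc. destruct Hc as (j & <- & Hj). apply in_seq in Hj.
      cbn [cwf iwf rwf]. rewrite iwf_times by reflexivity.
      replace (Nat.ltb (10 + j) (10 + d)) with true; [reflexivity|].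
      symmetry. apply Nat.ltb_lt. lia. }
  unfold main. cbn [cwf]. rewrite H1.
  unfold find_big, phases, active_radii, greedy_loop, point_radius, next_radius, count_table, process,
    measure_ball, mark_ball, dist_table, rassign, for_loop.
  cbn [cwf bwf]. rewrite H2, !Hd by reflexivity. reflexivity.
Qed.

(** Read off the initial registers through the layout with base n (d + 1), so that the simulation
    holds by computation once the base register is set. *)
Definition initial_store (d : nat) (S : list (list R)) (k : nat) : store :=
  let s := init_state d S k in
  mkStore (fun a i => im s (30 * i + a)%nat)
    (fun a i => rm s (length S * (d + 1) + (10 + d) * i + a)%nat) (rm s).

(** The prefix adds n to the base register, initially 0, d + 1 times: the registers below it have
    room for the input and for n balls. *)
Definition cover_program (d : nat) : program :=
  add_times base 0 (d + 1) ++ ccode (10 + d) (d + 1) (main d).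

(** * Transfer to the machine *)

Section Final.

Variables (d : nat) (pts : list (list R)) (k0 : nat).

Hypothesis valid_pts : valid_input d pts k0.

Notation n := (length pts).
Notation k := (Nat.min k0 n).
Notation M := (multiplicity d).

Definition point (i : nat) : list R := nth i pts [].

Lemma point_sep x y : (x < n)%nat -> (y < n)%nat -> x <> y -> 0 < point_dist d point x y.
Proof.
  intros Hx Hy Hxy. destruct valid_pts as (H1 & H2 & _).
  destruct (Rle_lt_or_eq_dec 0 (point_dist d point x y) (edist_nonneg _ _ _)) as [H|H]; [exact H|exfalso].
  rewrite Forall_forall in H2. apply Hxy.
  apply (proj1 (NoDup_nth pts []) H1); [exact Hx|exact Hy|].
  apply edist_zero with (d := d); [apply H2, nth_In, Hx|apply H2, nth_In, Hy|]. symmetry. exact H.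
Qed.

Lemma points_eq : pts = map point (seq 0 n).
Proof.
  apply nth_ext with (d := []) (d' := []).
  - rewrite length_map, length_seq. reflexivity.
  - intros i Hi. rewrite (nth_indep (map point (seq 0 n)) [] (point 0)) by (rewrite length_map, length_seq; exact Hi).
    rewrite map_nth, seq_nth by exact Hi. reflexivity.
Qed.

Definition center_at (s : store) (idx c : nat) : Prop :=
  forall j, (j < d)%nat -> low s (idx * (d + 1) + j) = nth j (point c) 0.

Definition radius_at (s : store) (idx : nat) : R := low s (idx * (d + 1) + d).

(** The output conditions with centers named by point indices. Coordinates agree with those of a
    point only below d, which is all that [dist2] sees. *)
Record good_store (s : store) : Prop := {
  good_le : (ia s 0 0 <= n)%nat;
  good_few : (k * ia s 0 0 <= (34 * M + 3) * n)%nat;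
  good_ball : forall idx, (idx < ia s 0 0)%nat -> exists c, center_at s idx c /\
    0 < radius_at s idx /\
    (count (fun i => Rleb (point_dist d point i c) (radius_at s idx)) (seq 0 n) <= k)%nat;
  good_cover : forall i, (i < n)%nat -> exists idx c, (idx < ia s 0 0)%nat /\
    center_at s idx c /\ point_dist d point i c <= radius_at s idx }.

Lemma count_eqb_le c m : (count (fun i => Nat.eqb i c) (seq 0 m) <= 1)%nat.
Proof.
  assert (H : NoDup (filter (fun i => Nat.eqb i c) (seq 0 m))) by (apply NoDup_filter, seq_NoDup).
  unfold count. etransitivity; [apply (NoDup_incl_length (l' := [c]) H)|reflexivity].
  intros i Hi. apply filter_In in Hi. destruct Hi as [_ E]. apply Nat.eqb_eq in E. simpl. auto.
Qed.

Lemma output_good big s : (1 <= n)%nat -> output d n k point big s -> good_store s.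
Proof.
  intros Hn (s1 & (T & m & sel & Hc & Hall & Hlen) & ->).
  assert (Hk1 : (1 <= k)%nat) by (destruct valid_pts as (_ & _ & H); lia).
  assert (E0 : ia (setI s1 0 0 (ia s1 15 0)) 0%nat 0%nat = length sel)
    by (cbn [setI ia]; rewrite upd2_same; apply (config_count _ _ _ _ _ _ _ _ _ _ Hc)).
  assert (Hidx : forall idx, (idx < length sel)%nat -> (nth idx sel 0 < n)%nat).
  { intros idx Hidx. apply (config_in _ _ _ _ _ _ _ _ _ _ Hc). apply nth_In. exact Hidx. }
  assert (Hle : (length sel <= length (seq 0 n))%nat).
  { apply NoDup_incl_length; [apply (config_NoDup _ _ _ _ _ _ _ _ _ _ Hc)|].
    intros x Hx. apply in_seq. pose proof (config_in _ _ _ _ _ _ _ _ _ _ Hc x Hx). lia. }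
  rewrite length_seq in Hle.
  constructor; rewrite ?E0.
  - exact Hle.
  - exact Hlen.
  - intros idx Hi.
    destruct (config_balls _ _ _ _ _ _ _ _ _ _ Hc idx Hi) as (B1 & B2 & B3).
    set (c := nth idx sel 0%nat) in *. exists c. split; [exact B1|]. split; [exact B2|].
    change (radius_at (setI s1 0 0 (ia s1 15 0)) idx) with (low s1 (idx * (d + 1) + d)).
    rewrite (count_ext _ (covers n k (point_dist d point) big T m c)).
    + unfold covers. destruct (light_ball n k (point_dist d point) big T m c) eqn:El.
      * apply andb_true_iff in El. destruct El as [_ El]. apply Nat.leb_le in El. exact El.
      (* A ball that is not light contains only its center, and k >= 1. *)
      * pose proof (count_eqb_le c n). lia.
    + intros i Hin. apply in_seq in Hin. apply B3. lia.
  - intros i Hi. specialize (Hall i Hi). apply existsb_exists in Hall.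
    destruct Hall as (c & Hcin & Hcov). apply In_nth with (d := 0%nat) in Hcin.
    destruct Hcin as (idx & Hi2 & Ec). exists idx, c. split; [exact Hi2|].
    destruct (config_balls _ _ _ _ _ _ _ _ _ _ Hc idx Hi2) as (B1 & B2 & B3). rewrite Ec in *.
    split; [exact B1|]. apply Rleb_true. rewrite <- Hcov. apply B3. exact Hi.
Qed.

Lemma empty_good s : n = 0%nat -> ia s 0 0 = n -> good_store s.
Proof. intros Hn E. constructor; rewrite ?E, ?Hn; intros; simpl in *; lia. Qed.

Notation beta := (n * (d + 1))%nat.
Notation w := (10 + d)%nat.
Notation s0 := (initial_store d pts k0).

Lemma initial_low i j : (i < n)%nat -> (j < d)%nat -> low s0 (i * d + j) = nth j (point i) 0.
Proof.
  intros Hi Hj. unfold initial_store, init_state. cbn [low rm].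
  replace (Nat.ltb (i * d + j) (n * d)) with true by (symmetry; apply Nat.ltb_lt; nia).
  rewrite Nat.div_add_l, Nat.div_small, Nat.add_0_r by lia.
  rewrite Nat.add_comm, Nat.Div0.mod_add, Nat.mod_small by lia. reflexivity.
Qed.

Lemma initial_status i : ia s0 13 i = 0%nat.
Proof.
  unfold initial_store, init_state. cbn [ia im].
  replace (30 * i + 13)%nat with (S (S (S (30 * i + 10)))) by lia. reflexivity.
Qed.

Lemma ecost_mono c (K K' : store -> R -> Prop) : (forall s B, K s B -> K' s B) ->
  forall s B, ecost beta c K s B -> ecost beta c K' s B.
Proof.
  intros HK s B H. revert K' HK. induction H; intros K' HK.
  - apply ecost_skip; auto.
  - apply ecost_setI; auto.
  - apply ecost_setR; auto.
  - apply ecost_setLow; auto.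
  - apply ecost_getLow; auto.
  - apply ecost_flip; auto.
  - eapply ecost_seq; [exact H|]. intros; eauto.
  - apply ecost_if; auto.
  - apply ecost_while_false; auto.
  - eapply ecost_while_true; [assumption|eassumption|]. intros; eauto.
  - eapply ecost_weaken; [auto|assumption].
Qed.

Definition run_factor : R := total_factor d + INR d + 40.

(** The linear preprocessing is absorbed because n <= n^2 / k after k has been cut down to n. The
    summand 1 covers the empty input. *)
Lemma ecost_main : exists B, ecost beta (main d) (fun s B' => good_store s /\ B' = 0) s0 B /\
  B <= run_factor * (INR n * INR n / INR k + 1) /\ 0 <= B.
Proof.
  assert (Hf : 0 <= run_factor - total_factor d) by (unfold run_factor; pose proof (pos_INR d); lra).
  assert (Ht : 0 <= total_factor d).
  { unfold total_factor, missed_factor, overhead, failure_factor, slow_factor.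
    pose proof (pos_INR d). pose proof (pos_INR M).
    assert (0 <= (17 * INR M + 3) * (INR d + 46)) by nra.
    assert (0 <= (6 * INR d + 800) * (4 ^ 12 * 27)) by (apply Rmult_le_pos; lra). lra. }
  pose proof (pos_INR k) as Hk0.
  destruct (Nat.eq_dec n 0) as [Hn0|Hn0].
  - exists 1. split; [|split; [|lra]].
    + unfold main. replace 1 with (0 + 1) by lra. apply ecost_if.
      cbn [beval ieval var]. change (ia s0 0 0) with n. rewrite Hn0. cbn [Nat.leb].
      apply ecost_skip. split; [|reflexivity]. apply empty_good; [exact Hn0|reflexivity].
    + rewrite Hn0. simpl (INR 0). unfold Rdiv. rewrite !Rmult_0_l.
      unfold run_factor in *. pose proof (pos_INR d). lra.
  - assert (Hn1 : (1 <= n)%nat) by lia.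
    assert (Hk1 : (1 <= k)%nat) by (destruct valid_pts as (_ & _ & H); lia).
    assert (Hkn : (k <= n)%nat) by lia.
    set (Bd := total_factor d * (INR n * INR n) / INR k).
    set (pre := INR n * (INR d + 3) + 3 + (INR n * 4 + 4) + (2 * INR k + 2) + (2 * INR n + 2) + 3).
    exists (Bd + pre).
    assert (Hk1' : 1 <= INR k) by (apply (le_INR 1); exact Hk1).
    assert (Hkn' : INR k <= INR n) by (apply le_INR; exact Hkn).
    split; [|split].
    + unfold main. eapply ecost_weaken with (B := Bd + (2 * INR n + 2) + (2 * INR k + 2) + (INR n * 4 + 4)
        + (INR n * (INR d + 3) + 3) + 2 + 1); [|unfold pre; lra].
      apply ecost_if. cbn [beval ieval var]. change (ia s0 0 0) with n.
      replace (Nat.leb n 0) with false by (symmetry; apply Nat.leb_gt; lia).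
      eapply ecost_seq_det with (Q := fun s => ia s 0 0 = n /\ ia s 1 0 = k /\
        low s = low s0 /\ forall i, ia s 13 i = 0%nat).
      { apply det_branch. cbn [beval ieval var]. change (ia s0 0 0) with n.
        change (ia s0 1 0) with k0. destruct (Nat.leb_spec n k0).
        - apply det_last_setI; [lra|]. cbn [ieval var setI ia low].
          split; [reflexivity|]. split; [|split; [reflexivity|intros i; apply initial_status]].
          rewrite upd2_same. change (ia s0 0 0) with n. lia.
        - apply det_last_skip; [lra|]. split; [reflexivity|]. split; [change (ia s0 1 0) with k0; lia|].
          split; [reflexivity|intros i; apply initial_status]. }
      intros s1 (E0 & E1 & El & E13).
      eapply ecost_seq_det; [apply det_read_input with (n := n) (pt := point); auto|].
      { intros i j Hi Hj. rewrite El. apply initial_low; assumption. }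
      intros s2 (I2 & R2).
      assert (He2 : env d n k point (ra s2 1 0) s2).
      { constructor; auto; rewrite I2 by lia; assumption. }
      eapply ecost_seq_det; [apply det_find_big with (n := n) (k := k) (pt := point); auto|].
      intros s3 (K3 & P3 & D3). set (big := ra s3 1 0) in *.
      assert (He3 : env d n k point big s3).
      { destruct He2 as [A1 A2 A3 A4]. constructor; auto; try (use_keep K3; assumption).
        intros i j Hi Hj. rewrite (proj1 (proj2 K3)) by (simpl; lia). auto. }
      eapply ecost_seq_det; [apply det_find_root with (k := k); auto|].
      { apply (env_k _ _ _ _ _ _ He3). }
      intros s4 (K4 & b & H5 & Hb1 & Hb2 & Hb3).
      eapply ecost_seq_det; [apply det_find_range with (n := n); auto|].
      { use_keep K4. apply (env_n _ _ _ _ _ _ He3). }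
      intros s5 (K5 & L & H6 & HL1 & HL2).
      assert (K45 : keep [5; 6]%nat [] s3 s5).
      { eapply keep_trans; [eapply keep_incl; [| |exact K4]|eapply keep_incl; [| |exact K5]]; intros a; simpl; tauto. }
      pose proof (ecost_sampled_part d n k beta point big b L P3 point_sep D3 (Nat.le_refl _) Hk1 Hkn Hb1 s5) as HR.
      pose proof (expected_run_bound d n k point big b L P3 point_sep D3 Hk1 Hkn Hb1 Hb2 Hb3 HL1 HL2) as HB.
      set (E := expect _ _ _ + _ + 3) in *.
      assert (HE : E <= Bd).
      { apply Rmult_le_reg_r with (INR k); [lra|]. eapply Rle_trans; [exact HB|].
        unfold Bd. right. field. lra. }
      eapply ecost_weaken; [|exact HE].
      eapply ecost_mono; [|apply HR].
      * intros s' B' [Ho ->]. split; [|reflexivity]. eapply output_good; eassumption.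
      * eapply env_keep; [exact He3|exact K45|index_tac|index_tac].
      * use_keep K5. exact H5.
      * exact H6.
      * intros i Hi. use_keep K5. use_keep K4. use_keep K3. rewrite I2 by lia. apply E13.
    + apply Rmult_le_reg_r with (INR k); [lra|].
      replace (run_factor * (INR n * INR n / INR k + 1) * INR k) with (run_factor * (INR n * INR n + INR k))
        by (field; lra).
      unfold Bd, pre.
      replace ((total_factor d * (INR n * INR n) / INR k + _) * INR k) with
        (total_factor d * (INR n * INR n) + pre * INR k) by (unfold pre; field; lra).
      unfold run_factor, pre. pose proof (pos_INR d).
      assert (H1 : INR n * INR k <= INR n * INR n) by nra.
      assert (H2 : INR k * INR k <= INR n * INR n) by nra.
      assert (H3 : 0 <= total_factor d * INR k) by (apply Rmult_le_pos; assumption).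
      assert (H4 : 0 <= INR d * INR k) by (apply Rmult_le_pos; assumption).
      assert (H5' : INR d * (INR n * INR k) <= INR d * (INR n * INR n))
        by (apply Rmult_le_compat_l; assumption).
      assert (H6' : 0 <= INR n * INR n) by nra.
      lra.
    + unfold Bd, pre. pose proof (pos_INR d).
      assert (0 <= total_factor d * (INR n * INR n) / INR k).
      { apply Rmult_le_pos; [apply Rmult_le_pos; nra|]. left. apply Rinv_0_lt_compat. lra. }
      assert (0 <= INR n * (INR d + 3)) by nra. lra.
Qed.

Definition count_factor : R := 34 * INR M + 3.

Lemma dist2_nth x y y' : (forall j, (j < d)%nat -> nth j y 0 = nth j y' 0) -> dist2 d x y = dist2 d x y'.
Proof. intros H. rewrite !dist2_rsum. apply rsum_ext. intros j Hj. rewrite H by exact Hj. reflexivity. Qed.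

Lemma nth_map_seq (f : nat -> R) m j : (j < m)%nat -> nth j (map f (seq 0 m)) 0 = f j.
Proof.
  intros Hj. rewrite (nth_indep _ 0 (f 0%nat)) by (rewrite length_map, length_seq; exact Hj).
  rewrite map_nth, seq_nth by exact Hj. reflexivity.
Qed.

Lemma good_output a s mm : good_store s -> sim w beta s mm ->
  good_cover_output d count_factor pts k0 (at_pc a mm).
Proof.
  intros [G1 G2 G3 G4] (I & _ & _ & Hlow).
  assert (Hq : out_count (at_pc a mm) = ia s 0 0).
  { unfold out_count, at_pc. cbn [im]. apply (I 0%nat 0%nat). lia. }
  assert (Hrad : forall idx, (idx < ia s 0 0)%nat -> out_radius d (at_pc a mm) idx = radius_at s idx).
  { intros idx Hi. unfold out_radius, at_pc, radius_at. cbn [rm]. apply Hlow. nia. }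
  assert (Hdist : forall idx c x, (idx < ia s 0 0)%nat -> center_at s idx c ->
    dist2 d x (out_center d (at_pc a mm) idx) = dist2 d x (point c)).
  { intros idx c x Hi Hc. apply dist2_nth. intros j Hj. unfold out_center, at_pc. cbn [rm].
    rewrite nth_map_seq by exact Hj. rewrite Hlow by nia. apply Hc. exact Hj. }
  unfold good_cover_output. cbv zeta. rewrite Hq. split; [|split; [|split]].
  - destruct valid_pts as (_ & _ & Hk0).
    assert (Hk1 : 1 <= INR k0) by (apply (le_INR 1); exact Hk0).
    unfold count_factor. pose proof (pos_INR M). pose proof (pos_INR n) as Hn0.
    apply le_INR in G2. rewrite !mult_INR, plus_INR, mult_INR in G2.
    replace (INR 34) with 34 in G2 by (simpl; lra). replace (INR 3) with 3 in G2 by (simpl; lra).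
    apply le_INR in G1.
    assert (Hdiv : 0 <= INR n / INR k0).
    { apply Rmult_le_pos; [exact Hn0|]. left. apply Rinv_0_lt_compat. lra. }
    destruct (Nat.le_gt_cases k0 n) as [Hle|Hgt].
    + rewrite Nat.min_l in G2 by exact Hle.
      apply Rle_trans with ((34 * INR M + 3) * (INR n / INR k0)); [|nra].
      apply Rmult_le_reg_r with (INR k0); [lra|].
      replace ((34 * INR M + 3) * (INR n / INR k0) * INR k0) with ((34 * INR M + 3) * INR n) by (field; lra).
      lra.
    (* For k0 > n the bound is a constant number of balls, which the summand 1 beside n / k0
       provides. *)
    + rewrite Nat.min_r in G2 by lia.
      destruct (Req_dec (INR n) 0) as [Hz|Hz].
      * assert (INR (ia s 0 0) <= 0) by lra. nra.
      * assert (INR (ia s 0 0) <= 34 * INR M + 3); [|nra].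
        apply Rmult_le_reg_r with (INR n); lra.
  - intros idx Hi. rewrite Hrad by exact Hi. destruct (G3 idx Hi) as (c & _ & H & _). exact H.
  - intros x Hx. apply In_nth with (d := []) in Hx. destruct Hx as (i & Hi & <-).
    destruct (G4 i Hi) as (idx & c & Hidx & Hc & Hd). exists idx. split; [exact Hidx|].
    unfold in_ball. rewrite Hrad by exact Hidx. rewrite (Hdist idx c) by assumption. exact Hd.
  - intros idx Hi. rewrite Hrad by exact Hi. destruct (G3 idx Hi) as (c & Hc & _ & Hcnt).
    transitivity (Nat.min k0 n); [|lia]. etransitivity; [|exact Hcnt].
    unfold count_in_ball. rewrite points_eq at 1. rewrite filter_map_length.
    unfold count. apply Nat.eq_le_incl. f_equal. apply filter_ext. intros i.
    unfold in_ballb. rewrite (Hdist idx c) by assumption. reflexivity.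
Qed.

Lemma program_within kappa : INR (length (ccode w (d + 1) (main d))) + 3 <= kappa -> exists B,
  within (cover_program d) (good_cover_output d count_factor pts k0) (init_state d pts k0)
    (kappa * B + INR (d + 1)) /\
  B <= run_factor * (INR n * INR n / INR k + 1).
Proof.
  intros Hk. destruct ecost_main as (B & HE & HB & HB0). exists B. split; [|exact HB].
  set (mm0 := (rm (init_state d pts k0), im (init_state d pts k0))).
  change (init_state d pts k0) with (at_pc 0 mm0).
  assert (Hc : code_at (cover_program d) 0 (add_times base 0 (d + 1) ++ ccode w (d + 1) (main d)))
    by (intros j _; reflexivity).
  apply code_at_app in Hc. destruct Hc as [Hc1 Hc2]. rewrite length_add_times in Hc2.
  destruct (exec_add_times_from base 0) with (n := (d + 1)%nat) (r := fst mm0) (m := snd mm0)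
    as (m1 & E1 & V1 & O1); [unfold base; lia|].
  assert (Hsim : sim w beta s0 (fst mm0, m1)).
  { split; [|split; [|split]].
    - intros a i Ha. cbn [snd]. rewrite O1 by (unfold base; lia). reflexivity.
    - cbn [snd]. rewrite V1. change (snd mm0 base) with 0%nat. change (snd mm0 0%nat) with n. lia.
    - intros a i _. reflexivity.
    - intros i _. reflexivity. }
  replace (INR (d + 1)) with (INR (length (add_times base 0 (d + 1)))) by (rewrite length_add_times; reflexivity).
  apply within_straight; [exact Hc1|apply straight_add_times|].
  rewrite (surjective_pairing mm0), E1, length_add_times.
  rewrite <- (Rplus_0_r (kappa * B)).
  eapply (ecost_sound w beta) with (1 := Nat.lt_0_succ _ : (1 <= w)%nat) (2 := HE);
    [apply cwf_main|exact Hc2|exact Hsim|lra|exact Hk|].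
  intros s' B' mm' [Hg ->] Hs'.
  apply within_halted.
  (* The program halts by running past its end, where [cur] defaults to [Halt]. *)
  - unfold halted, cur, at_pc. cbn [pc]. rewrite nth_overflow; [reflexivity|].
    unfold cover_program. rewrite length_app, length_add_times. rewrite Nat.add_0_l. apply Nat.le_refl.
  - eapply good_output; eassumption.
  - lra.
Qed.

End Final.

Theorem mainTheorem6 :
  forall d : nat,
  exists (p : program) (C : R),
    0 < C /\
    forall (S : list (list R)) (k : nat),
      valid_input d S k ->
      (* correctness on every run that halts (Las Vegas) *)
      (forall bits : list bool,
          halted p (run p bits (init_state d S k)) = true ->
          good_cover_output d C S k (run p bits (init_state d S k))) /\
      (* expected running time O_d(n^2/k) *)
      expected_time_le p (init_state d S k)
        (C * (INR (length S) ^ 2 / INR k + INR (length S) + 1)).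
Proof.
  intros d.
  set (kappa := INR (length (ccode (10 + d) (d + 1) (main d))) + 3).
  set (C0 := count_factor d). set (C1 := kappa * run_factor d).
  assert (Hkappa : 3 <= kappa) by (unfold kappa; pose proof (pos_INR (length (ccode (10 + d) (d + 1) (main d)))); lra).
  assert (HC0 : 3 <= C0) by (unfold C0, count_factor; pose proof (pos_INR (multiplicity d)); lra).
  assert (Hrun : 0 <= run_factor d).
  { unfold run_factor, total_factor, missed_factor, overhead, failure_factor, slow_factor.
    pose proof (pos_INR d). pose proof (pos_INR (multiplicity d)).
    assert (0 <= (17 * INR (multiplicity d) + 3) * (INR d + 46)) by nra.
    assert (0 <= (6 * INR d + 800) * (4 ^ 12 * 27)) by (apply Rmult_le_pos; lra). lra. }
  assert (HC1 : 0 <= C1) by (apply Rmult_le_pos; lra).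
  (* One constant for both claims: [C0] bounds the number of balls, [C1] the time of the compiled
     command, and d + 1 is the prefix that sets the base register. *)
  exists (cover_program d), (C0 + (2 * C1 + INR (d + 1))).
  pose proof (pos_INR (d + 1)) as Hd1.
  split; [lra|]. intros S k Hv.
  destruct (program_within d S k Hv kappa (Rle_refl _)) as (B & [HW1 HW2] & HB).
  set (n := length S) in *.
  destruct Hv as (_ & _ & Hk). assert (Hk1 : 1 <= INR k) by (apply (le_INR 1); exact Hk).
  pose proof (pos_INR n) as Hn0.
  assert (Hdiv : 0 <= INR n / INR k).
  { apply Rmult_le_pos; [exact Hn0|]. left. apply Rinv_0_lt_compat. lra. }
  assert (Hdiv2 : 0 <= INR n ^ 2 / INR k).
  { apply Rmult_le_pos; [nra|]. left. apply Rinv_0_lt_compat. lra. }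
  split.
  - intros bits Hh. destruct (HW2 bits Hh) as (G1 & G2 & G3 & G4).
    split; [|split; [exact G2|split; [exact G3|exact G4]]].
    eapply Rle_trans; [exact G1|]. fold n C0. apply Rmult_le_compat_r; lra.
  - intros N. eapply Rle_trans; [apply HW1|].
    set (q := INR n ^ 2 / INR k) in *.
    (* The run uses min(k, n); for k > n the quotient is n, which is where the linear term of the
       time bound is spent. *)
    assert (Hq : INR n * INR n / INR (Nat.min k n) <= q + INR n).
    { destruct (Nat.le_gt_cases k n) as [Hle|Hgt].
      - rewrite Nat.min_l by exact Hle. unfold q. simpl pow. rewrite Rmult_1_r. lra.
      - rewrite Nat.min_r by lia. destruct (Req_dec (INR n) 0) as [Hz|Hz].
        + rewrite Hz. unfold Rdiv. rewrite !Rmult_0_l. lra.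
        + replace (INR n * INR n / INR n) with (INR n) by (field; exact Hz). lra. }
    assert (HB2 : B <= run_factor d * (q + INR n + 1)).
    { eapply Rle_trans; [exact HB|]. apply Rmult_le_compat_l; lra. }
    assert (HkB : kappa * B <= C1 * (q + INR n + 1)).
    { unfold C1. rewrite Rmult_assoc. apply Rmult_le_compat_l; lra. }
    assert (H1 : INR (d + 1) <= INR (d + 1) * (q + INR n + 1)) by nra.
    assert (H2 : 0 <= (C0 + C1) * (q + INR n + 1)) by (apply Rmult_le_pos; lra).
    lra.
Qed.
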